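(* Let $k\in\mathbb N$ and let $s\ge2$ be real. Let $\Delta^*_s$ be an admissible exponent for minor arcs (as defined in the context). Then for every $\varepsilon>0$ there exists $\eta>0$ such that, for all sufficiently large $P$, all $R$ with $2\le R\le P^\eta$, and all real $Q$ with $1\le Q\le \tfrac12 P^{k/2}R^{-k}$, one has \[ \int_{\mathfrak N(Q,P)}|f(\alpha;P,R)|^s\,d\alpha\ll P^{s-k+\varepsilon}Q^{2\Delta^*_s/k}, \] with implied constant depending only on $\varepsilon,\eta,k,s$.
   Context: For real $P,R\ge1$, $\mathscr A(P,R)$ is the set of integers $n\in[1,P]$ all of whose prime divisors are at most $R$; $e(z)=e^{2\pi iz}$; $f(\alpha;P,R)=\sum_{x\in\mathscr A(P,R)}e(\alpha x^k)$; $U_u(P,R)=\int_0^1|f(\alpha;P,R)|^u\,d\alpha$. A real $\Delta_u$ is an admissible exponent (for $k$) if for every $\varepsilon>0$ there is $\eta>0$ (depending on $\varepsilon,k,u$) such that for $P$ sufficiently large and $1\le R\le P^\eta$ one has $U_u(P,R)\le CP^{u-k+\Delta_u+\varepsilon}$ with $C=C(\varepsilon,\eta,k,u)$. Suppose admissible exponents $\Delta_u$ have been fixed for each $u>0$ under consideration, and set $\tau(k)=\max_{w\in\mathbb N}(k-2\Delta_{2w})/(4w^2)$ (assumed to be attained). Suppose admissible exponents $\Delta_u$ are given for $2\le u\le s$; then $\Delta_s^*=\min_{0\le t\le s-2}(\Delta_{s-t}-t\tau(k))$ is called an admissible exponent for minor arcs. For $1\le Q\le P^{k/2}$, $\mathfrak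 M(Q,P)$ is the union over integers $1\le q\le Q$, $0\le a\le q$, $(a,q)=1$, of $\{\alpha\in[0,1):|q\alpha-a|\le QP^{-k}\}$, and $\mathfrak N(Q,P)=\mathfrak M(Q,P)\setminus\mathfrak M(Q/2,P)$. *)

(* Defs.v *)
From HB Require Import structures.
From mathcomp Require Import all_boot all_order all_algebra.
From mathcomp Require Import all_classical all_reals all_analysis.
Set Implicit Arguments. Unset Strict Implicit. Unset Printing Implicit Defensive.
Import Order.TTheory GRing.Theory Num.Theory.
Local Open Scope ring_scope.
Local Open Scope classical_set_scope.

Section Defs.
Variable R : realType.

Definition smooth_set (P Rr : R) : seq nat :=
  [seq n <- iota 1 (Num.truncn P) | all (fun p => p%:R <= Rr) (primes n)].

Definition f_re (k : nat) (P Rr alpha : R) : R :=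
  \sum_(x <- smooth_set P Rr) cos (2 * pi * alpha * (x ^ k)%:R).
Definition f_im (k : nat) (P Rr alpha : R) : R :=
  \sum_(x <- smooth_set P Rr) sin (2 * pi * alpha * (x ^ k)%:R).

Definition f_abs (k : nat) (P Rr alpha : R) : R :=
  Num.sqrt (f_re k P Rr alpha ^+ 2 + f_im k P Rr alpha ^+ 2).

Definition U (k : nat) (u P Rr : R) : \bar R :=
  (\int[lebesgue_measure]_(alpha in `[0%R, 1%R]) ((f_abs k P Rr alpha) `^ u)%:E)%E.

Definition admissible (k : nat) (u Du : R) : Prop :=
  forall eps : R, 0 < eps -> exists eta : R, 0 < eta /\
    exists C P0 : R, forall P Rr : R, P0 <= P -> 1 <= Rr -> Rr <= P `^ eta ->
      (U k u P Rr <= (C * P `^ (u - k%:R + Du + eps))%:E)%E.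

Definition is_tau (k : nat) (Delta : R -> R) (tau : R) : Prop :=
  (exists w : nat, (0 < w)%N /\
     tau = (k%:R - 2 * Delta (2 * w%:R)) / (4 * w%:R ^+ 2)) /\
  (forall w : nat, (0 < w)%N ->
     (k%:R - 2 * Delta (2 * w%:R)) / (4 * w%:R ^+ 2) <= tau).

Definition is_minor_arc_exponent (s : R) (Delta : R -> R) (tau Dstar : R)
    : Prop :=
  (exists t : R, 0 <= t /\ t <= s - 2 /\ Dstar = Delta (s - t) - t * tau) /\
  (forall t : R, 0 <= t -> t <= s - 2 -> Dstar <= Delta (s - t) - t * tau).

Definition Marcs (k : nat) (Q P : R) : set R :=
  [set alpha | 0 <= alpha /\ alpha < 1 /\
     exists q a : nat, (1 <= q)%N /\ q%:R <= Q /\ (a <= q)%N /\ coprime a q /\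
       `|q%:R * alpha - a%:R| <= Q * (P ^+ k)^-1].

Definition Narcs (k : nat) (Q P : R) : set R :=
  Marcs k Q P `\` Marcs k (Q / 2) P.

End Defs.

(* Main.v *)
(* Let [alpha] be in [Narcs k Q P], with [|q alpha - a| <= Q / P ^ k]. Build every smooth [x]
   from [1] by multiplying in its primes in decreasing order, and stop at the first partial
   product [m] with [P g ^ (2/k) < m R (2Q) ^ (2/k)], where [g = gcd(q, m ^ k)]. Those [x]
   that never stop number at most [P Q ^ (-1/k)], up to the divisor function. The others
   are [m v] with [v] running over the integers up to [N = P / m] free of prime factors
   above the least prime factor of [m], and [N] is, up to a factor [R], equal to
   [(2Q/g) ^ (2/k)]. At this scale [m ^ k alpha] lies on extreme minor arcs, where a
   bilinear estimate combined with the mean value of order [2w] bounds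
   [f (m ^ k alpha; N)] by [N ^ (1 - tau + eps)].

   Split [s = t + u] with [t] attaining the minimum defining [Dstar], use the pointwise
   bound for the power [t], and integrate the power [u]: since at most [g] of the [m ^ k]
   points [(c + j) / m ^ k] lie on the arcs with [gcd(q, m ^ k) = g], one gets
   [g / m ^ k] times the mean value of order [u] at height [N]. Counting the [m] with
   [g | m ^ k] leaves a sum over [g <= Q] whose terms are at most [1 / g] thanks to the
   lower bound [k - u/2 <= Delta_u], valid for every admissible exponent with [2 <= u].
   The same bound makes the measure of the arcs absorb the [x] that never stop. *)

Require Import Defs.
From HB Require Import structures.
From mathcomp Require Import all_boot all_order all_algebra.
From mathcomp Require Import all_classical all_reals all_analysis.
From mathcomp Require Import measurable_realfun.
From mathcomp.real_closed Require Import complex.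
From mathcomp Require Import ring lra zify.
Set Implicit Arguments. Unset Strict Implicit. Unset Printing Implicit Defensive.

(** * Decomposition along prime factors, and divisors *)

(** The rule involves [gcd(q, m ^ k)] because multiplying a point by [m ^ k] turns a denominator [q]
    into [q / g]. For [N] near [(2Q/g) ^ (2/k)] the bound [Q / g] on the new denominators is about
    [N ^ (k/2) / 2], the widest range of arcs at height [N], whatever [g] is; a rule based on the
    size of [m] alone would let the common factor push the dilated point out of the range where the
    bilinear estimate saves. As [g] can only grow when primes are multiplied in, the last prime is
    the only uncertainty in the size of [N]. The condition [Q <= P ^ (k/2) R ^ (-k) / 2] ensures
    that the empty product does not stop. The rule varies with [q], hence with [alpha]. Once [g] and
    [m] are fixed, this dependence is confined to the indicator of the arcs with
    [gcd(q, m ^ k) = g], and the sums can leave the integral. The exponents match since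
    [N ^ (- t tau)] from the pointwise bound and [N ^ Delta_u] from the mean value multiply to
    [N ^ Dstar], where [N] is about [(2Q/g) ^ (2/k)]. *)

(* Building [x] from [1] by multiplying in its primes in decreasing order,
   [first_stop stop x] is the first partial product satisfying [stop], and [0]
   if there is none; the first argument of [first_stop_rec] is fuel. *)
Fixpoint first_stop_rec (stop : pred nat) (n x : nat) : nat :=
  if n is n'.+1 then
    let y := first_stop_rec stop n' (x %/ pdiv x) in
    if (1 < x) && (y != 0) then y else if stop x then x else 0
  else 0.

Definition first_stop (stop : pred nat) (x : nat) : nat :=
  first_stop_rec stop x x.

Lemma divn_pdiv_lt x : 1 < x -> x %/ pdiv x < x.
Proof. by move=> x1; rewrite ltn_Pdiv ?prime_gt1 ?pdiv_prime//; lia. Qed.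

Lemma divn_pdiv_gt0 x : 0 < x -> 0 < x %/ pdiv x.
Proof. by move=> x1; rewrite divn_gt0 ?pdiv_gt0// dvdn_leq// pdiv_dvd. Qed.

Lemma first_stop_rec_fuel stop n n' x : x <= n -> x <= n' ->
  first_stop_rec stop n x = first_stop_rec stop n' x.
Proof.
elim: n n' x => [|n IH] [|n'] x //=.
- by rewrite leqn0 => /eqP -> _ /=; case: ifP.
- by rewrite leqn0 => _ /eqP -> /=; case: ifP.
move=> xn xn'; case: (ltnP 1 x) => //= x1.
by rewrite (IH n')// -ltnS (leq_trans (divn_pdiv_lt x1)).
Qed.

Lemma first_stopE stop x : 1 < x ->
  first_stop stop x = if first_stop stop (x %/ pdiv x) != 0
    then first_stop stop (x %/ pdiv x) else if stop x then x else 0.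
Proof.
move=> x1; rewrite {1}/first_stop; case: x x1 => // n x1 /=; rewrite x1 /=.
rewrite [first_stop_rec _ n _](@first_stop_rec_fuel _ n (n.+1 %/ pdiv n.+1))//.
by rewrite -ltnS divn_pdiv_lt.
Qed.

Lemma first_stop1 stop : first_stop stop 1 = stop 1.
Proof. by rewrite /first_stop /=; case: (stop 1). Qed.

Section FirstStop.
Variable stop : pred nat.
Hypothesis stop1 : stop 1 = false.
Local Notation T := (first_stop stop).

Lemma first_stop_le x : 0 < x -> T x <= x.
Proof.
elim/ltn_ind: x => x IH x0; case: (ltnP 1 x) => x1; last first.
  have -> : x = 1 by lia.
  by rewrite first_stop1; case: (stop 1).
rewrite first_stopE//; case: ifP => _; last by case: ifP.
rewrite (leq_trans (IH _ (divn_pdiv_lt x1) (divn_pdiv_gt0 x0)))//.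
by rewrite ltnW// divn_pdiv_lt.
Qed.

Lemma first_stop_eq0 x : 0 < x -> T x = 0 -> stop x = false.
Proof.
case: (ltnP 1 x) => x1 x0; last first.
  by have -> : x = 1 by lia.
rewrite first_stopE//; case: ifP => [/negP + /eqP//|_].
by case: ifP => // _; lia.
Qed.

(** The failure of the test one prime earlier is what bounds a stopping product from above, within a
    factor equal to its least prime. *)
Lemma first_stop_fix m : 0 < m -> T m = m ->
  [/\ 1 < m, stop m & stop (m %/ pdiv m) = false].
Proof.
move=> m0; case: (ltnP 1 m) => m1; last first.
  have -> : m = 1 by lia.
  by rewrite first_stop1 stop1.
rewrite first_stopE//; case: ifP => [y0 E|/eqP y0].
  have := first_stop_le (divn_pdiv_gt0 m0).
  by rewrite E; have := divn_pdiv_lt m1; lia.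
case: ifP => // [sm _|_ E]; last by lia.
split=> //; apply: first_stop_eq0; last by [].
exact: divn_pdiv_gt0.
Qed.

(** Stripping least primes from [x] runs through its partial products backwards, so every prime left
    in the cofactor was multiplied in after those of [T x]. Together with [first_stopM] this
    identifies the fibre of [T] above a stopping product. *)
Lemma first_stopP x : 0 < x -> T x != 0 ->
  [/\ T x %| x, T (T x) = T x &
      {in primes (x %/ T x), forall p, p <= pdiv (T x)}].
Proof.
elim/ltn_ind: x => x IH x0; case: (ltnP 1 x) => x1; last first.
  have -> : x = 1 by lia.
  by rewrite first_stop1 stop1.
have y0 := divn_pdiv_gt0 x0.
have Tx := first_stopE stop x1; case: ifP Tx => [Ty0|_] Tx; last first.
  rewrite Tx; case: ifP Tx => // sx Tx _; split=> //.
  by rewrite divnn x0.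
rewrite Tx => _; have [d1 d2 d3] := IH _ (divn_pdiv_lt x1) y0 Ty0.
have xE : x = x %/ pdiv x * pdiv x by rewrite divnK// pdiv_dvd.
set m := T _ in d1 d2 d3 Ty0 *.
have m0 : 0 < m by rewrite lt0n.
have m1 : 1 < m by have [] := first_stop_fix m0 d2.
split=> //; first by rewrite xE dvdn_mulr.
move=> p; rewrite {1}xE -divn_mulAC// primesM ?pdiv_gt0//; last first.
  by rewrite divn_gt0// dvdn_leq.
case/orP => [/d3//|]; rewrite mem_primes => /and3P[pp _ pd].
apply: (@leq_trans (pdiv x)); first by rewrite dvdn_leq// pdiv_gt0.
apply: pdiv_min_dvd; first by rewrite prime_gt1// pdiv_prime.
by rewrite xE dvdn_mulr// (dvdn_trans (pdiv_dvd _) d1).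
Qed.

Lemma pdiv_mul_small m v : 1 < m -> 1 < v ->
  {in primes v, forall p, p <= pdiv m} -> pdiv (m * v) = pdiv v.
Proof.
move=> m1 v1 vm; apply/eqP; rewrite eqn_leq; apply/andP; split.
  by rewrite pdiv_min_dvd ?prime_gt1 ?pdiv_prime// dvdn_mull// pdiv_dvd.
have mv1 : 1 < m * v by nia.
have := pdiv_dvd (m * v); rewrite Euclid_dvdM ?pdiv_prime// => /orP[] d.
  apply: (@leq_trans (pdiv m)); last by rewrite pdiv_min_dvd ?prime_gt1 ?pdiv_prime.
  by rewrite vm// pi_pdiv.
by rewrite pdiv_min_dvd ?prime_gt1 ?pdiv_prime.
Qed.

(** The least prime of [m * v] belongs to [v], so stripping leaves [m] untouched until [v] is
    exhausted. *)
Lemma first_stopM m v : 0 < m -> T m = m -> 0 < v ->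
  {in primes v, forall p, p <= pdiv m} -> T (m * v) = m.
Proof.
move=> m0 Tm; have [m1 _ _] := first_stop_fix m0 Tm.
elim/ltn_ind: v => v IH v0 vm; case: (ltnP 1 v) => v1; last first.
  have -> : v = 1 by lia.
  by rewrite muln1.
rewrite first_stopE ?pdiv_mul_small//; last by nia.
rewrite -muln_divA ?pdiv_dvd// IH ?divn_pdiv_lt ?divn_pdiv_gt0//.
  by rewrite -lt0n m0.
move=> p; rewrite mem_primes => /and3P[pp _ pd].
by apply: vm; rewrite mem_primes pp v0 (dvdn_trans pd)// dvdn_div// pdiv_dvd.
Qed.
End FirstStop.

Lemma gcdn_expn (k a b : nat) : gcdn a b ^ k = gcdn (a ^ k) (b ^ k).
Proof.
case: (posnP a) => [->|a0].
  by case: k => [|k]; rewrite ?gcd0n ?expn0// exp0n// gcd0n.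
set d := gcdn a b.
have d0 : 0 < d by rewrite gcdn_gt0 a0.
have [ad bd] : d %| a /\ d %| b by rewrite dvdn_gcdl dvdn_gcdr.
rewrite -[in a ^ k](divnK ad) -[in b ^ k](divnK bd) !expnMn -muln_gcdl.
suff /eqP -> : coprime ((a %/ d) ^ k) ((b %/ d) ^ k) by rewrite mul1n.
apply/coprimeXl/coprimeXr; rewrite /coprime -(eqn_pmul2r d0) mul1n.
by rewrite muln_gcdl !divnK ?dvdn_gcdl ?dvdn_gcdr.
Qed.

(* The least [h] with [g | h ^ k] works, since [gcd(h, m) ^ k = gcd(h ^ k, m ^ k)]. *)
Lemma dvdn_expn_root (k g : nat) : 0 < k -> 0 < g ->
  exists h, [/\ 0 < h, g <= h ^ k & forall m, g %| m ^ k -> h %| m].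
Proof.
move=> k0 g0; pose p h := (0 < h) && (g %| h ^ k).
have exp : exists h, p h by exists g; rewrite /p g0 dvdn_exp.
case: (ex_minnP exp) => h /andP[h0 gh] hmin; exists h; split=> //.
  by rewrite dvdn_leq// expn_gt0 h0.
move=> m gm; have : p (gcdn h m).
  by rewrite /p gcdn_gt0 h0 gcdn_expn dvdn_gcd gh.
move/hmin => hg; apply/gcdn_idPl/eqP.
by rewrite eqn_leq hg dvdn_leq// dvdn_gcdl.
Qed.

(** The map [d -> (gcd(d, a), d / gcd(d, a))] is injective. As [a] and [b] are arbitrary, the
    induction over prime factors carries no coprimality condition. *)
Lemma size_divisorsM a b : 0 < a -> 0 < b ->
  size (divisors (a * b)) <= size (divisors a) * size (divisors b).
Proof.
move=> a0 b0; rewrite -(size_allpairs muln (divisors a) (divisors b)).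
apply: uniq_leq_size; first exact: divisors_uniq.
move=> d; rewrite -dvdn_divisors ?muln_gt0 ?a0// => dab.
have d0 : 0 < d by rewrite (dvdn_gt0 _ dab)// muln_gt0 a0.
have g0 : 0 < gcdn d a by rewrite gcdn_gt0 d0.
apply/allpairsP; exists (gcdn d a, d %/ gcdn d a) => /=; split.
- by rewrite -dvdn_divisors// dvdn_gcdr.
- rewrite -dvdn_divisors// -(@Gauss_dvdr _ (a %/ gcdn d a)).
    by rewrite -(dvdn_pmul2r g0) divnK ?dvdn_gcdl// mulnAC divnK// dvdn_gcdr.
  rewrite /coprime -(eqn_pmul2r g0) mul1n muln_gcdl !divnK ?dvdn_gcdl//.
  exact: dvdn_gcdr.
- by rewrite mulnC divnK// dvdn_gcdl.
Qed.

Lemma size_divisors_pfactor p e : prime p -> size (divisors (p ^ e)) <= e.+1.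
Proof.
move=> pp; rewrite -[e.+1](size_iota 0) -(size_map (expn p) (iota 0 e.+1)).
apply: uniq_leq_size; first exact: divisors_uniq.
move=> d; rewrite -dvdn_divisors ?expn_gt0 ?prime_gt0//.
move/(dvdn_pfactor _ _ pp) => [f fe ->].
by apply: map_f; rewrite mem_iota.
Qed.

Lemma size_divisors_prod n : 0 < n ->
  size (divisors n) <= \prod_(p <- primes n) (logn p n).+1.
Proof.
move=> n0; rewrite {1}(prod_prime_decomp n0) prime_decompE big_map /=.
have : {in primes n, forall p, prime p} by move=> p; rewrite mem_primes => /andP[].
elim: (primes n) => [|p s IH] ps; first by rewrite !big_nil.
rewrite !big_cons /pfactor /=.
have pp : prime p by rewrite ps ?mem_head.
have ps' : {in s, forall p, prime p} by move=> x xs; rewrite ps// inE xs orbT.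
apply: leq_trans (size_divisorsM _ _) _; first by rewrite expn_gt0 prime_gt0.
  by rewrite big_seq prodn_cond_gt0// => i /ps' pi; rewrite expn_gt0 prime_gt0.
by rewrite leq_mul ?IH// size_divisors_pfactor.
Qed.

Import Order.TTheory GRing.Theory Num.Theory.
Import numFieldNormedType.Exports.
Local Open Scope ring_scope.

(** * Real inequalities *)

Section RealInequalities.
Variable R : realType.
Implicit Types x y a b p s : R.

Lemma powRE a x : 0 < a -> a `^ x = expR (x * ln a).
Proof. by move=> a0; rewrite /powR gt_eqF. Qed.

Lemma powR_ge1 a x : 1 <= a -> 0 <= x -> 1 <= a `^ x.
Proof. by move=> a1 x0; rewrite -(powRr0 a) ler_powR. Qed.

Lemma ler_powRl a b x : 0 <= a -> a <= b -> 0 <= x -> a `^ x <= b `^ x.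
Proof.
by move=> a0 ab x0; apply: ge0_ler_powR => //; rewrite nnegrE//; lra.
Qed.

(* The graph of [x `^ s] lies above its tangent line at [a]: this is Young's inequality. *)
Lemma powR_tangent s a x : 1 <= s -> 0 < a -> 0 <= x ->
  a `^ s + s * a `^ (s - 1) * (x - a) <= x `^ s.
Proof.
move=> s1 a0 x0; have s0 : 0 < s by lra.
have [->|s1'] := eqVneq s 1.
  by rewrite subrr powRr0 !powRr1//; lra.
have s2 : 1 < s by rewrite lt_neqAle eq_sym s1'.
have a1 : 0 < a `^ (s - 1) by rewrite powR_gt0.
have q0 : 0 < s / (s - 1) by rewrite divr_gt0//; lra.
have sum : s^-1 + (s / (s - 1))^-1 = 1.
  by field; rewrite !gt_eqF//; lra.
have := conjugate_powR x0 (ltW a1) s0 q0 sum.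
have -> : (a `^ (s - 1)) `^ (s / (s - 1)) = a `^ s.
  by rewrite -powRrM; congr (_ `^ _); field; lra.
have aE : a `^ s = a * a `^ (s - 1) by rewrite mulr_powRB1// ltW.
rewrite aE; set A := a `^ (s - 1) in a1 *; set X := x `^ s.
move=> H; have : s * (x * A) <= X + (s - 1) * (a * A).
  have -> : X + (s - 1) * (a * A) = s * (X / s + a * A / (s / (s - 1))).
    by field; rewrite !gt_eqF//; lra.
  by rewrite ler_wpM2l// ltW.
by move=> H'; lra.
Qed.

Lemma powR_sum_le (I : Type) (r : seq I) (F : I -> R) s :
  1 <= s -> (forall i, 0 <= F i) ->
  (\sum_(i <- r) F i) `^ s <= (size r)%:R `^ (s - 1) * \sum_(i <- r) F i `^ s.
Proof.
move=> s1 F0; set S := \sum_(i <- r) F i.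
have S0 : 0 <= S by apply: sumr_ge0.
have RHS0 : 0 <= (size r)%:R `^ (s - 1) * \sum_(i <- r) F i `^ s.
  by rewrite mulr_ge0 ?powR_ge0 ?sumr_ge0// => i _; rewrite powR_ge0.
have [SE|Sn] := eqVneq S 0; first by rewrite SE powR0//; lra.
have S1 : 0 < S by rewrite lt_neqAle eq_sym Sn.
have n0 : 0 < (size r)%:R :> R.
  rewrite ltr0n lt0n; apply/negP => /nilP rE.
  by move: Sn; rewrite /S rE big_nil eqxx.
(* Tangent at the mean of the [F i], so that the linear terms sum to zero. *)
set n := (size r)%:R in n0 RHS0 *; pose a := S / n.
have a0 : 0 < a by rewrite divr_gt0.
have : \sum_(i <- r) (a `^ s + s * a `^ (s - 1) * (F i - a)) <= \sum_(i <- r) F i `^ s.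
  by apply: ler_sum => i _; apply: powR_tangent.
rewrite big_split/= -mulr_sumr sumrB !big_const_seq !count_predT !iter_addr !addr0.
rewrite -[a `^ s *+ _]mulr_natl -[a *+ _]mulr_natl -/n -/S.
have -> : n * a = S by rewrite /a; field; lra.
rewrite subrr mulr0 addr0 => H.
apply: le_trans (ler_wpM2l (powR_ge0 _ _) H).
have -> : n `^ (s - 1) * (n * a `^ s) = (n * n `^ (s - 1)) * a `^ s by ring.
have -> : n * n `^ (s - 1) = n `^ s by rewrite mulr_powRB1//; lra.
rewrite -powRM; [|exact: ltW..].
by rewrite /a mulrC divfK// gt_eqF.
Qed.

(** Prime by prime, [e + 1 <= 2 ^ e] is at most [p ^ (d e)] as soon as [p ^ d >= 2]. Each of the at
    most [B] smaller primes costs a factor [A]. *)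
Lemma divisor_bound (d : R) : 0 < d ->
  exists2 C : R, 1 <= C &
  forall n : nat, (0 < n)%N -> (size (divisors n))%:R <= C * n%:R `^ d.
Proof.
move=> d0.
have l2 : 0 < ln 2 :> R by rewrite ln_gt0// ltr1n.
pose B := (Num.truncn ((2 : R) `^ d^-1)).+1.
(* Chosen so that [1 + e <= A * (1 + d * ln 2 * e)]. *)
pose A := 1 + (d * ln 2)^-1.
have A1 : 1 <= A by rewrite /A lerDl invr_ge0 mulr_ge0// ltW.
exists (A ^+ B); first by rewrite exprn_ege1.
move=> n n0.
have D1 (p e : nat) : prime p -> (e.+1)%:R <= (if (p < B)%N then A else 1) * (p ^ e)%:R `^ d.
  move=> pp.
  have p2 : 2 <= p%:R :> R by rewrite (ler_nat _ 2) prime_gt1.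
  have lp : ln 2 <= ln p%:R :> R by rewrite ler_ln// posrE; lra.
  have -> : (p ^ e)%:R `^ d = expR (e%:R * (d * ln p%:R)) :> R.
    rewrite natrX -powR_mulrn; last by lra.
    by rewrite -powRrM powRE; [congr expR; ring | lra].
  have [pB|Bp] := ltnP p B.
    have H : 1 + d * ln 2 * e%:R <= expR (e%:R * (d * ln p%:R)).
      apply: le_trans (expR_ge1Dx _) _; rewrite ler_expR mulrC ler_wpM2l//.
      by rewrite ler_pM2l.
    apply: le_trans (ler_wpM2l (le_trans ler01 A1) H).
    rewrite /A -addn1 natrD.
    have -> : (1 + (d * ln 2)^-1) * (1 + d * ln 2 * e%:R) =
       1 + e%:R + (d * ln 2)^-1 + d * ln 2 * e%:R.
      by field; rewrite !gt_eqF.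
    have : 0 <= (d * ln 2)^-1 by rewrite invr_ge0 mulr_ge0// ltW.
    have : 0 <= d * ln 2 * e%:R by rewrite !mulr_ge0// ltW.
    lra.
  rewrite mul1r.
  have H : ln 2 <= d * ln p%:R :> R.
    have p0 : 0 < p%:R :> R by lra.
    have : ln ((2 : R) `^ d^-1) <= ln p%:R.
      rewrite ler_ln ?posrE ?powR_gt0//.
      by rewrite ltW// (lt_le_trans (truncnS_gt _))// ler_nat.
    by rewrite ln_powR ler_pdivrMl.
  apply: (@le_trans _ _ (expR (e%:R * ln 2))); last first.
    by rewrite ler_expR ler_wpM2l.
  rewrite -powRE// powR_mulrn// -natrX ler_nat.
  exact: ltn_expl.
have H1 : (size (divisors n))%:R <= \prod_(p <- primes n) (logn p n).+1%:R :> R.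
  by rewrite -natr_prod ler_nat size_divisors_prod.
apply: (le_trans H1).
have H2 : \prod_(p <- primes n) (logn p n).+1%:R <=
   \prod_(p <- primes n) ((if (p < B)%N then A else 1) * (p ^ logn p n)%:R `^ d) :> R.
  rewrite big_seq [X in _ <= X]big_seq; apply: ler_prod => p.
  by rewrite mem_primes => /andP[pp _]; rewrite ler0n D1.
apply: (le_trans H2); rewrite big_split/=.
have -> : \prod_(p <- primes n) (p ^ logn p n)%:R `^ d = n%:R `^ d :> R.
  transitivity ((\prod_(p <- primes n) p ^ logn p n)%N%:R `^ d : R); last first.
    by rewrite {3}(prod_prime_decomp n0) prime_decompE big_map.
  elim: (primes n) => [|p s IH]; first by rewrite !big_nil powR1.
  by rewrite !big_cons IH natrM powRM.
rewrite ler_wpM2r ?powR_ge0//.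
rewrite -big_mkcond/= big_const_seq iter_mulr_1.
apply: ler_weXn2l => //.
rewrite -size_filter -{2}(size_iota 0 B); apply: uniq_leq_size.
  by rewrite filter_uniq// primes_uniq.
by move=> p; rewrite mem_filter mem_iota => /andP[].
Qed.

Lemma harmonic_le (n : nat) : (0 < n)%N ->
  \sum_(1 <= j < n.+1) j%:R^-1 <= 1 + ln n%:R :> R.
Proof.
case: n => // n _; elim: n => [|n IH].
  by rewrite big_nat1 ln1 invr1 addr0.
rewrite big_nat_recr//=.
suff : (n.+2)%:R^-1 <= ln (n.+2)%:R - ln (n.+1)%:R :> R.
  rewrite lerBrDl => H; apply: le_trans (lerD IH (lexx _)) _.
  by rewrite -addrA lerD2l.
have n1 : 0 < n.+1%:R :> R by rewrite ltr0n.
have n2 : 0 < n.+2%:R :> R by rewrite ltr0n.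
rewrite -opprB lerNr -lnV ?posrE// -lnM ?posrE ?invr_gt0//.
rewrite -ler_expR lnK ?posrE ?mulr_gt0 ?invr_gt0//.
apply: le_trans (expR_ge1Dx _).
suff -> : n.+1%:R / n.+2%:R = 1 - n.+2%:R^-1 :> R by [].
rewrite -[n.+2]addn1 natrD; field.
by move: n2; rewrite -addn1 natrD; lra.
Qed.

Lemma Cauchy_Schwarz_sum (I : Type) (r : seq I) (F G : I -> R) :
  (\sum_(i <- r) F i * G i) ^+ 2 <=
  (\sum_(i <- r) F i ^+ 2) * (\sum_(i <- r) G i ^+ 2).
Proof.
set A := \sum_(i <- r) F i ^+ 2; set B := \sum_(i <- r) G i ^+ 2.
set S := \sum_(i <- r) _.
have A0 : 0 <= A by apply: sumr_ge0 => i _; exact: sqr_ge0.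
have H (x y : R) : 0 <= x ^+ 2 * A + 2 * x * y * S + y ^+ 2 * B.
  have -> : x ^+ 2 * A + 2 * x * y * S + y ^+ 2 * B =
      \sum_(i <- r) (x * F i + y * G i) ^+ 2.
    rewrite !mulr_sumr -!big_split/=; apply: eq_bigr => i _; ring.
  by apply: sumr_ge0 => i _; exact: sqr_ge0.
have [E|An] := eqVneq A 0.
  (* Degenerate case: the quadratic form at [(B + 1, - S)] equals [- (B + 2) * S ^ 2], which forces
     [S] to vanish. *)
  rewrite E mul0r; have := H (B + 1) (- S); rewrite E.
  have B0 : 0 <= B by apply: sumr_ge0 => i _; exact: sqr_ge0.
  have -> : (B + 1) ^+ 2 * 0 + 2 * (B + 1) * - S * S + (- S) ^+ 2 * B
    = - (B + 2) * S ^+ 2 by ring.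
  by rewrite mulNr oppr_ge0 pmulr_rle0//; lra.
have A1 : 0 < A by rewrite lt_neqAle eq_sym An.
have := H (- S) A.
have -> : (- S) ^+ 2 * A + 2 * - S * A * S + A ^+ 2 * B = A * (A * B - S ^+ 2).
  by ring.
by rewrite pmulr_rge0// subr_ge0.
Qed.

Lemma exprn_sum_le (I : Type) (r : seq I) (F : I -> R) (w : nat) :
  (0 < w)%N -> (forall i, 0 <= F i) ->
  (\sum_(i <- r) F i) ^+ w <= (size r)%:R ^+ w.-1 * \sum_(i <- r) F i ^+ w.
Proof.
move=> w0 F0; have w1 : 1 <= w%:R :> R by rewrite ler1n.
have := powR_sum_le r w1 F0; rewrite powR_mulrn ?sumr_ge0//.
have -> : w%:R - 1 = w.-1%:R :> R by rewrite -subn1 natrB.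
rewrite powR_mulrn//.
have -> // : \sum_(i <- r) F i `^ w%:R = \sum_(i <- r) F i ^+ w.
by apply: eq_bigr => i _; rewrite powR_mulrn.
Qed.

End RealInequalities.

(** * Exponential sums and the bilinear inequality *)

Section Exponentials.
Variable R : realType.
Local Notation C := R[i].
Implicit Types (x y theta : R) (z : C).

Definition cabs (z : C) : R := Normc.normc z.

Lemma cabsE z : cabs z = Num.sqrt (complex.Re z ^+ 2 + complex.Im z ^+ 2).
Proof. by case: z. Qed.

Lemma cabs_ge0 z : 0 <= cabs z.
Proof. by rewrite cabsE sqrtr_ge0. Qed.

Lemma cabs0 : cabs 0 = 0. Proof. exact: Normc.normc0. Qed.
Lemma cabs1 : cabs 1 = 1. Proof. exact: Normc.normc1. Qed.
Lemma cabsM z z' : cabs (z * z') = cabs z * cabs z'.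
Proof. exact: Normc.normcM. Qed.
Lemma cabsD z z' : cabs (z + z') <= cabs z + cabs z'.
Proof. exact: le_normcD. Qed.
Lemma cabsN z : cabs (- z) = cabs z.
Proof. by rewrite !cabsE; case: z => a b /=; rewrite !sqrrN. Qed.
Lemma cabsX z n : cabs (z ^+ n) = cabs z ^+ n.
Proof. by elim: n => [|n IH]; rewrite ?cabs1// !exprS cabsM IH. Qed.
Lemma cabs_sum (I : Type) (r : seq I) (P : pred I) (F : I -> C) :
  cabs (\sum_(i <- r | P i) F i) <= \sum_(i <- r | P i) cabs (F i).
Proof.
elim/big_ind2 : _ => //; first by rewrite cabs0.
by move=> a b c d ab cd; apply: le_trans (cabsD _ _) _; exact: lerD.
Qed.
Lemma cabs_real x : cabs (x%:C)%C = `|x|.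
Proof. by rewrite cabsE/= expr0n/= addr0 sqrtr_sqr. Qed.
Lemma cabs_conj z : cabs (z^*)%C = cabs z.
Proof. by rewrite !cabsE; case: z => a b /=; rewrite !sqrrN. Qed.
Lemma cabs_sqr z : ((cabs z ^+ 2)%:C)%C = z * (z^*)%C.
Proof.
rewrite cabsE sqr_sqrtr ?addr_ge0 ?sqr_ge0//; case: z => a b /=.
by simpc; congr (_ +i* _)%C; ring.
Qed.

(** Lets a sum of moduli be rewritten as a linear form with bounded coefficients, to which the
    bilinear estimates apply. *)
Lemma cabs_phase z : exists2 c : C, cabs c <= 1 & ((cabs z)%:C)%C = c * z.
Proof.
have [->|z0] := eqVneq (cabs z) 0.
  by exists 0; rewrite ?cabs0 ?ler01// mul0r.
have z1 : 0 < cabs z by rewrite lt_neqAle eq_sym z0 cabs_ge0.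
exists (((cabs z)^-1)%:C%C * (z^*)%C).
  rewrite cabsM cabs_real cabs_conj ger0_norm ?mulVf//.
  by rewrite invr_ge0 ltW.
rewrite -mulrA [_ * z]mulrC -cabs_sqr -rmorphM/=; congr (_%:C)%C.
by field.
Qed.

Definition ee (x : R) : C := (cos (2 * pi * x) +i* sin (2 * pi * x))%C.

Lemma ee0 : ee 0 = 1.
Proof. by rewrite /ee mulr0 cos0 sin0. Qed.

Lemma eeD x y : ee (x + y) = ee x * ee y.
Proof.
rewrite /ee mulrDr cosD sinD; simpc.
by congr (_ +i* _)%C; rewrite // addrC [X in X + _]mulrC.
Qed.

Lemma eeN x : ee (- x) = (ee x)^*%C.
Proof. by rewrite /ee mulrN cosN sinN. Qed.

Lemma cabs_ee x : cabs (ee x) = 1.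
Proof. by rewrite cabsE/= cos2Dsin2 sqrtr1. Qed.

Lemma ee1 : ee 1 = 1.
Proof. by rewrite /ee mulr1 mulr_natl cos2pi sin2pi. Qed.

Lemma ee_nat n : ee n%:R = 1.
Proof. by elim: n => [|n IH]; rewrite ?ee0// -addn1 natrD eeD IH ee1 mulr1. Qed.

Lemma ee_int (n : int) : ee n%:~R = 1.
Proof.
case: n => n; first exact: ee_nat.
by rewrite NegzE mulrNz eeN ee_nat/= oppr0.
Qed.

Lemma eeM_nat x n : ee (x * n%:R) = ee x ^+ n.
Proof.
elim: n => [|n IH]; first by rewrite mulr0 ee0.
by rewrite -addn1 natrD mulrDr mulr1 eeD IH addn1 exprSr.
Qed.

Lemma f_absE k P Rr alpha :
  f_abs k P Rr alpha = cabs (\sum_(x <- smooth_set P Rr) ee (alpha * (x ^ k)%:R)).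
Proof.
rewrite cabsE /f_abs /f_re /f_im.
have H (s : seq nat) : \sum_(x <- s) ee (alpha * (x ^ k)%:R) =
  ((\sum_(x <- s) cos (2 * pi * alpha * (x ^ k)%:R)) +i*
   (\sum_(x <- s) sin (2 * pi * alpha * (x ^ k)%:R)))%C.
  elim: s => [|x s IH]; first by rewrite !big_nil.
  rewrite !big_cons IH /ee; simpc.
  by rewrite !mulrA.
by rewrite H.
Qed.

(* An exponential polynomial is the list of its (frequency, coefficient) pairs,
   with repetition; [coll] counts the pairs of coinciding frequencies. *)
Definition epoly (L : seq (nat * C)) theta : C :=
  \sum_(p <- L) p.2 * ee (theta * p.1%:R).

Definition lmul (L L' : seq (nat * C)) : seq (nat * C) :=
  [seq ((p.1 + q.1)%N, p.2 * q.2) | p <- L, q <- L'].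
Definition lpow (w : nat) (L : seq (nat * C)) := iter w (lmul L) [:: (0%N, 1)].

Definition sums (w : nat) (s : seq nat) : seq nat :=
  iter w (fun t => [seq (a + b)%N | a <- s, b <- t]) [:: 0%N].
Definition coll (t : seq nat) : nat := \sum_(a <- t) \sum_(b <- t) (a == b).

Lemma epoly_mul L L' theta : epoly (lmul L L') theta = epoly L theta * epoly L' theta.
Proof.
rewrite /epoly /lmul big_allpairs_dep mulr_suml; apply: eq_bigr => p _.
rewrite mulr_sumr; apply: eq_bigr => q _ /=.
by rewrite natrD mulrDr eeD mulrACA.
Qed.

Lemma epoly_pow w L theta : epoly (lpow w L) theta = epoly L theta ^+ w.
Proof.
elim: w => [|w IH].
  by rewrite /epoly big_seq1 /= mulr0 ee0 mulr1.
by rewrite /lpow iterS -/(lpow w L) epoly_mul IH exprS.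
Qed.

Lemma unzip1_lpow w L : unzip1 (lpow w L) = sums w (unzip1 L).
Proof.
elim: w => // w IH; rewrite {1}/lpow iterS -/(lpow w L) [in RHS]/sums iterS.
rewrite -/(sums w _) -IH /lmul /unzip1 map_allpairs allpairs_mapl.
by rewrite allpairs_mapr.
Qed.

Lemma size_lpow w L : size (lpow w L) = (size L ^ w)%N.
Proof. by elim: w => //= w IH; rewrite size_allpairs IH expnS. Qed.

Lemma lpow_coef w L : {in L, forall p, cabs p.2 <= 1} ->
  {in lpow w L, forall p, cabs p.2 <= 1}.
Proof.
move=> H; elim: w => [|w IH] p.
  by rewrite inE => /eqP ->; rewrite [cabs _]cabs1.
case/allpairsP => -[a b] /= [/H aL /IH bL ->] /=.
by rewrite cabsM mulr_ile1// cabs_ge0.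
Qed.

Lemma sums_le w s X : {in s, forall a, (a <= X)%N} ->
  {in sums w s, forall a, (a <= w * X)%N}.
Proof.
move=> H; elim: w => [|w IH] p; first by rewrite inE => /eqP ->.
by case/allpairsP => -[a b] /= [/H aL /IH bL ->]; rewrite mulSn leq_add.
Qed.

Lemma lpow_le w L X : {in L, forall p, (p.1 <= X)%N} ->
  {in lpow w L, forall p, (p.1 <= w * X)%N}.
Proof.
move=> H p pL; apply: (@sums_le w (unzip1 L)).
  by move=> a /mapP[q qL ->]; exact: H.
by rewrite -unzip1_lpow; apply: map_f.
Qed.

Lemma coll_count t n : {in t, forall a, (a < n)%N} ->
  coll t = (\sum_(v < n) count_mem (v : nat) t ^ 2)%N.
Proof.
move=> tn; rewrite /coll.
transitivity (\sum_(a <- t) \sum_(v < n) (a == v :> nat) * count_mem (v : nat) t)%N.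
  apply: eq_big_seq => a /tn an.
  rewrite (bigD1 (Ordinal an))//= eqxx mul1n [X in (_ + X)%N]big1 ?addn0; last first.
    by move=> i /eqP ni; have [E|//] := eqVneq a i; case: ni; exact: val_inj.
  by rewrite -sum1_count [RHS]big_mkcond/=; apply: eq_bigr => b _; rewrite eq_sym; case: eqP.
rewrite exchange_big/=; apply: eq_bigr => v _.
rewrite -big_distrl/= expnS expn1; congr (_ * _)%N.
by rewrite -sum1_count [RHS]big_mkcond/=; apply: eq_bigr => b _; case: eqP.
Qed.

(** The hypothesis, quantified over all weights, says that [s] is contained in [s'] as a multiset;
    in this form it passes through iterated sums. *)
Lemma sum_le_sums w s s' (F : nat -> nat) :
  (forall G : nat -> nat, \sum_(a <- s) G a <= \sum_(a <- s') G a)%N ->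
  (\sum_(a <- sums w s) F a <= \sum_(a <- sums w s') F a)%N.
Proof.
move=> H; elim: w F => [|w IH] F //=.
rewrite !big_allpairs_dep; apply: leq_trans (H _) _.
by apply: leq_sum => a _; apply: IH.
Qed.

Lemma coll_sums_le w s s' :
  (forall G : nat -> nat, \sum_(a <- s) G a <= \sum_(a <- s') G a)%N ->
  (coll (sums w s) <= coll (sums w s'))%N.
Proof.
move=> H; rewrite /coll; apply: leq_trans (sum_le_sums _ _ H) _.
by apply: leq_sum => a _; apply: sum_le_sums.
Qed.

(** Once coefficients are collected by frequency, their squared l^2 norms are at most [coll].
    Cauchy-Schwarz in the first variable and opening the square leave a Hermitian form whose kernel
    has row sums at most [K]; the inequality [2 |D z| |D z'| <= |D z| ^ 2 + |D z'| ^ 2] and the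
    symmetry of the kernel bound it. *)
Lemma bilinear_square (L L' : seq (nat * C)) theta (Y Z : nat) (K : R) :
  {in L, forall p, cabs p.2 <= 1} -> {in L', forall p, cabs p.2 <= 1} ->
  {in L, forall p, (p.1 < Y)%N} -> {in L', forall p, (p.1 < Z)%N} ->
  0 <= K ->
  (forall z : nat, (z < Z)%N ->
    \sum_(z' < Z) cabs (\sum_(y < Y) ee (theta * y%:R * (z%:R - z'%:R))) <= K) ->
  cabs (\sum_(p <- L) \sum_(q <- L') p.2 * q.2 * ee (theta * p.1%:R * q.1%:R)) ^+ 2
  <= (coll (unzip1 L))%:R * (coll (unzip1 L'))%:R * K.
Proof.
move=> L1 L'1 LY L'Z K0 HK.
pose c (L : seq (nat * C)) (y : nat) : C := \sum_(p <- L | p.1 == y) p.2.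
have csum (M : seq (nat * C)) (n : nat) (F : nat -> C) : {in M, forall p, (p.1 < n)%N} ->
   \sum_(p <- M) p.2 * F p.1 = \sum_(y < n) c M y * F y.
  move=> Mn.
  transitivity (\sum_(p <- M) \sum_(y < n) (p.1 == y :> nat)%:R * (p.2 * F p.1)).
    apply: eq_big_seq => p /Mn pn.
    rewrite (bigD1 (Ordinal pn))//= eqxx mul1r big1 ?addr0//.
    by move=> i; have [E /eqP[]|_] := eqVneq p.1 i; [exact: val_inj|rewrite mul0r].
  rewrite exchange_big/=; apply: eq_bigr => y _.
  rewrite /c mulr_suml [RHS]big_mkcond/=; apply: eq_bigr => p _.
  by case: eqP => [->|_]; rewrite ?mul1r ?mul0r.
have cle (M : seq (nat * C)) (n : nat) : {in M, forall p, cabs p.2 <= 1} ->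
    {in M, forall p, (p.1 < n)%N} ->
    \sum_(y < n) cabs (c M y) ^+ 2 <= (coll (unzip1 M))%:R.
  move=> M1 Mn; rewrite (@coll_count _ n); last by move=> a /mapP[p /Mn pn ->].
  rewrite natr_sum; apply: ler_sum => y _; rewrite natrX.
  apply: lerXn2r; rewrite ?nnegrE ?cabs_ge0//.
  apply: le_trans (cabs_sum _ _ _) _.
  rewrite -sum1_count natr_sum big_map /= big_seq_cond [X in _ <= X]big_seq_cond.
  by apply: ler_sum => p /andP[/M1].
pose T (y : nat) := \sum_(q <- L') q.2 * ee (theta * y%:R * q.1%:R).
have -> : \sum_(p <- L) \sum_(q <- L') p.2 * q.2 * ee (theta * p.1%:R * q.1%:R) =
   \sum_(y < Y) c L y * T y.
  rewrite -(csum _ _ T LY); apply: eq_bigr => p _; rewrite /T mulr_sumr.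
  by apply: eq_bigr => q _; rewrite mulrA.
have H1 : cabs (\sum_(y < Y) c L y * T y) <= \sum_(y < Y) cabs (c L y) * cabs (T y).
  apply: le_trans (cabs_sum _ _ _) _.
  by apply: ler_sum => y _; rewrite cabsM.
have H2 : \sum_(y < Y) cabs (T y) ^+ 2 <= (coll (unzip1 L'))%:R * K.
  pose D := c L'.
  pose S (z z' : nat) := cabs (\sum_(y < Y) ee (theta * y%:R * (z%:R - z'%:R))).
  have TE (y : nat) : T y = \sum_(z < Z) D z * ee (theta * y%:R * z%:R).
    by rewrite /T (csum _ Z (fun z : nat => ee (theta * y%:R * z%:R)) L'Z).
  have E : ((\sum_(y < Y) cabs (T y) ^+ 2)%:C)%C =
    \sum_(z < Z) \sum_(z' < Z) D z * (D z')^*%C *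
      \sum_(y < Y) ee (theta * y%:R * (z%:R - z'%:R)).
    have Ey (y : nat) : ((cabs (T y) ^+ 2)%:C)%C = \sum_(z < Z) \sum_(z' < Z)
        D z * (D z')^*%C * ee (theta * y%:R * (z%:R - z'%:R)).
      rewrite cabs_sqr TE (rmorph_sum (@conjc R)) big_distrlr/=.
      apply: eq_bigr => z _; apply: eq_bigr => z' _.
      have cM (u v : C) : ((u * v)^*)%C = (u^*)%C * (v^*)%C by rewrite rmorphM.
      by rewrite cM -eeN mulrACA -eeD -mulrBr.
    rewrite rmorph_sum/=; under eq_bigr => y _ do rewrite Ey.
    rewrite exchange_big/=; apply: eq_bigr => z _.
    rewrite exchange_big/=; apply: eq_bigr => z' _.
    by rewrite mulr_sumr.
  have -> : \sum_(y < Y) cabs (T y) ^+ 2 = cabs ((\sum_(y < Y) cabs (T y) ^+ 2)%:C)%C.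
    by rewrite cabs_real ger0_norm// sumr_ge0// => y _; rewrite exprn_ge0// cabs_ge0.
  rewrite E.
  have B1 : cabs (\sum_(z < Z) \sum_(z' < Z) D z * (D z')^*%C *
      \sum_(y < Y) ee (theta * y%:R * (z%:R - z'%:R))) <=
    \sum_(z < Z) \sum_(z' < Z) (cabs (D z) ^+ 2 / 2 * S z z' + cabs (D z') ^+ 2 / 2 * S z z').
    apply: le_trans (cabs_sum _ _ _) _; apply: ler_sum => z _.
    apply: le_trans (cabs_sum _ _ _) _; apply: ler_sum => z' _.
    rewrite !cabsM cabs_conj -mulrDl ler_wpM2r ?cabs_ge0//.
    have := sqr_ge0 (cabs (D z) - cabs (D z')).
    by rewrite sqrrB; lra.
  apply: (le_trans B1).
  have SC (z z' : nat) : S z z' = S z' z.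
    rewrite /S -cabs_conj (rmorph_sum (@conjc R)); congr cabs; apply: eq_bigr => y _.
    rewrite -[LHS]/((ee (theta * y%:R * (z%:R - z'%:R)))^*%C).
    by rewrite -eeN -mulrN opprB.
  have B2 : \sum_(z < Z) \sum_(z' < Z) cabs (D z) ^+ 2 / 2 * S z z' <=
     (coll (unzip1 L'))%:R * K / 2.
    apply: (@le_trans _ _ (\sum_(z < Z) cabs (D z) ^+ 2 / 2 * K)).
      apply: ler_sum => z _; rewrite -mulr_sumr ler_wpM2l ?divr_ge0 ?exprn_ge0 ?cabs_ge0//.
      exact: HK.
    rewrite -mulr_suml -mulr_suml mulrAC ler_wpM2r// ler_wpM2r//.
    exact: cle.
  have B3 : \sum_(z < Z) \sum_(z' < Z) cabs (D z') ^+ 2 / 2 * S z z' <=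
     (coll (unzip1 L'))%:R * K / 2.
    rewrite exchange_big/=; apply: le_trans B2.
    by apply: ler_sum => z _; apply: ler_sum => z' _; rewrite SC.
  under eq_bigr => z _ do rewrite big_split/=.
  by rewrite big_split/=; lra.
have C0 : 0 <= \sum_(y < Y) cabs (c L y) * cabs (T y).
  by apply: sumr_ge0 => y _; rewrite mulr_ge0 ?cabs_ge0.
apply: (@le_trans _ _ ((\sum_(y < Y) cabs (c L y) * cabs (T y)) ^+ 2)).
  by apply: lerXn2r; rewrite ?nnegrE ?cabs_ge0.
apply: le_trans (Cauchy_Schwarz_sum _ _ _) _.
rewrite -mulrA; apply: ler_pM => //; last exact: cle.
  by apply: sumr_ge0 => y _; rewrite exprn_ge0 ?cabs_ge0.
by apply: sumr_ge0 => y _; rewrite exprn_ge0 ?cabs_ge0.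
Qed.

(* Hölder twice, first in [m] and then in the sums of [w] powers [v ^ k], reduces to
   [bilinear_square]. *)
Lemma bilinear_power (w k : nat) (s s' : seq nat) (a b : nat -> C) theta
    (X X' : nat) (K : R) :
  (0 < w)%N -> (forall m, cabs (a m) <= 1) -> (forall v, cabs (b v) <= 1) ->
  {in s, forall m, (m ^ k <= X)%N} -> {in s', forall v, (v ^ k <= X')%N} ->
  0 <= K ->
  (forall z : nat, (z < (w * X').+1)%N -> \sum_(z' < (w * X').+1)
     cabs (\sum_(y < (w * X).+1) ee (theta * y%:R * (z%:R - z'%:R))) <= K) ->
  cabs (\sum_(m <- s) \sum_(v <- s') a m * b v * ee (theta * ((m * v) ^ k)%N%:R))
    ^+ (2 * w ^ 2) <=
  ((size s)%:R * (size s')%:R) ^+ (2 * w * w.-1) *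
  (coll (sums w (map (expn^~ k) s)))%:R * (coll (sums w (map (expn^~ k) s')))%:R * K.
Proof.
move=> w0 a1 b1 sX s'X K0 HK.
set S := \sum_(m <- s) _.
pose Lb := [seq (v ^ k, b v)%N | v <- s'].
pose T m := epoly Lb (theta * (m ^ k)%:R).
have ST : cabs S <= \sum_(m <- s) cabs (T m).
  apply: le_trans (cabs_sum _ _ _) _; apply: ler_sum => m _.
  have -> : \sum_(v <- s') a m * b v * ee (theta * ((m * v) ^ k)%N%:R) = a m * T m.
    rewrite /T /epoly big_map mulr_sumr; apply: eq_bigr => v _ /=.
    by rewrite expnMn natrM !mulrA.
  by rewrite cabsM ler_piMl ?cabs_ge0.
(* The phases linearize [|T m| ^ w]; exchanging the sums then makes the [w]-fold sums of the [v ^ k]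
   the outer variable. *)
pose c m := s2val (cid2 (cabs_phase (T m ^+ w))).
have c1 m : cabs (c m) <= 1 by rewrite /c; case: cid2.
have cE m : ((cabs (T m ^+ w))%:C)%C = c m * T m ^+ w by rewrite /c; case: cid2.
pose La := [seq (m ^ k, c m)%N | m <- s].
pose Lbw := lpow w Lb.
pose T' n := epoly La (theta * n%:R).
have Lb1 : {in Lb, forall p, cabs p.2 <= 1} by move=> p /mapP[v _ ->] /=.
have La1 : {in La, forall p, cabs p.2 <= 1} by move=> p /mapP[v _ ->] /=.
have sizeLbw : size Lbw = (size s' ^ w)%N by rewrite size_lpow size_map.
have H1 : \sum_(m <- s) cabs (T m) ^+ w <= \sum_(q <- Lbw) cabs (T' q.1).
  have -> : \sum_(m <- s) cabs (T m) ^+ w = cabs (\sum_(q <- Lbw) q.2 * T' q.1).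
    have -> : \sum_(q <- Lbw) q.2 * T' q.1 = ((\sum_(m <- s) cabs (T m) ^+ w)%:C)%C.
      rewrite rmorph_sum/=.
      under [RHS]eq_bigr => m _ do rewrite -cabsX cE -epoly_pow /epoly mulr_sumr.
      rewrite exchange_big/=; apply: eq_bigr => q _.
      rewrite /T' /epoly big_map mulr_sumr; apply: eq_bigr => m _ /=.
      by rewrite mulrCA !mulrA; congr (_ * ee _); rewrite -!mulrA [X in _ * X]mulrC.
    rewrite cabs_real ger0_norm// sumr_ge0// => m _.
    by rewrite exprn_ge0// cabs_ge0.
  apply: le_trans (cabs_sum _ _ _) _; rewrite big_seq [X in _ <= X]big_seq.
  apply: ler_sum => q /(lpow_coef Lb1) q1.
  by rewrite cabsM ler_piMl ?cabs_ge0.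
pose d n := s2val (cid2 (cabs_phase (T' n ^+ w))).
have d1 m : cabs (d m) <= 1 by rewrite /d; case: cid2.
have dE m : ((cabs (T' m ^+ w))%:C)%C = d m * T' m ^+ w by rewrite /d; case: cid2.
pose Laww := lpow w La.
(* The new phases replace the coefficients of [Lbw]; repeated frequencies are kept, since [coll]
   counts them. *)
pose Ld := [seq (q.1, d q.1) | q <- Lbw].
have H2 : \sum_(q <- Lbw) cabs (T' q.1) ^+ w =
   cabs (\sum_(p <- Laww) \sum_(q <- Ld) p.2 * q.2 * ee (theta * p.1%:R * q.1%:R)).
  have -> : \sum_(p <- Laww) \sum_(q <- Ld) p.2 * q.2 * ee (theta * p.1%:R * q.1%:R) =
     ((\sum_(q <- Lbw) cabs (T' q.1) ^+ w)%:C)%C.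
    rewrite rmorph_sum/=.
    under [RHS]eq_bigr => q _ do rewrite -cabsX dE -epoly_pow /epoly mulr_sumr.
    rewrite [RHS]exchange_big/=; apply: eq_bigr => p _.
    rewrite big_map; apply: eq_bigr => q _ /=.
    by rewrite mulrA [d _ * _]mulrC; congr (_ * ee _); rewrite mulrAC.
  rewrite cabs_real ger0_norm// sumr_ge0// => m _.
  by rewrite exprn_ge0// cabs_ge0.
have uLd : unzip1 Ld = sums w (map (expn^~ k) s').
  rewrite /Ld /unzip1 -map_comp /= -/(unzip1 Lbw) unzip1_lpow.
  by congr sums; rewrite /unzip1 -map_comp.
have uLa : unzip1 Laww = sums w (map (expn^~ k) s).
  by rewrite unzip1_lpow; congr sums; rewrite /unzip1 -map_comp.
have H3 : (\sum_(q <- Lbw) cabs (T' q.1) ^+ w) ^+ 2 <=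
    (coll (sums w (map (expn^~ k) s)))%:R * (coll (sums w (map (expn^~ k) s')))%:R * K.
  rewrite H2 -uLd -uLa; apply: (bilinear_square (Y := (w * X).+1) (Z := (w * X').+1)) => //.
  - exact: lpow_coef.
  - by move=> p /mapP[q _ ->] /=.
  - move=> p pL; rewrite ltnS; apply: lpow_le pL => q /mapP[m ms ->] /=.
    exact: sX.
  - move=> p /mapP[q qL ->] /=; rewrite ltnS; apply: lpow_le qL => q' /mapP[m ms ->] /=.
    exact: s'X.
have H4 : cabs S ^+ w <= (size s)%:R ^+ w.-1 * \sum_(q <- Lbw) cabs (T' q.1).
  apply: (@le_trans _ _ ((\sum_(m <- s) cabs (T m)) ^+ w)).
    by apply: lerXn2r; rewrite ?nnegrE ?cabs_ge0 ?sumr_ge0// => *; exact: cabs_ge0.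
  apply: le_trans (exprn_sum_le _ w0 _) _; first by move=> *; exact: cabs_ge0.
  by rewrite ler_wpM2l// exprn_ge0.
have H5 : (\sum_(q <- Lbw) cabs (T' q.1)) ^+ w <=
   (size s')%:R ^+ (w * w.-1) * \sum_(q <- Lbw) cabs (T' q.1) ^+ w.
  apply: le_trans (exprn_sum_le _ w0 _) _; first by move=> *; exact: cabs_ge0.
  by rewrite sizeLbw natrX -exprM.
have H6 : cabs S ^+ (w ^ 2) <= ((size s)%:R * (size s')%:R) ^+ (w * w.-1) *
   \sum_(q <- Lbw) cabs (T' q.1) ^+ w.
  rewrite expnS expn1 exprM.
  apply: (@le_trans _ _ (((size s)%:R ^+ w.-1 * \sum_(q <- Lbw) cabs (T' q.1)) ^+ w)).
    apply: lerXn2r; rewrite ?nnegrE ?exprn_ge0 ?cabs_ge0 ?mulr_ge0 ?exprn_ge0 ?sumr_ge0// => *.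
    exact: cabs_ge0.
  rewrite exprMn -exprM [(w.-1 * w)%N]mulnC exprMn -mulrA ler_wpM2l ?exprn_ge0//.
rewrite mulnC exprM.
apply: (@le_trans _ _ ((((size s)%:R * (size s')%:R) ^+ (w * w.-1) *
   \sum_(q <- Lbw) cabs (T' q.1) ^+ w) ^+ 2)).
  apply: lerXn2r => //; rewrite nnegrE ?exprn_ge0 ?cabs_ge0//.
  rewrite mulr_ge0 ?exprn_ge0 ?mulr_ge0 ?sumr_ge0// => *; rewrite exprn_ge0//.
  exact: cabs_ge0.
rewrite exprMn -exprM -mulrA -mulrA [X in _ ^+ X * _](_ : _ = (2 * w * w.-1)%N).
  by rewrite ler_wpM2l ?exprn_ge0 ?mulr_ge0// mulrA.
by rewrite mulnC mulnA.
Qed.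

End Exponentials.

(** * Separation of variables and spacing *)

(* Writes the condition [v < X] as a sum of [L] equalities between a function of [X] and
   a function of [v], which [block_diagonal_bound] can then remove. *)
Lemma ltn_binary (L v X : nat) : (X < 2 ^ L)%N ->
  (v < X)%N = (\sum_(i < L) (odd (X %/ 2 ^ i) && ((v %/ 2 ^ i).+1 == X %/ 2 ^ i)))%N :> nat.
Proof.
elim: L v X => [|L IH] v X; first by rewrite expn0 big_ord0; case: X.
move=> XL; rewrite big_ord_recl expn0 !divn1.
have /(IH (v %/ 2)%N) : (X %/ 2 < 2 ^ L)%N by rewrite ltn_divLR// -expnSr.
under eq_bigr => i _ do rewrite -!divnMA -expnS.
under [in X in _ -> X]eq_bigr => i _ do rewrite lift0.
by move=> <-; lia.
Qed.

Section Spacing.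
Variable R : realType.
Local Notation C := R[i].
Implicit Types (x y theta : R) (z : C).

Lemma cabs_nat (n : nat) : cabs (n%:R : C) = n%:R.
Proof. by rewrite -(rmorph_nat (real_complex R)) [LHS]cabs_real normr_nat. Qed.

(* Averaging over the sign of the [n]-th block kills its off-diagonal entries; one block
   at a time, with no loss in the bound. *)
Lemma block_diagonal_bound (s s' : seq nat) (c : nat -> nat -> C) (I J : nat -> nat)
    (B : R) :
  (forall a b : nat -> C, (forall m, cabs (a m) <= 1) -> (forall v, cabs (b v) <= 1) ->
    cabs (\sum_(m <- s) \sum_(v <- s') a m * b v * c m v) <= B) ->
  cabs (\sum_(m <- s) \sum_(v <- s') (I m == J v)%:R * c m v) <= B.
Proof.
move=> HB.
(* [K n] is the equality test for blocks below [n] and merges all blocks from [n] on; [K 0] is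
   constantly true. *)
pose K n m v := ((I m == J v) && (I m < n) || (n <= I m) && (n <= J v))%N.
have HK n a b : (forall m, cabs (a m) <= 1) -> (forall v, cabs (b v) <= 1) ->
    cabs (\sum_(m <- s) \sum_(v <- s') a m * b v * ((K n m v)%:R * c m v)) <= B.
  elim: n a b => [|n IH] a b a1 b1.
    under eq_bigr => m _ do under eq_bigr => v _ do rewrite /K ltn0 andbF /= mul1r.
    exact: HB.
  pose sg (x : nat) : C := if x == n then -1 else 1.
  have sg1 (x : nat) : cabs (sg x) = 1 by rewrite /sg; case: eqP; rewrite ?cabsN [cabs _]cabs1.
  have := IH (fun m => sg (I m) * a m) (fun v => sg (J v) * b v) _ _.
  have := IH a b a1 b1.
  set S1 := \sum_(m <- s) _; set S2 := \sum_(m <- s) _; set S3 := \sum_(m <- s) _.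
  have SE : S3 + S3 = S1 + S2.
    rewrite /S1 /S2 /S3 -!big_split/=; apply: eq_bigr => m _.
    rewrite -!big_split/=; apply: eq_bigr => v _.
    suff : (K n.+1 m v)%:R *+ 2 = (K n m v)%:R + sg (I m) * sg (J v) * (K n m v)%:R :> C.
      rewrite mulr2n => /(congr1 (fun u => a m * b v * c m v * u)).
      by rewrite !mulrDr => H; apply: etrans (etrans H _); ring.
    have [/eqP e|e] := boolP ((I m == n) == (J v == n)).
      have -> : K n.+1 m v = K n m v by rewrite /K; lia.
      by rewrite /sg e; case: ifP => _; rewrite ?mulrNN !mul1r.
    have -> : K n.+1 m v = false by rewrite /K; lia.
    rewrite mul0rn; move: e; rewrite /sg.
    by do 2! case: ifP => _ //; rewrite ?mulN1r ?mul1r ?mulr1 ?mulN1r subrr.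
  have S2B : cabs S2 <= B.
    apply: IH => x; rewrite cabsM sg1 mul1r; [exact: a1|exact: b1].
  have : cabs (S3 + S3) <= B + B.
    by rewrite SE; apply: le_trans (cabsD _ _) _; apply: lerD => //; apply: IH.
  by rewrite -mulr2n -mulr_natl cabsM cabs_nat; lra.
(* Beyond the largest [I m] nothing is merged, and [K] is the exact equality test. *)
have := HK (\max_(m <- s) I m).+1 (fun=> 1) (fun=> 1).
rewrite (eq_big_seq (fun m => \sum_(v <- s') (I m == J v)%:R * c m v)); last first.
  move=> m ms; apply: eq_bigr => v _; rewrite !mul1r /K.
  have Im : (I m < (\max_(m <- s) I m).+1)%N by rewrite ltnS leq_bigmax_seq.
  by rewrite Im andbT [((_ < I m)%N)]ltnNge -ltnS Im orbF.
by apply=> ?; rewrite [cabs _]cabs1.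
Qed.

(** Each binary digit of [X m] contributes one equality, so the condition [v < X m] is removed at
    the price of the number [L] of digits. *)
Lemma sum_lt_bound (s s' : seq nat) (c : nat -> nat -> C) (X : nat -> nat) (L : nat)
    (B : R) :
  (forall a b : nat -> C, (forall m, cabs (a m) <= 1) -> (forall v, cabs (b v) <= 1) ->
    cabs (\sum_(m <- s) \sum_(v <- s') a m * b v * c m v) <= B) ->
  {in s, forall m, (X m < 2 ^ L)%N} ->
  cabs (\sum_(m <- s) \sum_(v <- s' | (v < X m)%N) c m v) <= L%:R * B.
Proof.
move=> HB XL.
(* In the equality below, the default [0] taken when the digit of [X m] is zero never equals a
   successor. *)
have -> : \sum_(m <- s) \sum_(v <- s' | (v < X m)%N) c m v =
  \sum_(i < L) \sum_(m <- s) \sum_(v <- s')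
    ((if odd (X m %/ 2 ^ i) then X m %/ 2 ^ i else 0) == (v %/ 2 ^ i).+1)%N%:R * c m v.
  rewrite exchange_big/=; apply: eq_big_seq => m /XL mL.
  rewrite exchange_big/= big_mkcond/=; apply: eq_bigr => v _.
  rewrite -mulr_suml -natr_sum.
  have -> : (if (v < X m)%N then c m v else 0) = (v < X m)%N%:R * c m v.
    by case: ifP; rewrite ?mul1r ?mul0r.
  congr (_%:R * _); rewrite (ltn_binary _ mL); apply: eq_bigr => i _.
  by case: ifP => //=; rewrite eq_sym.
apply: le_trans (cabs_sum _ _ _) _.
rewrite mulr_natl -[L in _ *+ L]card_ord -sumr_const; apply: ler_sum => i _.
exact: (block_diagonal_bound (fun m => if odd (X m %/ 2 ^ i) then X m %/ 2 ^ i else 0)%N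
  (fun v => (v %/ 2 ^ i).+1)).
Qed.

(** Write [sin x = 2 sin y cos y] with [y = x / 2]: the mean value theorem gives [y cos y <= sin y],
    and [cos x >= 0] gives [cos y ^ 2 >= 1/2]. *)
Lemma sin_ge_half x : 0 <= x -> x <= pi / 2 -> x / 2 <= sin x.
Proof.
rewrite le_eqVlt => /orP[/eqP <-|x0 x2]; first by rewrite mul0r sin0.
have pi0 := pi_gt0 R.
pose y := x / 2.
have y0 : 0 < y by rewrite /y; lra.
have c0 : 0 <= cos y by rewrite cos_ge0_pihalf// /y; lra.
have cx : 0 <= cos x by rewrite cos_ge0_pihalf//; lra.
have xE : x = y *+ 2 by rewrite mulr2n /y; lra.
have siny : y * cos y <= sin y.
  have H1 (u : R) : u \in `]0, y[ -> is_derive u 1 sin (cos u) by move=> _; exact: is_derive_sin.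
  have H2 : {within `[0, y]%classic, continuous (@sin R)}%classic.
    by apply: continuous_subspaceT => u; exact: continuous_sin.
  have [c] := MVT y0 H1 H2; rewrite in_itv/= => /andP[c1 c2].
  rewrite sin0 !subr0 => ->; rewrite mulrC ler_wpM2r ?(ltW y0)// -subr_ge0.
  pose u := (c + y) / 2; pose v := (y - c) / 2.
  have -> : cos c - cos y = 2 * (sin u * sin v).
    have -> : c = u - v by rewrite /u /v; lra.
    have -> : y = u + v by rewrite /u /v; lra.
    by rewrite cosB cosD; ring.
  have yx : y = x / 2 by [].
  by rewrite !mulr_ge0// sin_ge0_pi//; apply/andP; split; rewrite /u /v; lra.
have : 1 / 2 <= cos y ^+ 2.
  by move: cx; rewrite xE cos_mulr2n mulr2n; lra.
move=> c2; rewrite {2}xE sin_mulr2n -/y mulr2n.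
by have := ler_wpM2r c0 siny; nra.
Qed.

Lemma cabs_1Bee x : `|x| <= 1 / 2 -> 2 * `|x| <= cabs (1 - ee x).
Proof.
move=> x2; set y := `|x| in x2 *.
have y0 : 0 <= y by exact: normr_ge0.
have -> : cabs (1 - ee x) = cabs (1 - ee y).
  rewrite /y; case: (ger0P x) => // _.
  by rewrite !cabsE /ee/= mulrN cosN sinN !sub0r !sqrrN.
have pi2 := pi_ge2 R.
have := @sin_ge_half (pi * y) _ _.
have -> : cabs (1 - ee y) = 2 * `|sin (pi * y)|.
  rewrite cabsE /ee /= sub0r sqrrN.
  have -> : 2 * pi * y = (pi * y) *+ 2 by rewrite mulr2n; ring.
  rewrite cos_mulr2n sin_mulr2n.
  have -> : (1 - (cos (pi * y) ^+ 2 *+ 2 - 1)) ^+ 2 + (cos (pi * y) * sin (pi * y) *+ 2) ^+ 2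
    = (2 * sin (pi * y)) ^+ 2.
    rewrite !mulr2n; set c := cos _; set sn := sin _.
    have : sn ^+ 2 = 1 - c ^+ 2 by rewrite /sn sin2cos2.
    move=> H; have -> : (c * sn + c * sn) ^+ 2 = 4 * c ^+ 2 * sn ^+ 2 by ring.
    by rewrite exprMn H; ring.
  by rewrite sqrtr_sqr normrM ger0_norm.
move=> H; have : pi * y / 2 <= sin (pi * y) by apply: H; nra.
have := ler_norm (sin (pi * y)); nra.
Qed.

(** Modulo one [x] is [u], and the geometric sum is [|e(u) ^ Y - 1| <= 2] divided by
    [|e(u) - 1| >= 2 |u|]. *)
Lemma geometric_ee_bound x (n : int) (Y : nat) : 0 < `|x - n%:~R| -> `|x - n%:~R| <= 1 / 2 ->
  cabs (\sum_(y < Y) ee (y%:R * x)) <= `|x - n%:~R|^-1.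
Proof.
set u := x - _ => u0 u2.
have -> : \sum_(y < Y) ee (y%:R * x) = \sum_(y < Y) ee u ^+ y.
  apply: eq_bigr => y _; rewrite -eeM_nat mulrC /u mulrBl eeD.
  have -> : - (n%:~R * y%:R) = (- (n * y%:Z))%:~R :> R by rewrite mulrNz intrM.
  by rewrite ee_int mulr1.
have /(congr1 (@cabs R)) := subrX1 (ee u) Y.
rewrite cabsM => E.
have H := cabs_1Bee u2.
have : cabs (ee u - 1) * cabs (\sum_(i < Y) ee u ^+ i) <= 2.
  rewrite -E; apply: le_trans (cabsD _ _) _.
  by rewrite cabsN cabsX cabs_ee expr1n [cabs 1]cabs1.
rewrite -(cabsN (ee u - 1)) opprB => H2.
rewrite -[_^-1]mul1r ler_pdivlMr//.
have := cabs_ge0 (\sum_(i < Y) ee u ^+ i); nra.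
Qed.

(* For each [j] at most two of the points [base + theta * l], one on each side, lie at a
   distance between [j d] and [(j + 1) d] from the integers. *)
Lemma spaced_sum theta (d : R) (L Y : nat) (base : R) :
  0 < d -> d <= 1 / 2 ->
  (forall (l : nat) (n : int), (0 < l)%N -> (l < L)%N -> d <= `|theta * l%:R - n%:~R|) ->
  \sum_(l < L) cabs (\sum_(y < Y) ee (y%:R * (base + theta * l%:R)))
  <= 2 * Y%:R + 2 / d * (1 + ln d^-1).
Proof.
move=> d0 d2 Hd.
pose phi (l : nat) := base + theta * l%:R.
pose n (l : nat) := Num.floor (phi l + 1 / 2).
pose psi (l : nat) := phi l - (n l)%:~R.
have psi2 l : `|psi l| <= 1 / 2.
  have := floor_itv (phi l + 1 / 2); rewrite -/(n l) intrD => /andP[n1 n2].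
  by rewrite ler_norml /psi; apply/andP; split; lra.
(* Distances to the nearest integer are at most [1/2], so the bins of width [d] have indices up to
   [1 / (2 d)]. *)
pose J := Num.truncn (2 * d)^-1.
pose j l := Num.truncn (`|psi l| / d).
have jE l : (j l)%:R * d <= `|psi l| < (j l).+1%:R * d.
  by rewrite -ler_pdivlMr// -ltr_pdivrMr// truncn_itv// divr_ge0// ltW.
have jJ l : (j l <= J)%N.
  rewrite le_truncn// ler_pdivrMr//; apply: le_trans (psi2 l) _.
  by rewrite invfM mulfVK ?gt_eqF//; lra.
(* The bin next to the integers gets the trivial bound, the others that of the geometric sum. *)
pose g (i : nat) : R := if i == 0%N then Y%:R else (i%:R * d)^-1.
have g0 i : 0 <= g i by rewrite /g; case: ifP => // _; rewrite invr_ge0 mulr_ge0// ltW.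
have Gg l : cabs (\sum_(y < Y) ee (y%:R * phi l)) <= g (j l).
  rewrite /g; case: ifPn => [_|jl].
    apply: le_trans (cabs_sum _ _ _) _.
    by under eq_bigr do rewrite cabs_ee; rewrite sumr_const card_ord.
  have jd : 0 < (j l)%:R * d by rewrite mulr_gt0// ltr0n lt0n.
  have /andP[j1 _] := jE l.
  apply: le_trans (@geometric_ee_bound _ (n l) _ _ (psi2 l)) _.
    exact: lt_le_trans j1.
  by rewrite lef_pV2// posrE// (lt_le_trans jd j1).
pose h (l : 'I_L) : bool * 'I_J.+1 := (psi l < 0, inord (j l)).
have hinj : injective h.
  suff H (l l' : 'I_L) : (l < l')%N -> h l <> h l'.
    move=> l l' hl; case: (ltngtP l l') => [/H/(_ hl)[]|/H/(_ (esym hl))[]|ll'].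
    exact: ord_inj.
  move=> ll' [sE /(congr1 val)]; rewrite /= !inordK ?ltnS// => jEq.
  have : `|psi l' - psi l| < d.
    have /andP[a1 a2] := jE l; have /andP[b1 b2] := jE l'.
    rewrite jEq -natr1 in a1 a2; rewrite -natr1 in b2.
    move: a1 a2 b1 b2 sE.
    case: (ltrP (psi l) 0) => s1; case: (ltrP (psi l') 0) => s2 //.
      rewrite (ltr0_norm s1) (ltr0_norm s2) => *; rewrite ltr_norml; apply/andP; split; lra.
    rewrite (ger0_norm s1) (ger0_norm s2) => *; rewrite ltr_norml; apply/andP; split; lra.
  rewrite ltNge => /negP; apply.
  have := Hd (l' - l)%N (n l' - n l) _ _; rewrite subn_gt0 ll' => /(_ isT).
  rewrite (leq_ltn_trans (leq_subr _ _))// => /(_ isT).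
  rewrite natrB ?(ltnW ll')// rmorphB/=; set u := theta * _ - _.
  suff -> : u = psi l' - psi l by [].
  by rewrite /u /psi /phi; ring.
apply: (@le_trans _ _ (\sum_(l < L) g (h l).2)).
  by apply: ler_sum => l _; rewrite /h /= inordK ?ltnS//; exact: Gg.
apply: (@le_trans _ _ (\sum_(t : bool * 'I_J.+1) g t.2)).
  have -> : \sum_(l < L) g (h l).2 = \sum_(t in h @: [set: 'I_L]) g t.2.
    rewrite big_imset/=; last by move=> x y _ _; exact: hinj.
    by apply: eq_bigl => l; rewrite inE.
  by rewrite [X in _ <= X](bigID (mem (h @: [set: 'I_L])))/= lerDl sumr_ge0.
rewrite -(pair_bigA _ (fun (_ : bool) (t : 'I_J.+1) => g t))/= big_bool/=.
have J0 : (0 < J)%N.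
  by rewrite truncn_gt0 -[_^-1]mul1r ler_pdivlMr ?mul1r; lra.
have -> : \sum_(t < J.+1) g t = Y%:R + d^-1 * \sum_(1 <= i < J.+1) i%:R^-1.
  rewrite big_ord_recl {1}/g eqxx; congr (_ + _).
  rewrite big_add1/= big_mkord mulr_sumr; apply: eq_bigr => i _.
  by rewrite /g/= invfM mulrC.
have : \sum_(1 <= i < J.+1) i%:R^-1 <= 1 + ln d^-1 :> R.
  apply: le_trans (harmonic_le R J0) _; rewrite lerD2l ler_ln ?posrE ?ltr0n ?invr_gt0//.
  apply: (@le_trans _ _ (2 * d)^-1); first by rewrite truncn_le invr_ge0; lra.
  by rewrite lef_pV2 ?posrE; lra.
move=> /(ler_wpM2l (ltW (_ : 0 < d^-1))) => /(_ _)/=.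
rewrite invr_gt0 => /(_ d0); lra.
Qed.

Lemma sum_blocks_le (F : nat -> R) (L N : nat) (T : R) :
  (forall a, \sum_(l < L) F (a + l)%N <= T) -> \sum_(z < N * L) F z <= N%:R * T.
Proof.
elim: N F => [|N IH] F H; first by rewrite mul0n big_ord0 mul0r.
rewrite mulSn big_split_ord/= -natr1 mulrDl mul1r addrC.
apply: lerD; last exact: (H 0%N).
apply: (IH (fun z : nat => F (L + z)%N)) => a.
by under eq_bigr => l _ do rewrite addnA; exact: H.
Qed.

(** The range of [z'] is cut into at most [Z / L + 1] blocks of [L] consecutive integers; two
    elements of a block differ by less than [L], so the spacing hypothesis applies inside it. *)
Lemma spaced_double_sum theta (d : R) (L Y Z : nat) (z : nat) :
  0 < d -> d <= 1 / 2 -> (0 < L)%N ->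
  (forall (l : nat) (n : int), (0 < l)%N -> (l < L)%N -> d <= `|theta * l%:R - n%:~R|) ->
  \sum_(z' < Z) cabs (\sum_(y < Y) ee (theta * y%:R * (z%:R - z'%:R))) <=
  (Z%:R / L%:R + 1) * (2 * Y%:R + 2 / d * (1 + ln d^-1)).
Proof.
move=> d0 d2 L0 Hd.
have T0 : 0 <= 2 * Y%:R + 2 / d * (1 + ln d^-1).
  rewrite addr_ge0 ?mulr_ge0// ?invr_ge0 ?(ltW d0)// addr_ge0// ln_ge0//.
  by rewrite invf_ge1//; lra.
pose F (z' : nat) := cabs (\sum_(y < Y) ee (theta * y%:R * (z%:R - z'%:R))).
apply: (@le_trans _ _ (\sum_(z' < (Z %/ L).+1 * L) F z')).
  have ZL : (Z <= (Z %/ L).+1 * L)%N by rewrite ltnW// -ltn_divLR.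
  rewrite -!(big_mkord xpredT F) (big_cat_nat _ ZL)//= lerDl sumr_ge0// => i _.
  exact: cabs_ge0.
apply: (@le_trans _ _ (((Z %/ L).+1)%:R * (2 * Y%:R + 2 / d * (1 + ln d^-1)))).
  apply: sum_blocks_le => a; rewrite /F.
  rewrite (eq_bigr (fun l : 'I_L => cabs (\sum_(y < Y)
      ee (y%:R * (theta * (z%:R - a%:R) + - theta * l%:R))))).
    apply: spaced_sum => // l n l0 lL; have := Hd l (- n) l0 lL.
    by rewrite mulNr -opprD normrN mulrNz opprK.
  by move=> l _; congr cabs; apply: eq_bigr => y _; congr ee; rewrite natrD; ring.
apply: ler_wpM2r => //; rewrite -natr1 lerD2r ler_pdivlMr ?ltr0n//.
by rewrite -natrM ler_nat leq_trunc_div.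
Qed.

(** Multiplied by [q], the quantity [theta * l - n] is [l] times the error [q * theta - b] plus an
    integer. If that integer is not zero and [l] times the error is at most [1/2], the distance is
    at least [1 / (2 q)]. If it is zero, [q] divides [l] and the distance is at least the error
    itself. A large [q] excludes the second case for [l < q]; a large error makes it harmless. *)
Lemma minor_arc_spacing theta (q b : nat) (Q D : R) :
  (0 < q)%N -> coprime b q -> q%:R <= Q -> 4 * Q ^+ 2 <= D ->
  `|q%:R * theta - b%:R| <= Q / D ->
  (Q / 2 < q%:R \/ Q / (2 * D) < `|q%:R * theta - b%:R|) ->
  exists L : nat, [/\ (0 < L)%N, Q / 2 <= L%:R &
    forall (l : nat) (n : int), (0 < l)%N -> (l < L)%N ->
      Q / (2 * D) <= `|theta * l%:R - n%:~R|].
Proof.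
move=> q0 bq qQ QD; set kap := `|_| => kapQ Hor.
have q1 : 1 <= q%:R :> R by rewrite ler1n.
have D0 : 0 < D by apply: lt_le_trans QD; nra.
have Q0 : 0 < Q by lra.
have QQD : Q / D <= 1 / (4 * Q).
  by rewrite ler_pdivrMr// mulrAC ler_pdivlMr ?mul1r; nra.
have main (l : nat) (n : int) : (0 < l)%N -> l%:R * kap <= 1 / 2 ->
    (~~ (q %| l)%N \/ Q / (2 * D) <= kap) -> Q / (2 * D) <= `|theta * l%:R - n%:~R|.
  move=> l0 lk Hq.
  pose m : int := (b * l)%:Z - n * q%:Z.
  have l1 : 1 <= l%:R :> R by rewrite ler1n.
  have E : q%:R * (theta * l%:R - n%:~R) = (q%:R * theta - b%:R) * l%:R + m%:~R.
    by rewrite /m rmorphB/= intrM -!pmulrn natrM; ring.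
  have Ea : q%:R * `|theta * l%:R - n%:~R| = `|(q%:R * theta - b%:R) * l%:R + m%:~R|.
    by rewrite -E normrM ger0_norm//; lra.
  have kl : `|(q%:R * theta - b%:R) * l%:R| = kap * l%:R by rewrite normrM [`|l%:R|]ger0_norm.
  have [m0|m0] := eqVneq m 0; last first.
    have m1 : 1 <= `|m%:~R| :> R by rewrite -intr_norm ler1z -gtz0_ge1 normr_gt0.
    have : 1 / 2 <= q%:R * `|theta * l%:R - n%:~R|.
      rewrite Ea addrC; apply: le_trans (lerB_normD _ _).
      by rewrite kl; lra.
    set t := `|theta * _ - _| => qt.
    have t0 : 0 <= t by exact: normr_ge0.
    have Qt : 1 / 2 <= Q * t by nra.
    have -> : Q / (2 * D) = (Q / D) / 2 by field; lra.
    have : 1 / (4 * Q) <= t by rewrite ler_pdivrMr; nra.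
    by lra.
  case: Hq => [/negP[]|Hk].
    rewrite -(@Gauss_dvdr _ b) 1?coprime_sym//.
    move/eqP: m0; rewrite /m subr_eq0 => /eqP mE.
    have : (q%:Z %| (b * l)%:Z)%Z by rewrite mE dvdz_mull.
    by [].
  have ql : (q <= l)%N.
    rewrite dvdn_leq// -(@Gauss_dvdr _ b) 1?coprime_sym//.
    move/eqP: m0; rewrite /m subr_eq0 => /eqP mE.
    have : (q%:Z %| (b * l)%:Z)%Z by rewrite mE dvdz_mull.
    by [].
  rewrite m0 addr0 kl in Ea.
  apply: (le_trans Hk).
  have q1' : 0 < q%:R :> R by lra.
  rewrite -(ler_pM2l q1') Ea mulrC ler_wpM2l ?ler_nat// normr_ge0//.
have kap0 : 0 <= kap by exact: normr_ge0.
have QQ4 : Q * (Q / D) <= 1 / 4.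
  by rewrite mulrA ler_pdivrMr//; nra.
case: Hor => [qQ2|kapL].
  exists q; split => //; first by rewrite ltW.
  move=> l n l0 lq; apply: main => //; last by left; rewrite gtnNdvd.
  have lq' : l%:R <= q%:R :> R by rewrite ler_nat ltnW.
  apply: (@le_trans _ _ (Q * (Q / D))); last by lra.
  by apply: ler_pM => //; lra.
have kap1 : 0 < kap.
  by apply: le_lt_trans kapL; rewrite divr_ge0//; lra.
(* Here [l < L] means that [l] times the error is at most [1/2]. *)
exists (Num.truncn (2 * kap)^-1).+1; split => //.
  apply/ltW/(le_lt_trans _ (truncnS_gt _)).
  rewrite -[leRHS]mul1r ler_pdivlMr; last by lra.
  by nra.
move=> l n l0; rewrite ltnS truncn_ge_nat; last by rewrite invr_ge0; lra.
rewrite -[_^-1]mul1r ler_pdivlMr => [lk|]; last by lra.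
by apply: main => //; [lra|right; exact: ltW].
Qed.

End Spacing.

(** * Smooth numbers *)

Section Smooth.
Variable R : realType.
Implicit Types (P r : R) (x m v : nat).

Lemma mem_smooth P r x : (x \in smooth_set P r) =
  [&& (0 < x)%N, x%:R <= P & all (fun p => p%:R <= r) (primes x)].
Proof.
rewrite mem_filter mem_iota andbC -andbA add1n ltnS; case: x => //= x.
by rewrite -truncn_gt_nat.
Qed.

Lemma smooth_uniq P r : uniq (smooth_set P r).
Proof. by rewrite filter_uniq// iota_uniq. Qed.

Lemma smooth_gt0 P r x : x \in smooth_set P r -> (0 < x)%N.
Proof. by rewrite mem_smooth => /andP[]. Qed.

Lemma smooth_le P r x : x \in smooth_set P r -> x%:R <= P.
Proof. by rewrite mem_smooth => /and3P[]. Qed.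

Lemma smooth_dvd P r x d : x \in smooth_set P r -> (d %| x)%N -> d \in smooth_set P r.
Proof.
rewrite !mem_smooth => /and3P[x0 xP /allP xr] dx.
have d0 : (0 < d)%N by exact: dvdn_gt0 dx.
apply/and3P; split => //.
  by apply: le_trans xP; rewrite ler_nat dvdn_leq.
apply/allP => p pd; apply: xr; move: pd; rewrite !mem_primes x0 d0.
by move=> /andP[-> /dvdn_trans]; apply.
Qed.

Lemma smooth_pdiv P r m : m \in smooth_set P r -> (1 < m)%N -> (pdiv m)%:R <= r.
Proof.
rewrite mem_smooth => /and3P[_ _ /allP H] m1; apply: H.
by rewrite -[_ \in _]/(pdiv m \in \pi(m)) pi_pdiv.
Qed.

Lemma smoothS P P' r r' : P <= P' -> r <= r' ->
  {subset smooth_set P r <= smooth_set P' r'}.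
Proof.
move=> PP rr x; rewrite !mem_smooth => /and3P[-> xP /allP xr] /=.
rewrite (le_trans xP)//=; apply/allP => p px; apply: le_trans (xr _ px) rr.
Qed.

Lemma size_smooth P r : 0 <= P -> (size (smooth_set P r))%:R <= P.
Proof.
move=> P0; apply: (@le_trans _ _ (Num.truncn P)%:R); last by rewrite truncn_le.
by rewrite ler_nat size_filter (leq_trans (count_size _ _))// size_iota.
Qed.

(** The decreasing order of the primes makes the tails above a stopping [m] a full smooth set, whose
    smoothness bound is the least prime of [m]; no coprimality condition links [m] and [v]. *)
Lemma sum_smooth_first_stop (V : nmodType) (stop : pred nat) P r (F : nat -> V) :
  stop 1%N = false ->
  \sum_(x <- smooth_set P r) F x =
    \sum_(x <- smooth_set P r | first_stop stop x == 0%N) F x +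
    \sum_(m <- smooth_set P r | first_stop stop m == m)
      \sum_(v <- smooth_set (P / m%:R) (pdiv m)%:R) F (m * v)%N.
Proof.
move=> stop1; rewrite (bigID (fun x => first_stop stop x == 0%N))/=; congr (_ + _).
set A := smooth_set P r; set T := first_stop stop.
have uA : uniq A by exact: smooth_uniq.
transitivity (\sum_(m <- A) \sum_(x <- A | T x == m) F x).
  rewrite (exchange_big_dep xpredT)//= big_mkcond big_seq [RHS]big_seq.
  apply: eq_bigr => x xA; have x0 := smooth_gt0 xA.
  case: ifPn => [Tx|].
    have [Txx _ _] := first_stopP stop1 x0 Tx.
    rewrite -big_filter (eq_filter (a2 := pred1 (T x))).
      by rewrite filter_pred1_uniq ?big_seq1// (smooth_dvd xA).
    by move=> y /=; rewrite eq_sym.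
  rewrite negbK => /eqP Tx; rewrite big_seq_cond big1// => m.
  by rewrite Tx => /andP[/smooth_gt0 + /eqP m0]; rewrite -m0.
rewrite [RHS]big_mkcond/= big_seq [RHS]big_seq; apply: eq_bigr => m mA.
have m0 := smooth_gt0 mA.
case: ifPn => [/eqP Tm|Tm]; last first.
  rewrite big_seq_cond big1// => x /andP[xA /eqP Tx].
  have Tx0 : T x != 0%N by rewrite Tx -lt0n.
  have [_ + _] := first_stopP stop1 (smooth_gt0 xA) Tx0.
  by rewrite -/T Tx => E; rewrite E eqxx in Tm.
have [m1 _ _] := first_stop_fix stop1 m0 Tm.
rewrite -big_filter -(big_map (muln m) xpredT F); apply: perm_big.
apply: uniq_perm; first by rewrite filter_uniq.
  rewrite map_inj_uniq ?smooth_uniq// => a b /eqP.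
  by rewrite eqn_pmul2l// => /eqP.
have mR : 0 < m%:R :> R by rewrite ltr0n.
move=> x; rewrite mem_filter; apply/andP/mapP => [[/eqP Tx xA]|[v]].
  have x0 := smooth_gt0 xA.
  have Tx0 : T x != 0%N by rewrite Tx -lt0n.
  have [d1 _ d3] := first_stopP stop1 x0 Tx0; rewrite -/T Tx in d1 d3.
  exists (x %/ m)%N; last by rewrite mulnC divnK.
  rewrite mem_smooth divn_gt0// dvdn_leq//=; apply/andP; split.
    by rewrite ler_pdivlMr// -natrM divnK// (smooth_le xA).
  by apply/allP => p /d3; rewrite ler_nat.
rewrite mem_smooth => /and3P[v0 vP /allP vm] ->.
have vm' : {in primes v, forall p, (p <= pdiv m)%N}.
  by move=> p /vm; rewrite ler_nat.
split; first by rewrite /T first_stopM.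
rewrite mem_smooth muln_gt0 m0 v0 /=; apply/andP; split.
  by rewrite natrM mulrC -ler_pdivlMr.
apply/allP => p; rewrite primesM// => /orP[pm|/vm' pv].
  by move: mA; rewrite mem_smooth => /and3P[_ _ /allP]; apply.
by apply: le_trans (smooth_pdiv mA m1); rewrite ler_nat.
Qed.

End Smooth.

(** * Mean values *)

Section Integrals.
Local Open Scope classical_set_scope.
Variable R : realType.
Local Notation mu := (@lebesgue_measure R).
Local Notation C := R[i].

(** [c] times the push-forward of Lebesgue measure under the affine map agrees with Lebesgue measure
    on half-open intervals, hence everywhere. *)
Lemma ge0_integral_affine (c d : R) (f : R -> \bar R) : 0 < c ->
  measurable_fun setT f -> (forall x, (0 <= f x)%E) ->
  (\int[mu]_x f x = c%:E * \int[mu]_x f (c * x + d)%R)%E.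
Proof.
move=> c0 mf f0.
pose phi : measurableTypeR R -> measurableTypeR R := fun x : R => (c * x + d : R).
have mphi : measurable_fun setT phi.
  by apply: measurable_funD => //; exact: measurable_funM.
pose cn := NngNum (ltW c0).
pose nu0 := mscale cn (pushforward mu phi).
pose nu := nu0 mphi.
have nuE A : measurable A -> mu A = nu A.
  apply: lebesgue_measure_unique => X [[a b] /= ab <-].
  rewrite /nu /nu0 /mscale/= /pushforward.
  have -> : phi @^-1` `]a, b] = `]((a - d) / c), ((b - d) / c)]%classic.
    apply/seteqP; split => x /=; rewrite !in_itv/= /phi.
      by rewrite ltr_pdivrMr// ler_pdivlMr// => /andP[? ?]; apply/andP; split; lra.
    by rewrite ltr_pdivrMr// ler_pdivlMr// => /andP[? ?]; apply/andP; split; lra.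
  rewrite !lebesgue_measure_itv/= !lte_fin ltr_pM2r ?invr_gt0// ltrD2r.
  case: ifP => _; last by rewrite mule0.
  rewrite -!EFinD -EFinM; congr (_%:E); field; lra.
rewrite (@eq_measure_integral _ _ _ setT nu)//; last by move=> A mA _; exact: (nuE A mA).
rewrite ge0_integral_mscale//=; congr (_ * _)%E.
by rewrite ge0_integral_pushforward.
Qed.

Lemma is_derive_sumf (I : Type) (r : seq I) (F f : I -> R -> R) :
  (forall i (x : R), is_derive x 1 (F i) (f i x)) ->
  forall x : R, is_derive x 1 (fun y => \sum_(i <- r) F i y) (\sum_(i <- r) f i x).
Proof.
move=> H x; elim: r => [|i r IH].
  rewrite big_nil (_ : (fun _ => _) = cst 0); first exact: is_derive_cst.
  by apply/funext => y; rewrite big_nil.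
rewrite big_cons (_ : (fun _ => _) = F i \+ (fun y => \sum_(j <- r) F j y)).
  exact: is_deriveD.
by apply/funext => y; rewrite big_cons.
Qed.

Lemma continuous_sumf (I : Type) (r : seq I) (f : I -> R -> R) :
  (forall i, continuous (f i)) -> continuous (fun y => \sum_(i <- r) f i y).
Proof.
move=> H; elim: r => [|i r IH].
  rewrite (_ : (fun _ => _) = cst 0); first exact: cst_continuous.
  by apply/funext => y; rewrite big_nil.
rewrite (_ : (fun _ => _) = f i \+ (fun y => \sum_(j <- r) f j y)).
  by move=> x; apply: continuousD; [exact: H|exact: IH].
by apply/funext => y; rewrite big_cons.
Qed.

Lemma continuous_cosM (d : R) : continuous (fun x : R => cos (d * x)).
Proof.
move=> x; apply: continuous_comp; last exact: continuous_cos.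
by apply: continuousM => //; exact: cst_continuous.
Qed.

Lemma continuous_sinM (d : R) : continuous (fun x : R => sin (d * x)).
Proof.
move=> x; apply: continuous_comp; last exact: continuous_sin.
by apply: continuousM => //; exact: cst_continuous.
Qed.

Lemma sin_2piB (a b : nat) : sin (2 * pi * (a%:R - b%:R)) = 0 :> R.
Proof.
have := ee_int R (a%:Z - b%:Z); rewrite rmorphB/= => /(congr1 (@complex.Im R)).
by rewrite /ee/=.
Qed.

Lemma cabs_sum_ee_sqr (t : seq nat) (x : R) :
  cabs (\sum_(a <- t) ee (x * a%:R)) ^+ 2 =
  \sum_(a <- t) \sum_(b <- t) cos (2 * pi * (a%:R - b%:R) * x).
Proof.
have E : \sum_(a <- t) ee (x * a%:R) = ((\sum_(a <- t) cos (2 * pi * (x * a%:R))) +i*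
    (\sum_(a <- t) sin (2 * pi * (x * a%:R))))%C.
  elim: t => [|a t IH]; first by rewrite !big_nil.
  by rewrite !big_cons IH /ee; simpc.
rewrite cabsE E /= sqr_sqrtr ?addr_ge0 ?sqr_ge0// !expr2 !big_distrlr/= -big_split/=.
apply: eq_bigr => a _; rewrite -big_split/=; apply: eq_bigr => b _.
by rewrite -cosB; congr cos; ring.
Qed.

Lemma Parseval_ee (t : seq nat) :
  (\int[mu]_(x in `[0%R, 1%R]) (cabs (\sum_(a <- t) ee (x * a%:R)) ^+ 2)%:E
   = ((coll t)%:R)%:E)%E.
Proof.
pose d (a b : nat) : R := 2 * pi * (a%:R - b%:R).
pose f (x : R) := \sum_(a <- t) \sum_(b <- t) cos (d a b * x).
(* Primitive of each term: off the diagonal the frequency is [2 pi] times a nonzero integer, so the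
   primitive vanishes at [0] and at [1]. *)
pose G (a b : nat) (x : R) := if a == b then x else (d a b)^-1 * sin (d a b * x).
pose F (x : R) := \sum_(a <- t) \sum_(b <- t) G a b x.
have dG a b (x : R) : is_derive x 1 (G a b) (cos (d a b * x)).
  rewrite /G; have [ab|ab] := eqVneq a b.
    by rewrite /d ab subrr mulr0 mul0r cos0; exact: is_derive_id.
  have d0 : d a b != 0.
    rewrite /d !mulf_neq0 ?subr_eq0 ?eqr_nat//; first by rewrite gt_eqF// pi_gt0.
  have H1 : is_derive x 1 (fun y : R => d a b * y) (d a b).
    rewrite -[X in is_derive _ _ _ X]mulr1.
    exact: (is_deriveZ (d a b) (is_derive_id x 1)).
  have H2 : is_derive x 1 (sin \o (fun y : R => d a b * y)) (d a b * cos (d a b * x)).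
    by rewrite mulrC; exact: is_derive1_comp.
  have := is_deriveZ (d a b)^-1 H2.
  by rewrite [X in is_derive _ _ _ X]mulrA mulVf// mul1r.
have dF (x : R) : is_derive x 1 F (f x).
  apply: (is_derive_sumf t (F := fun a y => \sum_(b <- t) G a b y)
    (f := fun a y => \sum_(b <- t) cos (d a b * y))) => a y.
  exact: (is_derive_sumf t (F := G a) (f := fun b y => cos (d a b * y))).
have cf : continuous f.
  by apply: continuous_sumf => a; apply: continuous_sumf => b; exact: continuous_cosM.
rewrite (_ : (fun _ => _) = EFin \o f); last first.
  by apply/funext => x; rewrite cabs_sum_ee_sqr.
rewrite (@continuous_FTC2 _ f F 0 1) //.
- rewrite -EFinB; congr (_%:E).
  rewrite /F /coll natr_sum -sumrB; apply: eq_bigr => a _.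
  rewrite natr_sum -sumrB; apply: eq_bigr => b _.
  rewrite /G; case: eqVneq => _; first by rewrite subr0.
  by rewrite mulr1 /d sin_2piB !mulr0 sin0 mulr0 subr0.
- by apply: continuous_subspaceT => x; exact: cf.
- have dxF (x : R) : derivable F x 1 by apply: ex_derive.
  have cF : continuous F.
    by move=> x; apply: differentiable_continuous; apply/derivable1_diffP.
  split => //.
  + by apply: cvg_at_right_filter; exact: cF.
  + by apply: cvg_at_left_filter; exact: cF.
- by move=> x _; rewrite derive1E; apply: derive_val.
Qed.

Lemma sum_ee_pow w (t : seq nat) (x : R) :
  (\sum_(a <- t) ee (x * a%:R)) ^+ w = \sum_(a <- sums w t) ee (x * a%:R).
Proof.
pose L := [seq (a, 1 : C) | a <- t].
have LE (M : seq (nat * C)) : {in M, forall p, p.2 = 1} ->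
    epoly M x = \sum_(a <- unzip1 M) ee (x * a%:R).
  by move=> H; rewrite big_map; apply: eq_big_seq => p /H ->; rewrite mul1r.
have L1 : {in L, forall p, p.2 = 1} by move=> p /mapP[a _ ->].
have uL : unzip1 L = t by rewrite /unzip1 -map_comp map_id_in.
have Lw : {in lpow w L, forall p, p.2 = 1}.
  elim: w => [|w IH] p; first by rewrite inE => /eqP ->.
  by case/allpairsP => -[a b] /= [/L1 -> /IH -> ->] /=; rewrite mulr1.
by rewrite -[in LHS]uL -(LE _ L1) -epoly_pow (LE _ Lw) unzip1_lpow uL.
Qed.

Lemma f_abs_ge0 k P r (x : R) : 0 <= f_abs k P r x.
Proof. by rewrite f_absE cabs_ge0. Qed.

(** Even moments become collision counts, which are monotone in the set of summands;
    [pointwise_bound] relies on this for subsets of a smooth set. *)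
Lemma U_even k w P r : (0 < w)%N ->
  U k (2 * w%:R) P r = ((coll (sums w (map (expn^~ k) (smooth_set P r))))%:R : R)%:E.
Proof.
move=> w0; rewrite -Parseval_ee; apply: eq_integral => x _; congr (_%:E).
rewrite -natrM powR_mulrn ?f_abs_ge0// mulnC exprM; congr (_ ^+ 2).
by rewrite -sum_ee_pow f_absE cabsX big_map.
Qed.

Lemma coll_sums1 (t : seq nat) : uniq t -> coll (sums 1 t) = size t.
Proof.
move=> ut; have -> : sums 1 t = t.
  by rewrite /sums /=; elim: t {ut} => //= a t ->; rewrite addn0.
rewrite /coll -sum1_size; apply: eq_big_seq => a at_.
under eq_bigr => b _ do rewrite eq_sym.
transitivity (count_mem a t); last by rewrite count_uniq_mem// at_.
by rewrite -sum1_count [RHS]big_mkcond/=; apply: eq_bigr => b _; case: eqP.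
Qed.

Lemma continuous_f_abs k P r : continuous (f_abs k P r : R -> R).
Proof.
move=> x; apply: continuous_comp; last exact: sqrt_continuous.
have H (g : R -> R) : continuous g -> continuous (fun y => g y ^+ 2).
  move=> cg; rewrite (_ : (fun _ => _) = g \* g); last by apply/funext => y; rewrite expr2.
  by move=> y; apply: continuousM; exact: cg.
apply: continuousD.
  apply: H; apply: continuous_sumf => a y.
  rewrite (_ : (fun _ => _) = fun y : R => cos (2 * pi * (a ^ k)%:R * y)).
    exact: continuous_cosM.
  by apply/funext => z; congr cos; ring.
apply: H; apply: continuous_sumf => a y.
rewrite (_ : (fun _ => _) = fun y : R => sin (2 * pi * (a ^ k)%:R * y)).
  exact: continuous_sinM.
by apply/funext => z; congr sin; ring.
Qed.

Lemma measurable_f_abs_powR k P r u (D : set R) :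
  measurable_fun D (fun x : R => (f_abs k P r x) `^ u).
Proof.
apply/(measurable_funTS).
apply: (measurableT_comp (measurable_powR _)).
by apply: continuous_measurable_fun; exact: continuous_f_abs.
Qed.

Lemma measurable_f_abs_powR_EFin k P r u (D : set R) :
  measurable_fun D (fun x : R => ((f_abs k P r x) `^ u)%:E).
Proof. by apply/measurable_EFinP; exact: measurable_f_abs_powR. Qed.

Lemma f_abs_le_size k P r (x : R) : f_abs k P r x <= (size (smooth_set P r))%:R.
Proof.
rewrite f_absE; apply: le_trans (cabs_sum _ _ _) _.
by under eq_bigr do rewrite cabs_ee; rewrite big_const_seq count_predT iter_addr addr0.
Qed.

Lemma f_abs_le k P r (x : R) : 0 <= P -> f_abs k P r x <= P.
Proof. by move=> P0; apply: le_trans (f_abs_le_size _ _ _ _) (size_smooth _ P0). Qed.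

Lemma U_le k (u P r : R) : 0 <= P -> 0 <= u -> (U k u P r <= (P `^ u)%:E)%E.
Proof.
move=> P0 u0.
apply: (@le_trans _ _ (\int[mu]_(x in `[0%R, 1%R]) (cst (P `^ u)%:E x))%E).
  apply: ge0_le_integral => //.
  - by move=> x _; rewrite lee_fin powR_ge0.
  - exact: measurable_f_abs_powR_EFin.
  - by move=> x _; rewrite lee_fin ler_powRl ?f_abs_ge0// f_abs_le.
by rewrite integral_cst// [X in (_ * X)%E]lebesgue_measure_itv/= lte01 sube0 mule1.
Qed.

(** Jensen's inequality against the second moment, which is exactly the number [c] of summands: the
    tangent to [y ^ (u / 2)] at [y = c] is taken at [y = |f| ^ 2] and integrated. *)
Lemma U_ge_size k (u P r : R) : (0 < k)%N -> 2 <= u ->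
  (((size (smooth_set P r))%:R `^ (u / 2))%:E <= U k u P r)%E.
Proof.
move=> k0 u2; set c := (size _)%:R.
have [c0|c0] := eqVneq c 0.
  rewrite c0 powR0; last by rewrite gt_eqF//; lra.
  by apply: integral_ge0 => x _; rewrite lee_fin powR_ge0.
have c1 : 0 < c by rewrite lt_neqAle eq_sym c0 ler0n.
pose p := u / 2; have p1 : 1 <= p by rewrite /p; lra.
have tang (x : R) : c `^ p + p * c `^ (p - 1) * f_abs k P r x `^ 2 <=
    f_abs k P r x `^ u + p * c `^ p.
  have := powR_tangent p1 c1 (powR_ge0 (f_abs k P r x) 2).
  rewrite -powRrM (_ : 2 * p = u); last by rewrite /p; field.
  have : c * c `^ (p - 1) = c `^ p by rewrite mulr_powRB1 ?ltW//; lra.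
  by move=> <-; lra.
have cp0 : 0 <= c `^ p by exact: powR_ge0.
have cp1 : 0 <= p * c `^ (p - 1) by rewrite mulr_ge0 ?powR_ge0//; lra.
have I01 : mu `[0%R, 1%R] = 1%E by rewrite lebesgue_measure_itv/= lte01 sube0.
have L : (\int[mu]_(x in `[0%R, 1%R]) (c `^ p + p * c `^ (p - 1) * f_abs k P r x `^ 2)%:E
   <= \int[mu]_(x in `[0%R, 1%R]) (f_abs k P r x `^ u + p * c `^ p)%:E)%E.
  apply: ge0_le_integral => //.
  - by move=> x _; rewrite lee_fin addr_ge0// mulr_ge0// powR_ge0.
  - apply/measurable_EFinP; apply: measurable_funD => //.
    by apply: measurable_funM => //; exact: measurable_f_abs_powR.
  - apply/measurable_EFinP; apply: measurable_funD => //.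
    exact: measurable_f_abs_powR.
  - by move=> x _; rewrite lee_fin.
have U2 : (\int[mu]_(x in `[0%R, 1%R]) (f_abs k P r x `^ 2)%:E = c%:E)%E.
  have := @U_even k 1 P r isT; rewrite mulr1 /U => ->; congr (_%:E).
  rewrite coll_sums1; first by rewrite size_map.
  rewrite map_inj_uniq ?smooth_uniq// => a b /eqP.
  by rewrite eqn_exp2r// => /eqP.
move: L.
under eq_integral do rewrite EFinD EFinM.
under [in X in (_ <= X)%E]eq_integral do rewrite EFinD.
have m2 := @measurable_f_abs_powR_EFin k P r 2 `[0%R, 1%R].
have mu' := @measurable_f_abs_powR_EFin k P r u `[0%R, 1%R].
rewrite ge0_integralD//; last 2 first.
- by move=> x _; rewrite -EFinM lee_fin mulr_ge0// powR_ge0.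
- exact: measurable_funeM.
rewrite ge0_integralD//; last 2 first.
- by move=> x _; rewrite lee_fin powR_ge0.
- by move=> x _; rewrite lee_fin mulr_ge0//; lra.
rewrite ge0_integralZl_EFin//; last by move=> x _; rewrite lee_fin powR_ge0.
rewrite U2 !integral_cst//; rewrite ![(_ * lebesgue_measure _)%E](congr1 _ I01) !mule1.
have -> : (\int[mu]_(x in `[0%R, 1%R]) (f_abs k P r x `^ u)%:E = U k u P r)%E by [].
have : c * c `^ (p - 1) = c `^ p by rewrite mulr_powRB1 ?ltW//; lra.
case: (U k u P r) => [y| |] //; rewrite -?EFinM -?EFinD ?lee_fin => cE; last first.
  by move=> _; rewrite leey.
rewrite -/p; nra.
Qed.

End Integrals.

(** * Admissible exponents *)

Section Admissible.
Local Open Scope classical_set_scope.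
Variable R : realType.

Lemma powRDp (x a b : R) : 0 < x -> x `^ (a + b) = x `^ a * x `^ b.
Proof. by move=> x0; rewrite powRD//; apply/implyP => _; rewrite gt_eqF. Qed.

(* Each product [a * b] with [b <= Z] is again smooth, and arises from at most [d(a * b)]
   pairs. *)
Lemma smooth_count_step (Z J : nat) :
  (Z * size (smooth_set (Z ^ J)%N%:R (Z%:R : R)) <=
   \sum_(n <- smooth_set (Z ^ J.+1)%N%:R (Z%:R : R)) size (divisors n))%N.
Proof.
set A := smooth_set (Z ^ J)%:R _; set A' := smooth_set (Z ^ J.+1)%:R _.
have uA : uniq A by exact: smooth_uniq.
have uA' : uniq A' by exact: smooth_uniq.
have -> : (Z * size A = \sum_(n <- A') \sum_(a <- A) \sum_(b <- iota 1 Z) (a * b == n))%N.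
  rewrite exchange_big/= mulnC.
  under eq_bigr => a _ do rewrite exchange_big/=.
  transitivity (\sum_(a <- A) Z)%N.
    by rewrite big_const_seq count_predT iter_addn_0 mulnC.
  apply: eq_big_seq => a aA.
  transitivity (\sum_(b <- iota 1 Z) 1)%N; first by rewrite sum1_size size_iota.
  apply: eq_big_seq => b; rewrite mem_iota add1n ltnS => /andP[b0 bZ].
  have abA : (a * b)%N \in A'.
    move: aA; rewrite !mem_smooth => /and3P[a0 aZ /allP ap].
    apply/and3P; split; first by rewrite muln_gt0 a0.
      by rewrite ler_nat expnSr leq_mul// -(ler_nat R).
    apply/allP => p; rewrite primesM// => /orP[/ap//|].
    rewrite mem_primes ler_nat => /and3P[_ _ /(dvdn_leq b0)] pb.
    exact: leq_trans pb bZ.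
  transitivity (count_mem (a * b)%N A'); first by rewrite count_uniq_mem// abA.
  by rewrite -sum1_count [LHS]big_mkcond/=; apply: eq_bigr => n _; rewrite eq_sym; case: eqP.
rewrite big_seq [leqRHS]big_seq; apply: leq_sum => n nA'.
have n0 := smooth_gt0 nA'.
apply: (@leq_trans (\sum_(a <- A) (a %| n))%N).
  rewrite big_seq [leqRHS]big_seq; apply: leq_sum => a /smooth_gt0 a0.
  have [/dvdnP[b ->]|an] := boolP (a %| n)%N; last first.
    rewrite big1 // => b _; case: eqP => // abn.
    by rewrite -abn dvdn_mulr in an.
  apply: (@leq_trans (count_mem b (iota 1 Z))); last first.
    by rewrite count_uniq_mem ?iota_uniq//; case: (_ \in _).
  rewrite -sum1_count [leqRHS]big_mkcond/=; apply: leq_sum => c _.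
  by rewrite [(b * a)%N]mulnC eqn_pmul2l//; case: eqP.
rewrite -big_mkcond/= sum1_count -size_filter; apply: uniq_leq_size.
  by rewrite filter_uniq.
by move=> a; rewrite mem_filter -dvdn_divisors// => /andP[].
Qed.

(** [J] applications of [smooth_count_step], starting from the single number [1]. All integers met
    are at most [Z ^ J], so one divisor bound serves every step. *)
Lemma smooth_count (d : R) (J : nat) : 0 < d -> exists2 C : R, 1 <= C &
  forall Z : nat, (0 < Z)%N ->
    (Z%:R ^+ J : R) <=
    (C * (Z%:R ^+ J) `^ d) ^+ J * (size (smooth_set (Z ^ J)%N%:R (Z%:R : R)))%:R.
Proof.
move=> d0; have [C C1 HC] := divisor_bound d0; exists C => // Z Z0.
have Z1 : 1 <= Z%:R :> R by rewrite ler1n.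
set B := C * _.
have B0 : 0 <= B by rewrite mulr_ge0 ?powR_ge0//; lra.
suff H j : (j <= J)%N -> Z%:R ^+ j <= B ^+ j *
    (size (smooth_set (Z ^ j)%N%:R (Z%:R : R)))%:R.
  exact: H.
elim: j => [|j IH] jJ.
  rewrite !expr0 mul1r ler1n expn0.
  have : 1%N \in smooth_set 1%N%:R (Z%:R : R) by rewrite mem_smooth lexx.
  by case: (smooth_set _ _).
have {IH} := IH (ltnW jJ); rewrite !exprS => IH.
apply: le_trans (ler_wpM2l (ler0n _ Z) IH) _.
rewrite mulrCA [leRHS](_ : _ = B ^+ j * (B * (size (smooth_set (Z ^ j.+1)%N%:R (Z%:R : R)))%:R)); last by ring.
rewrite ler_wpM2l ?exprn_ge0// -natrM.
apply: (@le_trans _ _ (\sum_(n <- smooth_set (Z ^ j.+1)%N%:R (Z%:R : R)) size (divisors n))%N%:R).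
  by rewrite ler_nat smooth_count_step.
rewrite natr_sum.
apply: (@le_trans _ _ (\sum_(n <- smooth_set (Z ^ j.+1)%N%:R (Z%:R : R)) B)).
  rewrite big_seq [leRHS]big_seq; apply: ler_sum => n nA.
  apply: le_trans (HC _ (smooth_gt0 nA)) _; rewrite ler_wpM2l//; first by lra.
  rewrite ler_powRl// ?(ltW d0)//; apply: le_trans (smooth_le nA) _.
  by rewrite natrX ler_weXn2l.
by rewrite big_const_seq count_predT iter_addr addr0 mulr_natr.
Qed.

Lemma powR_unbounded (a K P0 : R) : 0 < a -> exists2 Z : nat, (0 < Z)%N &
  P0 <= Z%:R /\ K < Z%:R `^ a.
Proof.
move=> a0; pose M := Num.max P0 ((Num.max K 1) `^ a^-1).
exists (Num.truncn M).+1 => //.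
have ZM : M < (Num.truncn M).+1%:R by exact: truncnS_gt.
split; first by apply/ltW/(le_lt_trans _ ZM); rewrite /M le_max lexx.
have K1 : 0 < Num.max K 1 by rewrite lt_max ltr01 orbT.
apply: (@le_lt_trans _ _ (Num.max K 1)); first by rewrite le_max lexx.
rewrite [X in X < _](_ : _ = (Num.max K 1 `^ a^-1) `^ a); last first.
  by rewrite -powRrM mulVf ?gt_eqF// powRr1// ltW.
have MZ : Num.max K 1 `^ a^-1 < (Num.truncn M).+1%:R.
  by apply: le_lt_trans ZM; rewrite /M le_max lexx orbT.
by apply: (gt0_ltr_powR a0 _ _ MZ); rewrite nnegrE ?powR_ge0// ler0n.
Qed.

(* Test admissibility on [P = Z ^ J], [R = Z], where the smooth numbers are at least
   [P `^ (1 - eps)] in number, and bound the mean value below by its second moment. *)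
Lemma admissible_lower (k : nat) (u D : R) : (0 < k)%N -> 2 <= u ->
  admissible k u D -> k%:R - u / 2 <= D.
Proof.
move=> k0 u2 adm; rewrite leNgt; apply/negP => DL.
pose e := k%:R - u / 2 - D; have e0 : 0 < e by rewrite /e; lra.
have e4 : 0 < e / 4 by lra.
have [eta [eta0 [C [P0 HC]]]] := adm _ e4.
(* With [P = Z ^ J] this makes [Z <= P ^ eta]. *)
pose J := (Num.truncn eta^-1).+1.
have J0 : 0 < J%:R :> R by rewrite ltr0n.
have Jeta : 1 <= J%:R * eta.
  by rewrite -ler_pdivrMr// mul1r ltW// truncnS_gt.
(* The divisor losses then amount to [P ^ (e / 4)]; with the [e / 4] of admissibility, half of the
   gap [e] remains. *)
pose d := e / (2 * J%:R * u).
have u0 : 0 < u by lra.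
have d0 : 0 < d by rewrite divr_gt0// !mulr_gt0.
have [C' C'1 HC'] := smooth_count J d0.
pose K := C * (C' ^+ J) `^ (u / 2).
have [Z Z0 [ZP0 ZK]] := @powR_unbounded (J%:R * (e / 2)) K P0 (mulr_gt0 J0 (divr_gt0 e0 (ltr0Sn _ 1))).
have Z1 : 1 <= Z%:R :> R by rewrite ler1n.
pose P : R := Z%:R ^+ J.
have PZ : Z%:R <= P by rewrite /P /J exprS ler_peMr ?exprn_ege1//; lra.
have P1 : 1 <= P by lra.
have Pp : 0 < P by lra.
have PE (x : R) : P `^ x = Z%:R `^ (J%:R * x) by rewrite /P -powR_mulrn// powRrM.
have ZR : Z%:R <= P `^ eta by rewrite PE le1r_powR.
have := HC P Z%:R (le_trans ZP0 PZ) Z1 ZR.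
set S := (size (smooth_set P Z%:R))%:R : R.
have HS : P <= (C' * P `^ d) ^+ J * S.
  by have := HC' Z Z0; rewrite natrX.
move=> /(le_trans (U_ge_size _ _ k0 u2)); rewrite lee_fin -/S => HU.
have W0 : 0 <= (C' * P `^ d) ^+ J by rewrite exprn_ge0// mulr_ge0 ?powR_ge0//; lra.
have S0 : 0 <= S by exact: ler0n.
have : P `^ (u / 2) <= ((C' * P `^ d) ^+ J) `^ (u / 2) * (C * P `^ (u - k%:R + D + e / 4)).
  apply: le_trans (ler_powRl (ltW Pp) HS (_ : 0 <= u / 2)) _; first by lra.
  by rewrite powRM// ler_wpM2l ?powR_ge0.
rewrite exprMn powRM ?exprn_ge0 ?powR_ge0//; last by lra.
rewrite -[(P `^ d) ^+ J]powR_mulrn ?powR_ge0// -!powRrM.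
rewrite [leRHS](_ : _ = K * (P `^ (d * (J%:R * (u / 2))) * P `^ (u - k%:R + D + e / 4))); last first.
  by rewrite /K; ring.
rewrite -powRDp// => H.
have : P `^ (e / 2) <= K.
  have EE : u / 2 = e / 2 + (d * (J%:R * (u / 2)) + (u - k%:R + D + e / 4)).
    by rewrite /d /e; field; rewrite !gt_eqF.
  by move: H; rewrite {1}EE [P `^ (e / 2 + _)]powRDp// ler_pM2r ?powR_gt0.
by rewrite PE leNgt ZK.
Qed.

(* For [N] below a small power of [P] the trivial bound [U <= N `^ u] suffices. *)
Lemma admissible_uniform (k : nat) (u D : R) : 0 <= u -> admissible k u D ->
  forall eps : R, 0 < eps -> exists2 eta : R, 0 < eta & exists2 C : R, 0 < C &
  forall P N r : R, 1 <= N -> N <= P -> 1 <= r -> r <= P `^ eta ->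
    (U k u N r <= (C * N `^ (u - k%:R + D) * P `^ eps)%:E)%E.
Proof.
move=> u0 adm eps eps0.
have [eta [eta0 [C [P0 HC]]]] := adm _ eps0.
(* [N ^ K] dominates [N ^ (k - D)], the ratio of the trivial bound to the desired one. It is at most
   [P ^ eps] for [N <= P ^ kap] and at most [C1] for [N <= M]. *)
pose K := `|k%:R - D| + 1.
have K1 : 1 <= K by rewrite lerDr.
have KD : k%:R - D <= K by apply: le_trans (ler_norm _) _; rewrite lerDl.
pose kap := eps / K; have kap0 : 0 < kap by rewrite divr_gt0//; lra.
pose M := Num.max P0 1.
have M1 : 1 <= M by rewrite le_max lexx orbT.
pose C1 := M `^ K.
have C11 : 1 <= C1 by rewrite powR_ge1//; lra.
(* For [N >= P ^ kap] this gives [r <= N ^ eta]. *)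
exists (eta * kap); first by rewrite mulr_gt0.
exists (`|C| + C1); first by have := normr_ge0 C; lra.
move=> P N r N1 NP r1 rP.
have N0 : 0 < N by lra.
have P1 : 1 <= P by lra.
have PE1 : 1 <= P `^ eps by rewrite powR_ge1// ltW.
have NE0 : 0 <= N `^ (u - k%:R + D) by exact: powR_ge0.
have small : N `^ K <= C1 * P `^ eps -> (U k u N r <= ((`|C| + C1) * N `^ (u - k%:R + D) * P `^ eps)%:E)%E.
  move=> H; apply: le_trans (U_le _ _ (ltW N0) u0) _; rewrite lee_fin.
  have -> : u = u - k%:R + D + (k%:R - D) by ring.
  rewrite powRDp//; have -> : u - k%:R + D + (k%:R - D) - k%:R + D = u - k%:R + D by ring.
  rewrite mulrAC [leRHS]mulrC ler_wpM2l//.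
  apply: le_trans (ler_powR N1 KD) _; apply: le_trans H _.
  by rewrite ler_wpM2r ?powR_ge0// lerDr.
have [NM|NM] := ltP N M.
  apply: small; apply: (@le_trans _ _ C1); first by rewrite ler_powRl//; lra.
  by rewrite ler_peMr//; lra.
have [NK|NK] := ltP N (P `^ kap).
  apply: small; apply: (@le_trans _ _ (P `^ eps)); last by rewrite ler_peMl//; lra.
  have -> : eps = kap * K by rewrite /kap divfK// gt_eqF//; lra.
  by rewrite powRrM ler_powRl//; lra.
have rN : r <= N `^ eta.
  apply: (le_trans rP); rewrite mulrC powRrM ler_powRl ?powR_ge0//.
  exact: ltW.
have NP0 : P0 <= N by apply: le_trans NM; rewrite le_max lexx.
apply: le_trans (HC N r NP0 r1 rN) _; rewrite lee_fin powRDp// mulrA.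
have NP' : N `^ eps <= P `^ eps by rewrite ler_powRl//; lra.
apply: (@le_trans _ _ (`|C| * N `^ (u - k%:R + D) * N `^ eps)).
  by rewrite ler_wpM2r ?powR_ge0// ler_wpM2r// ler_norm.
apply: ler_pM; rewrite ?mulr_ge0 ?powR_ge0//.
by rewrite ler_wpM2r// lerDl; lra.
Qed.

End Admissible.

(** * The pointwise bound on extreme minor arcs *)

Section Pointwise.
Variable R : realType.
Local Notation C := R[i].

Lemma ln_le_powR (e x : R) : 0 < e -> 1 <= x -> ln x <= e^-1 * x `^ e.
Proof.
move=> e0 x1; have x0 : 0 < x by lra.
have : e * ln x <= x `^ e.
  by rewrite powRE//; have := expR_ge1Dx (e * ln x); lra.
by rewrite ler_pdivlMl.
Qed.

(** Stopping at the first partial product above [sqrt N] puts both factors below [r * sqrt N], and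
    at most [sqrt N] summands never stop. Sorting by the least prime [p] of [m] frees the smoothness
    condition on [v] from [m]; the condition [v <= N / m] is removed by [sum_lt_bound] at a
    logarithmic cost. *)
Lemma f_abs_bilinear_le k (N r theta B : R) : 1 <= N -> 1 <= r -> 0 <= B ->
  (forall (s s' : seq nat) (a b : nat -> C), uniq s -> uniq s' ->
    {subset s <= smooth_set (r * Num.sqrt N) r} ->
    {subset s' <= smooth_set (r * Num.sqrt N) r} ->
    (forall m, cabs (a m) <= 1) -> (forall v, cabs (b v) <= 1) ->
    cabs (\sum_(m <- s) \sum_(v <- s') a m * b v * ee (theta * ((m * v) ^ k)%N%:R)) <= B) ->
  f_abs k N r theta <= Num.sqrt N + (Num.truncn r).+1%:R *
    ((trunc_log 2 (Num.truncn (Num.sqrt N)).+1).+1%:R * B).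
Proof.
move=> N1 r1 B0 HB; set X := Num.sqrt N.
have N0 : 0 <= N by lra.
have X2 : X ^+ 2 = N by rewrite sqr_sqrtr.
have X0 : 0 <= X by exact: sqrtr_ge0.
have X1 : 1 <= X by rewrite -sqrtr1 ler_wsqrtr.
have leX (x : R) : 0 <= x -> (x <= X) = (x ^+ 2 <= N).
  by move=> x0; rewrite -X2 ler_sqr ?nnegrE.
pose stop m := N < m%:R ^+ 2.
have stop1 : stop 1%N = false by rewrite /stop expr1n; apply/negbTE; rewrite -leNgt.
pose F (x : nat) : C := ee (theta * (x ^ k)%:R).
have F1 x : cabs (F x) = 1 by exact: cabs_ee.
rewrite f_absE (sum_smooth_first_stop _ _ F stop1).
apply: le_trans (cabsD _ _) _; apply: lerD.
  apply: le_trans (cabs_sum _ _ _) _.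
  under eq_bigr do rewrite F1.
  rewrite big_const_seq iter_addr addr0 -size_filter.
  apply: le_trans (size_smooth r X0); rewrite ler_nat; apply: uniq_leq_size.
    by rewrite filter_uniq// smooth_uniq.
  move=> x; rewrite mem_filter => /andP[/eqP Tx]; rewrite !mem_smooth.
  move=> /and3P[x0 _ ->]; rewrite x0 andbT/= leX// leNgt.
  by have := first_stop_eq0 stop1 x0 Tx; rewrite /stop => ->.
set A := smooth_set N r; set T := first_stop stop.
have leafP m : m \in A -> T m = m ->
    [/\ (1 < m)%N, N < m%:R ^+ 2, m%:R <= r * X & (pdiv m < (Num.truncn r).+1)%N].
  move=> mA Tm; have m0 := smooth_gt0 mA.
  have [m1 sm sd] := first_stop_fix stop1 m0 Tm.
  have pr := smooth_pdiv mA m1.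
  split => //; last by rewrite ltnS truncn_ge_nat//; lra.
  have : (m %/ pdiv m)%N%:R <= X by rewrite leX// leNgt; move: sd; rewrite /stop => ->.
  rewrite -[in m%:R](divnK (pdiv_dvd m)) natrM mulrC => dX.
  by apply: ler_pM.
pose s p := [seq m <- A | (T m == m) && (pdiv m == p)].
(* The successor turns [v <= N / m] into the strict inequality of [sum_lt_bound]. *)
pose Xm m := (Num.truncn (N / m%:R)).+1.
have -> : \sum_(m <- A | T m == m) \sum_(v <- smooth_set (N / m%:R) (pdiv m)%:R) F (m * v)%N =
  \sum_(p < (Num.truncn r).+1) \sum_(m <- s p)
    \sum_(v <- smooth_set X (p%:R : R) | (v < Xm m)%N) F (m * v)%N.
  under [RHS]eq_bigr => p _ do rewrite big_filter big_mkcond.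
  rewrite [RHS]exchange_big/= big_mkcond/=; apply: eq_big_seq => m mA.
  case: eqP => [Tm|_]; last by rewrite big1.
  have [m1 Nm _ pm] := leafP m mA Tm.
  rewrite (bigD1 (Ordinal pm))//= eqxx [X in _ + X]big1 ?addr0; last first.
    move=> p pn; case: eqP => // E; case/eqP: pn; exact: val_inj.
  have mX : X <= m%:R by rewrite leNgt; apply/negP => /ltW; rewrite leX// leNgt Nm.
  rewrite -[RHS]big_filter; apply: perm_big; apply: uniq_perm; rewrite ?filter_uniq ?smooth_uniq ?iota_uniq//.
  move=> v; rewrite [RHS]mem_filter !mem_smooth /Xm ltnS.
  have Nm0 : 0 <= N / m%:R by rewrite divr_ge0.
  rewrite truncn_ge_nat//.
  have NmX : N / m%:R <= X.
    by rewrite ler_pdivrMr; [rewrite -X2 expr2 ler_wpM2l|rewrite ltr0n ltnW].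
  case: (leP v%:R (N / m%:R)) => /= [vN|_]; last by rewrite andbF.
  by rewrite (le_trans vN NmX).
apply: le_trans (cabs_sum _ _ _) _.
rewrite [leRHS](_ : _ = \sum_(p < (Num.truncn r).+1)
  (trunc_log 2 (Num.truncn X).+1).+1%:R * B); last by rewrite sumr_const card_ord mulr_natl.
apply: ler_sum => p _.
apply: sum_lt_bound; last first.
  move=> m; rewrite mem_filter => /andP[/andP[/eqP Tm _] mA].
  have [m1 Nm _ _] := leafP m mA Tm.
  apply: leq_ltn_trans (trunc_log_ltn _ (isT : (1 < 2)%N)); rewrite ltnS.
  apply: le_truncn.
  have mX : X <= m%:R by rewrite leNgt; apply/negP => /ltW; rewrite leX// leNgt Nm.
  rewrite ler_pdivrMr; last by lra.
  by rewrite -X2 expr2 ler_wpM2l.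
move=> a b a1 b1; apply: HB => //.
- by rewrite filter_uniq// smooth_uniq.
- exact: smooth_uniq.
- move=> m; rewrite mem_filter => /andP[/andP[/eqP Tm _] mA].
  have [m1 Nm mrX _] := leafP m mA Tm.
  by move: mA; rewrite !mem_smooth mrX => /and3P[-> _ ->].
- apply: smoothS; first by rewrite ler_peMl.
  have := ltn_ord p; rewrite ltnS truncn_ge_nat//; lra.
Qed.

(** As [Q] is [X ^ k] up to constants and powers of [Rr], the number of blocks is bounded by a power
    of [Rr] and a block costs about [X ^ k]. The trivial bound for the kernel has order [X ^ (2 k)];
    the saving of [X ^ k] is the source of the [k] in the numerator of [tau]. *)
Lemma kernel_bound (k w : nat) (eps : R) : 0 < eps -> exists2 C : R, 0 < C &
  forall P X Rr Q L Y : R, 1 <= X -> X <= P -> 1 <= Rr -> 1 <= Q ->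
  2 * Q <= X ^+ k -> X ^+ k <= Rr ^+ k * (2 * Q) -> Q / 2 <= L ->
  0 <= Y -> Y <= (w%:R + 1) * (Rr * X) ^+ k ->
  (Y / L + 1) * (2 * Y + 2 / (Q / (2 * X ^+ (2 * k))) *
     (1 + ln (Q / (2 * X ^+ (2 * k)))^-1))
  <= C * X ^+ k * Rr ^+ (4 * k) * P `^ eps.
Proof.
move=> eps0; pose W : R := w%:R + 1; pose c := 2 + 2 * k%:R / eps.
have W1 : 1 <= W by rewrite lerDr.
have ke0 : 0 <= 2 * k%:R / eps by rewrite divr_ge0 ?mulr_ge0// ltW.
have c2 : 2 <= c by rewrite lerDl.
exists ((4 * W + 1) * (2 * W + 8 * c)); first by nra.
move=> P X Rr Q L Y X1 XP Rr1 Q1 QX XQ QL Y0; rewrite -/W exprMn.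
have -> : Rr ^+ (4 * k) = (Rr ^+ k) ^+ 4 by rewrite -exprM mulnC.
have -> : X ^+ (2 * k) = (X ^+ k) ^+ 2 by rewrite -exprM mulnC.
have x1 : 1 <= X ^+ k by rewrite exprn_ege1.
have r1 : 1 <= Rr ^+ k by rewrite exprn_ege1.
have xP : X ^+ k <= P ^+ k by apply: lerXn2r; rewrite ?nnegrE; lra.
move: x1 r1 xP QX XQ; set x := X ^+ k; set r := Rr ^+ k => x1 r1 xP QX XQ YW.
have P1 : 1 <= P by lra.
have p1 : 1 <= P `^ eps by rewrite powR_ge1// ltW.
have L0 : 0 < L by lra.
have Q0 : 0 < Q by lra.
have r2 : r <= r ^+ 2 by rewrite expr2 ler_peMr//; lra.
have xr0 : 0 <= x * r by nra.
have A1 : Y / L + 1 <= (4 * W + 1) * r ^+ 2.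
  have : Y / L <= 4 * W * r ^+ 2.
    rewrite ler_pdivrMr//; apply: (le_trans YW).
    apply: (@le_trans _ _ (4 * W * r ^+ 2 * (Q / 2))); last first.
      by rewrite ler_wpM2l// !mulr_ge0 ?sqr_ge0//; lra.
    have -> : 4 * W * r ^+ 2 * (Q / 2) = W * (r * (r * (2 * Q))) by field.
    by do 2! (apply: ler_wpM2l; first lra).
  have : 1 <= r ^+ 2 by lra.
  by lra.
have dE : (Q / (2 * x ^+ 2))^-1 = 2 * x ^+ 2 / Q by rewrite invf_div.
have A2 : 2 / (Q / (2 * x ^+ 2)) <= 8 * (x * r).
  rewrite dE [leLHS]mulrA ler_pdivrMr//.
  have -> : 2 * (2 * x ^+ 2) = 4 * (x * x) by ring.
  have -> : 8 * (x * r) * Q = 4 * (x * (r * (2 * Q))) by ring.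
  by rewrite ler_pM2l// ler_wpM2l//; lra.
have A3 : 1 + ln (Q / (2 * x ^+ 2))^-1 <= c * P `^ eps.
  have H : ln (Q / (2 * x ^+ 2))^-1 <= ln 2 + (2 * k%:R) * ln P.
    have -> : ln 2 + 2 * k%:R * ln P = ln (2 * P ^+ (2 * k)).
      rewrite lnM ?posrE ?exprn_gt0//; last by lra.
      by rewrite lnXn; [rewrite -[_ *+ (2 * k)]mulr_natl natrM | lra].
    rewrite dE ler_ln ?posrE ?divr_gt0 ?mulr_gt0 ?exprn_gt0//; try lra.
    rewrite ler_pdivrMr//.
    have x2 : x ^+ 2 <= P ^+ (2 * k).
      by rewrite mulnC exprM; apply: lerXn2r; rewrite ?nnegrE ?exprn_ge0//; lra.
    have : 0 <= P ^+ (2 * k) by rewrite exprn_ge0//; lra.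
    nra.
  have l2 : ln 2 <= 1 :> R.
    by rewrite -[leRHS]expRK ler_ln ?posrE ?expR_gt0//; have := expR_ge1Dx (1 : R); lra.
  have lP := ln_le_powR eps0 P1.
  have : 2 * k%:R * ln P <= 2 * k%:R / eps * P `^ eps.
    have -> : 2 * k%:R / eps * P `^ eps = 2 * k%:R * (eps^-1 * P `^ eps) by rewrite !mulrA.
    by rewrite ler_wpM2l// mulr_ge0.
  rewrite /c; lra.
have A4 : 2 * Y + 2 / (Q / (2 * x ^+ 2)) * (1 + ln (Q / (2 * x ^+ 2))^-1) <=
    (2 * W + 8 * c) * (x * r ^+ 2 * P `^ eps).
  have B1 : 2 / (Q / (2 * x ^+ 2)) * (1 + ln (Q / (2 * x ^+ 2))^-1) <=
     8 * (x * r) * (c * P `^ eps).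
    apply: ler_pM => //.
      by rewrite divr_ge0// divr_ge0 ?mulr_ge0 ?sqr_ge0//; lra.
    rewrite addr_ge0// ln_ge0// dE ler_pdivlMr// mul1r; nra.
  have B2 : x * r <= x * r ^+ 2 by rewrite ler_wpM2l//; lra.
  have B3 : x * r ^+ 2 <= x * r ^+ 2 * P `^ eps by rewrite ler_peMr//; lra.
  have B4 : 8 * (x * r) * (c * P `^ eps) <= 8 * c * (x * r ^+ 2 * P `^ eps).
    have -> : 8 * (x * r) * (c * P `^ eps) = 8 * c * (x * r * P `^ eps) by ring.
    by apply: ler_wpM2l; [lra|apply: ler_wpM2r; lra].
  have B5 : 2 * Y <= 2 * W * (x * r ^+ 2 * P `^ eps).
    have : W * (x * r) <= W * (x * r ^+ 2 * P `^ eps) by rewrite ler_wpM2l//; lra.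
    lra.
  lra.
have -> : (4 * W + 1) * (2 * W + 8 * c) * x * r ^+ 4 * P `^ eps =
  ((4 * W + 1) * r ^+ 2) * ((2 * W + 8 * c) * (x * r ^+ 2 * P `^ eps)) by ring.
apply: ler_pM => //; first by rewrite addr_ge0// divr_ge0// ltW.
apply: addr_ge0; first by rewrite mulr_ge0.
apply: mulr_ge0; first by rewrite divr_ge0// divr_ge0 ?mulr_ge0 ?sqr_ge0//; lra.
rewrite addr_ge0// ln_ge0// dE ler_pdivlMr// mul1r; nra.
Qed.

Lemma le_powR_root (x M : R) (n : nat) : (0 < n)%N -> 0 <= x -> x ^+ n <= M ->
  x <= M `^ n%:R^-1.
Proof.
move=> n0 x0 xM; have n1 : 0 < n%:R :> R by rewrite ltr0n.
rewrite [leLHS](_ : _ = (x ^+ n) `^ n%:R^-1); last first.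
  by rewrite -powR_mulrn// -powRrM mulfV ?powRr1// gt_eqF.
by rewrite ler_powRl ?exprn_ge0// invr_ge0 ltW.
Qed.

Lemma trunc_log_le_powR (eps : R) : 0 < eps -> exists2 C : R, 0 < C &
  forall P X : R, 1 <= X -> X <= P ->
  (trunc_log 2 (Num.truncn X).+1).+1%:R <= C * P `^ eps.
Proof.
move=> eps0; have l2 : 0 < ln 2 :> R by rewrite ln_gt0// ltr1n.
have el0 : 0 < (eps * ln 2)^-1 by rewrite invr_gt0 mulr_gt0.
exists (2 + (eps * ln 2)^-1); first by lra.
move=> P X X1 XP; set n := (Num.truncn X).+1; set t := trunc_log 2 n.
have P1 : 1 <= P by lra.
have tn : (2 ^ t <= n)%N by exact: trunc_logP.
have nP : n%:R <= 2 * P.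
  rewrite /n -natr1; have : (Num.truncn X)%:R <= X by rewrite truncn_le; lra.
  lra.
have : t%:R * ln 2 <= ln 2 + ln P.
  rewrite -lnM ?posrE//; last by lra.
  rewrite mulr_natl -lnXn// ler_ln ?posrE ?exprn_gt0//; last by lra.
  by apply: le_trans nP; rewrite -natrX ler_nat.
move=> H; have : t%:R <= 1 + ln P / ln 2.
  by rewrite -ler_pdivlMr// in H; apply: le_trans H _; rewrite mulrDl mulfV ?gt_eqF.
have lP : ln P / ln 2 <= (eps * ln 2)^-1 * P `^ eps.
  rewrite ler_pdivrMr//; apply: le_trans (ln_le_powR eps0 P1) _.
  rewrite le_eqVlt; apply/orP; left; apply/eqP; field; rewrite !gt_eqF//.
have p1 : 1 <= P `^ eps by rewrite powR_ge1// ltW.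
rewrite -natr1; lra.
Qed.

(** The exponent of [X = sqrt N] is [h + k = 4 w ^ 2 - k + 2 Dw]: [4 w (w - 1)] from the sizes of
    the two sets, [2 g] from the two mean values and [k] from the kernel. Divided by [2 n] it is
    [1 - tau]. *)
Lemma pointwise_exponent_bound (k w : nat) (Dw e0 C1 CK P N Rr : R) :
  let g := 2 * w%:R - k%:R + Dw in
  let h := 4 * w%:R * (w.-1)%:R + 2 * g in
  let M := h + 4 * k%:R + 5 in
  let n := (2 * w ^ 2)%N in
  let tau := (k%:R - 2 * Dw) / (4 * w%:R ^+ 2) in
  let X := Num.sqrt N in
  let Z0 := Rr * X in
  (0 < w)%N -> 0 < h -> 0 < e0 -> 0 < C1 -> 0 < CK -> 1 <= P -> 1 <= N -> 1 <= Rr ->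
  Rr <= P `^ e0 ->
  ((Z0 * Z0) ^+ (2 * w * w.-1) * (C1 * Z0 `^ g * P `^ e0) *
    (C1 * Z0 `^ g * P `^ e0) * (CK * X ^+ k * Rr ^+ (4 * k) * P `^ e0)) `^ n%:R^-1
  <= (C1 ^+ 2 * CK) `^ n%:R^-1 * N `^ (1 - tau) * P `^ (e0 * (M - 2)).
Proof.
move=> g h M n tau X Z0 w0 h0 e00 C10 CK0 P1 N1 R1 R_e0.
have Pp : 0 < P by exact: lt_le_trans P1.
have R0 : 0 < Rr by exact: lt_le_trans R1.
have N0 : 0 < N by exact: lt_le_trans N1.
have X0 : 0 < X by rewrite sqrtr_gt0.
have Z0p : 0 < Z0 by rewrite mulr_gt0.
have wE : (w.-1)%:R = w%:R - 1 :> R by rewrite -subn1 natrB.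
have w1 : 1 <= w%:R :> R by rewrite ler1n.
have n1 : 1 <= n%:R :> R by rewrite ler1n muln_gt0 expn_gt0 w0.
set M0 := (_ * _) ^+ _ * _ * _ * _; set CB := (C1 ^+ 2 * CK) `^ _.
have CB0 : 0 < CB by rewrite powR_gt0// mulr_gt0// exprn_gt0.
have XE : X = N `^ 2^-1 by rewrite powR12_sqrt// ltW.
have Zh : (Z0 * Z0) ^+ (2 * w * w.-1) * Z0 `^ g * Z0 `^ g = Rr `^ h * X `^ h.
  rewrite -powRM ?(ltW X0) ?(ltW R0)// -/Z0 -expr2 -exprM -powR_mulrn ?(ltW Z0p)//.
  rewrite -!powRDp//; congr (_ `^ _); rewrite !natrM /h; ring.
have Xh : X `^ h * X ^+ k = (N `^ (1 - tau)) `^ n%:R.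
  rewrite -powR_mulrn ?(ltW X0)// -powRDp// XE -!powRrM; congr (_ `^ _).
  rewrite /h /g /tau /n natrM natrX wE; field; clear -w1; lra.
have Rh : Rr `^ h * Rr ^+ (4 * k) <= P `^ (e0 * (h + 4 * k%:R)).
  rewrite -powR_mulrn ?(ltW R0)// -powRDp// natrM powRrM ler_powRl ?(ltW R0)//.
  by rewrite addr_ge0 ?mulr_ge0// ltW.
have M0_le : M0 <= (C1 ^+ 2 * CK) * (N `^ (1 - tau)) `^ n%:R * P `^ (e0 * (M - 2)).
  rewrite (_ : M0 = (C1 ^+ 2 * CK) * (X `^ h * X ^+ k) *
      ((Rr `^ h * Rr ^+ (4 * k)) * (P `^ e0 * (P `^ e0 * P `^ e0)))); last first.
    have -> : (C1 ^+ 2 * CK) * (X `^ h * X ^+ k) *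
      ((Rr `^ h * Rr ^+ (4 * k)) * (P `^ e0 * (P `^ e0 * P `^ e0))) =
      (C1 ^+ 2 * CK) * (Rr `^ h * X `^ h) * X ^+ k * Rr ^+ (4 * k) *
      (P `^ e0 * (P `^ e0 * P `^ e0)) by ring.
    by rewrite -Zh /M0; ring.
  rewrite Xh ler_wpM2l ?mulr_ge0 ?exprn_ge0 ?powR_ge0 ?(ltW CK0) ?(ltW C10)//.
  have -> : P `^ (e0 * (M - 2)) = P `^ (e0 * (h + 4 * k%:R)) * (P `^ e0 * (P `^ e0 * P `^ e0)).
    by rewrite -!powRDp//; congr (_ `^ _); rewrite /M; ring.
  by rewrite ler_wpM2r ?mulr_ge0 ?powR_ge0.
have M00 : 0 <= M0.
  by rewrite /M0 !mulr_ge0 ?exprn_ge0 ?mulr_ge0 ?powR_ge0// ltW.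
have n0' : 0 <= n%:R^-1 :> R by rewrite invr_ge0.
apply: (le_trans (ler_powRl M00 M0_le n0')).
rewrite powRM ?mulr_ge0 ?exprn_ge0 ?powR_ge0 ?(ltW CK0) ?(ltW C10)//.
rewrite powRM ?mulr_ge0 ?exprn_ge0 ?powR_ge0 ?(ltW CK0) ?(ltW C10)// -/CB.
rewrite -[((N `^ _) `^ _) `^ _]powRrM mulfV; last by rewrite gt_eqF// (lt_le_trans ltr01).
rewrite powRr1 ?powR_ge0// ler_wpM2l ?mulr_ge0 ?powR_ge0 ?(ltW CB0)//.
rewrite -powRrM ler_powR// ler_piMr//; last by rewrite invf_le1// (lt_le_trans ltr01).
rewrite mulr_ge0 ?(ltW e00)// /M; have := ler0n R k; clear -h0; lra.
Qed.

(** The constants are uniform in [r <= Rr], as [r] will be the least prime of a stopping product.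
    The bilinear forms run over subsets of the smooth numbers up to [Rr * sqrt N], so the mean value
    of order [2 w] at that height bounds their collision counts. *)
Lemma pointwise_bound (k w : nat) (Dw : R) : (0 < k)%N -> (0 < w)%N ->
  admissible k (2 * w%:R) Dw ->
  forall eps : R, 0 < eps -> exists2 eta : R, 0 < eta & exists2 C : R, 0 < C &
  forall (P N r Rr theta Q : R) (q b : nat), 1 <= N -> N <= P -> 1 <= r -> r <= Rr ->
    Rr <= P `^ eta -> 4 * Q ^+ 2 <= N ^+ k -> N ^+ k <= Rr ^+ k * (4 * Q ^+ 2) ->
    (0 < q)%N -> coprime b q -> q%:R <= Q -> `|q%:R * theta - b%:R| <= Q / N ^+ k ->
    (Q / 2 < q%:R \/ Q / (2 * N ^+ k) < `|q%:R * theta - b%:R|) ->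
    f_abs k N r theta <= C * N `^ (1 - (k%:R - 2 * Dw) / (4 * w%:R ^+ 2)) * P `^ eps.
Proof.
move=> k0 w0 adm eps eps0.
have w1 : 1 <= w%:R :> R by rewrite ler1n.
have DwL : k%:R - w%:R <= Dw.
  have := admissible_lower k0 (_ : 2 <= 2 * w%:R) adm.
  by rewrite [2 * w%:R / 2]mulrAC divff// mul1r; apply; lra.
pose g := 2 * w%:R - k%:R + Dw.
have g0 : 0 < g by rewrite /g; lra.
pose h := 4 * w%:R * (w.-1)%:R + 2 * g.
have wE : (w.-1)%:R = w%:R - 1 :> R by rewrite -subn1 natrB.
have h0 : 0 < h by rewrite /h ltr_wpDl ?mulr_ge0//; lra.
pose M := h + 4 * k%:R + 5.
have M5 : 5 <= M by rewrite /M; have := ler0n R k; lra.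
pose e0 := eps / M; have e00 : 0 < e0 by rewrite divr_gt0//; lra.
have u0 : 0 <= 2 * w%:R :> R by lra.
have [eta1 eta10 [C1 C10 HC1]] := admissible_uniform u0 adm e00.
have [CK CK0 HCK] := kernel_bound k w e00.
have [CL CL0 HCL] := trunc_log_le_powR e00.
pose n := (2 * w ^ 2)%N.
have n0 : (0 < n)%N by rewrite muln_gt0 expn_gt0 w0.
have n1 : 1 <= n%:R :> R by rewrite ler1n.
pose CB := (C1 ^+ 2 * CK) `^ n%:R^-1.
have CB0 : 0 < CB by rewrite powR_gt0// mulr_gt0// exprn_gt0.
(* The bound [1/2] ensures [Rr * sqrt N <= P], as the uniform mean value bound requires. *)
pose eta := Num.min eta1 (Num.min e0 2^-1).
exists eta; first by rewrite !lt_min eta10 e00 invr_gt0/=.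
exists (1 + 2 * CL * CB); first by rewrite addr_gt0// !mulr_gt0.
move=> P N r Rr theta Q q b N1 NP r1 rR RP QN NQ q0 bq qQ Hq Hor.
have P1 : 1 <= P by exact: le_trans NP.
have Pp : 0 < P by exact: lt_le_trans P1.
have R1 : 1 <= Rr by exact: le_trans rR.
have R0 : 0 < Rr by exact: lt_le_trans R1.
have N0 : 0 < N by exact: lt_le_trans N1.
have R_eta1 : Rr <= P `^ eta1.
  by apply: (le_trans RP); rewrite ler_powR// /eta ge_min lexx.
have R_e0 : Rr <= P `^ e0.
  by apply: (le_trans RP); rewrite ler_powR// /eta !ge_min lexx orbT.
have R_2 : Rr <= Num.sqrt P.
  rewrite -powR12_sqrt ?(ltW Pp)//.
  by apply: (le_trans RP); rewrite ler_powR// /eta !ge_min lexx !orbT.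
have q1 : 1 <= q%:R :> R by rewrite ler1n.
have Q1 : 1 <= Q by exact: le_trans qQ.
have Q0 : 0 < Q by exact: lt_le_trans Q1.
set X := Num.sqrt N.
have X2 : X ^+ 2 = N by rewrite sqr_sqrtr// ltW.
have X1 : 1 <= X by rewrite -sqrtr1 ler_wsqrtr.
have X0 : 0 < X by exact: lt_le_trans X1.
have XP2 : X <= Num.sqrt P by rewrite ler_wsqrtr.
have NkE : N ^+ k = X ^+ (2 * k) by rewrite -X2 exprM.
pose Z0 := Rr * X.
have Z1 : 1 <= Z0 by rewrite /Z0 mulr_ege1.
have Z0p : 0 < Z0 by exact: lt_le_trans Z1.
have ZP : Z0 <= P.
  rewrite -[leRHS](@sqr_sqrtr _ P) ?(ltW Pp)// expr2.
  by apply: ler_pM => //; exact: ltW.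
have XP : X <= P by apply: le_trans ZP; rewrite /Z0 ler_peMl// ltW.
(* By [U_even] this is the mean value of order [2 w] at height [Z0]. *)
pose J0 := coll (sums w (map (expn^~ k) (smooth_set Z0 Rr))).
have J0E : J0%:R <= C1 * Z0 `^ g * P `^ e0.
  have := HC1 P Z0 Rr Z1 ZP R1 R_eta1; by rewrite U_even// lee_fin.
pose D := N ^+ k.
have D0 : 0 < D by rewrite exprn_gt0.
have [L [L0 QL HL]] := minor_arc_spacing q0 bq qQ QN Hq Hor.
pose d := Q / (2 * D).
have d0 : 0 < d by rewrite divr_gt0 ?mulr_gt0.
have d2 : d <= 1 / 2.
  have QD : Q <= D by apply: le_trans QN; clear -Q1; nra.
  rewrite /d ler_pdivrMr ?mulr_gt0//; clear -QD; lra.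
pose Y := (w * Num.truncn (Z0 ^+ k)).+1.
pose K := (Y%:R / L%:R + 1) * (2 * Y%:R + 2 / d * (1 + ln d^-1)).
have K_le : K <= CK * X ^+ k * Rr ^+ (4 * k) * P `^ e0.
  rewrite /K /d /D NkE; apply: HCK => //.
  - have : (2 * Q) ^+ 2 <= (X ^+ k) ^+ 2.
      by rewrite -exprM mulnC -NkE; apply: le_trans QN; clear; lra.
    by rewrite ler_sqr ?nnegrE ?exprn_ge0 ?mulr_ge0// ltW.
  - have : (X ^+ k) ^+ 2 <= (Rr ^+ k * (2 * Q)) ^+ 2.
      rewrite -exprM mulnC -NkE exprMn; apply: (le_trans NQ).
      have -> : (2 * Q) ^+ 2 = 4 * Q ^+ 2 by ring.
      rewrite ler_wpM2r ?mulr_ge0 ?(ltW Q0)//.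
      by rewrite expr2 ler_peMr ?exprn_ege1// exprn_ge0// ltW.
    by rewrite ler_sqr ?nnegrE ?exprn_ge0 ?mulr_ge0 ?exprn_ge0// ltW.
  - rewrite /Y -natr1 natrM mulrDl mul1r -/Z0.
    apply: lerD; last by rewrite exprn_ege1.
    by rewrite ler_wpM2l// truncn_le exprn_ge0// ltW.
have K0 : 0 <= K.
  apply: mulr_ge0; first by rewrite addr_ge0// divr_ge0.
  apply: addr_ge0; first by rewrite mulr_ge0.
  apply: mulr_ge0; first by apply: mulr_ge0 => //; rewrite invr_ge0 ltW.
  by rewrite addr_ge0// ln_ge0// invf_ge1//; clear -d2; lra.
pose M0 := (Z0 * Z0) ^+ (2 * w * w.-1) * (C1 * Z0 `^ g * P `^ e0) *
  (C1 * Z0 `^ g * P `^ e0) * (CK * X ^+ k * Rr ^+ (4 * k) * P `^ e0).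
pose B := M0 `^ n%:R^-1.
have B0 : 0 <= B by exact: powR_ge0.
have HB (s s' : seq nat) (a c : nat -> C) : uniq s -> uniq s' ->
    {subset s <= smooth_set (r * X) r} -> {subset s' <= smooth_set (r * X) r} ->
    (forall m, cabs (a m) <= 1) -> (forall v, cabs (c v) <= 1) ->
    cabs (\sum_(m <- s) \sum_(v <- s') a m * c v * ee (theta * ((m * v) ^ k)%N%:R)) <= B.
  move=> us us' ss ss' a1 c1; apply: le_powR_root => //; first exact: cabs_ge0.
  have sub : {subset smooth_set (r * X) r <= smooth_set Z0 Rr}.
    by apply: smoothS => //; rewrite /Z0 ler_wpM2r// ltW.
  have le0 : {in smooth_set Z0 Rr, forall m, (m ^ k <= Num.truncn (Z0 ^+ k))%N}.
    move=> m /smooth_le mZ; rewrite truncn_ge_nat ?exprn_ge0 ?(ltW Z0p)// natrX.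
    by apply: lerXn2r; rewrite ?nnegrE// ltW.
  have size0 (t : seq nat) : uniq t -> {subset t <= smooth_set (r * X) r} ->
      (size t)%:R <= Z0.
    move=> ut st; apply: (le_trans _ (size_smooth Rr (ltW Z0p))).
    by rewrite ler_nat uniq_leq_size// => x /st /sub.
  have coll0 (t : seq nat) : uniq t -> {subset t <= smooth_set (r * X) r} ->
      (coll (sums w (map (expn^~ k) t)))%:R <= C1 * Z0 `^ g * P `^ e0.
    move=> ut st; apply: le_trans J0E; rewrite ler_nat; apply: coll_sums_le => G.
    rewrite !big_map; apply: uniq_sub_le_big => //.
    - by move=> *; rewrite leq_addr.
    - exact: smooth_uniq.
    - by move=> x /st /sub.
  apply: le_trans (@bilinear_power R w k s s' a c theta (Num.truncn (Z0 ^+ k))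
    (Num.truncn (Z0 ^+ k)) K w0 a1 c1 _ _ K0 _) _.
  - by move=> m /ss /sub /le0.
  - by move=> m /ss' /sub /le0.
  - by move=> z _; apply: (@spaced_double_sum R theta d L Y Y z d0 d2 L0 HL).
  rewrite /M0; apply: ler_pM; [by rewrite !mulr_ge0 ?exprn_ge0 ?mulr_ge0|exact: K0| |exact: K_le].
  apply: ler_pM; [by rewrite mulr_ge0 ?exprn_ge0 ?mulr_ge0|exact: ler0n| |exact: coll0].
  apply: ler_pM; [by rewrite exprn_ge0 ?mulr_ge0|exact: ler0n| |exact: coll0].
  apply: lerXn2r; [by rewrite nnegrE mulr_ge0|by rewrite nnegrE mulr_ge0 ?(ltW Z0p)|].
  by apply: ler_pM; [exact: ler0n|exact: ler0n|exact: size0|exact: size0].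
have rX0 : 0 <= B by [].
have := f_abs_bilinear_le (k := k) (theta := theta) N1 r1 B0 HB.
pose tau := (k%:R - 2 * Dw) / (4 * w%:R ^+ 2); rewrite -/tau.
have B_le : B <= CB * N `^ (1 - tau) * P `^ (e0 * (M - 2)).
  exact: pointwise_exponent_bound.
have tau2 : tau <= 1 / 2.
  have w2 : w%:R <= w%:R ^+ 2 :> R by rewrite expr2 ler_peMr.
  have w2p : 0 < 4 * w%:R ^+ 2 :> R by rewrite mulr_gt0// exprn_gt0// ltr0n.
  rewrite /tau ler_pdivrMr//; have := ler0n R k; clear -w2 w1 DwL; lra.
have XN : X <= N `^ (1 - tau).
  by rewrite /X -powR12_sqrt ?(ltW N0)//; apply: ler_powR => //; clear -tau2; lra.
move=> H; apply: (le_trans H).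
have r2 : (Num.truncn r).+1%:R <= 2 * P `^ e0.
  rewrite -natr1; have : (Num.truncn r)%:R <= r by rewrite truncn_le (le_trans ler01).
  have : 1 <= P `^ e0 by rewrite powR_ge1// ltW.
  clear -rR R_e0; lra.
have T_le := HCL P X X1 XP.
have NT0 : 0 <= N `^ (1 - tau) by exact: powR_ge0.
have PE : P `^ eps = P `^ e0 * (P `^ e0 * P `^ (e0 * (M - 2))).
  by rewrite -!powRDp//; congr (_ `^ _); rewrite /e0; field; clear -M5; lra.
have Pe1 : 1 <= P `^ eps by rewrite powR_ge1// ltW.
have -> : (1 + 2 * CL * CB) * N `^ (1 - tau) * P `^ eps = N `^ (1 - tau) * P `^ eps +
  (2 * P `^ e0) * ((CL * P `^ e0) * (CB * N `^ (1 - tau) * P `^ (e0 * (M - 2)))).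
  by rewrite PE; ring.
apply: lerD; first by apply: (le_trans XN); rewrite ler_peMr.
by apply: ler_pM => //; [rewrite mulr_ge0|apply: ler_pM].
Qed.

End Pointwise.

(** * Arcs and folding of integrals *)

Section Arcs.
Local Open Scope classical_set_scope.
Variable R : realType.
Local Notation mu := (@lebesgue_measure R).

(* [g] bounds the number of the [n] preimages of a point under [x |-> n x mod 1] in [E]. *)
Lemma ge0_integral_fold (F : R -> R) (n : nat) (g : R) (E : set R) :
  measurable_fun setT F -> (forall x, 0 <= F x) -> (forall x, F (x + 1) = F x) ->
  (0 < n)%N -> 0 <= g -> measurable E -> E `<=` `[0, 1[ ->
  (forall c, 0 <= c < 1 -> \sum_(j < n) \1_E ((c + j%:R) / n%:R) <= g) ->
  (\int[mu]_(x in E) (F (n%:R * x))%:E <=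
   (g / n%:R)%:E * \int[mu]_(x in `[0%R, 1%R]) (F x)%:E)%E.
Proof.
move=> mF F0 FS n0 g0 mE E01 HE.
have n1 : 0 < n%:R :> R by rewrite ltr0n.
have FSn x j : F (x + j%:R) = F x.
  by elim: j => [|j IH]; rewrite ?addr0// -natr1 addrA FS.
pose I01 : set R := `[0, 1[.
have mI : measurable I01 by exact: measurable_itv.
have mindic (A : set R) (f : R -> R) : measurable A -> measurable_fun setT f ->
    measurable_fun setT (fun x => \1_A (f x) : R).
  move=> mA mf.
  have H : measurable_fun setT (\1_A : R -> R) by exact: measurable_indic.
  exact: (measurableT_comp H mf).
pose h (j : nat) (x : R) : R := \1_I01 (n%:R * x - j%:R) * \1_E x * F (n%:R * x).
have indic0 (A : set R) x : 0 <= \1_A x :> R by rewrite indicE ler0n.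
have h0 j x : 0 <= h j x by rewrite /h !mulr_ge0.
have maff (c d : R) : measurable_fun setT (fun x : R => c * x + d).
  by apply: measurable_funD => //; exact: measurable_funM.
have mh j : measurable_fun setT (h j).
  apply: measurable_funM; [apply: measurable_funM|].
  - exact: (mindic _ (fun x => n%:R * x - j%:R) mI (maff _ _)).
  - exact: measurable_indic.
  - apply: (measurableT_comp mF); have := maff n%:R 0.
    by under eq_fun do rewrite addr0.
have mhE j : measurable_fun setT (fun x => (h j x)%:E) by exact/measurable_EFinP.
have mFn : measurable_fun setT (fun x : R => (F (n%:R * x))%:E).
  apply/measurable_EFinP; apply: (measurableT_comp mF); have := maff n%:R 0.
  by under eq_fun do rewrite addr0.
(* Each [x] in [E] lies in one interval [[j / n, (j + 1) / n)], the one selected by the first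
   indicator in [h j]. *)
have S1 : (\int[mu]_(x in E) (F (n%:R * x))%:E <= \int[mu]_x (\sum_(j <- iota 0 n) (h j x)%:E))%E.
  rewrite integral_mkcond; apply: ge0_le_integral => //.
  - by move=> x _; apply: erestrict_ge0 => y _; rewrite lee_fin.
  - by apply/(measurable_restrictT _ _).1 => //; exact: measurable_funTS.
  - by apply: emeasurable_sum.
  move=> x _; rewrite patchE sumEFin.
  case: ifPn => [|_]; last by rewrite lee_fin sumr_ge0.
  rewrite inE => Ex; rewrite lee_fin.
  have /andP[x0 x1] : 0 <= x < 1 by have := E01 _ Ex; rewrite /= in_itv.
  have nx0 : 0 <= n%:R * x by rewrite mulr_ge0// ltW.
  pose j := Num.truncn (n%:R * x).
  have /andP[j1 j2] := truncn_itv nx0.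
  have jn : (j < n)%N.
    by rewrite /j truncn_lt_nat// -[ltRHS]mulr1 ltr_pM2l.
  rewrite (big_rem j)/=; last by rewrite mem_iota.
  rewrite -[leLHS]addr0 lerD ?sumr_ge0//.
  rewrite /h !indicE !mem_set// ?mul1r// /I01/= in_itv/=.
  by apply/andP; split; [rewrite subr_ge0|rewrite ltrBlDr addrC natr1].
apply: (le_trans S1).
rewrite ge0_integral_sum//; last by move=> j x _; rewrite lee_fin.
(* [h j] after the substitution of [(x + j) / n] for [x], simplified by the periodicity of [F]. *)
pose h' (j : nat) (x : R) : R := \1_I01 x * \1_E ((x + j%:R) / n%:R) * F x.
have h'E j : (\int[mu]_x (h j x)%:E = (n%:R^-1)%:E * \int[mu]_x (h' j x)%:E)%E.
  have -> := @ge0_integral_affine R n%:R^-1 (j%:R / n%:R) (fun x => (h j x)%:E).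
  - congr (_ * _)%E; apply: eq_integral => x _; congr (_%:E); rewrite /h /h'.
    have -> : n%:R^-1 * x + j%:R / n%:R = (x + j%:R) / n%:R by rewrite mulrDl mulrC.
    have -> : n%:R * ((x + j%:R) / n%:R) = x + j%:R by rewrite mulrC divfK// gt_eqF.
    by rewrite addrK FSn.
  - by rewrite invr_gt0.
  - exact: mhE.
  - by move=> x; rewrite lee_fin.
under eq_bigr => j _ do rewrite h'E.
have mh' j : measurable_fun setT (fun x => (h' j x)%:E).
  apply/measurable_EFinP; apply: measurable_funM => //; apply: measurable_funM.
    exact: measurable_indic.
  apply: mindic => //.
  rewrite (_ : (fun _ => _) = fun x => n%:R^-1 * x + j%:R / n%:R); first exact: maff.
  by apply/funext => x; rewrite mulrDl mulrC.
have h'0 j x : 0 <= h' j x by rewrite /h' !mulr_ge0.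
rewrite -ge0_sume_distrr; last by move=> j _; apply: integral_ge0 => x _; rewrite lee_fin.
rewrite -ge0_integral_sum//; last by move=> j x _; rewrite lee_fin.
have -> : ((g / n%:R)%:E * \int[mu]_(x in `[0%R, 1%R]) (F x)%:E =
   (n%:R^-1)%:E * (g%:E * \int[mu]_(x in `[0%R, 1%R]) (F x)%:E))%E.
  by rewrite muleA -EFinM mulrC.
apply: lee_wpmul2l; first by rewrite lee_fin invr_ge0 ltW.
have mF' : measurable_fun (`[0%R, 1%R] : set R) (fun x => (F x)%:E).
  by apply/measurable_EFinP; exact: measurable_funTS.
rewrite -ge0_integralZl_EFin//; last by move=> x _; rewrite lee_fin.
rewrite [leRHS]integral_mkcond; apply: ge0_le_integral => //.
- by move=> x _; apply: sume_ge0 => j _; rewrite lee_fin.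
- exact: emeasurable_sum.
- apply/(measurable_restrictT _ _).1 => //.
  by apply/measurable_EFinP; apply: measurable_funM => //; exact: measurable_funTS.
move=> x _; rewrite sumEFin patchE.
have [x01|x01] := boolP (0 <= x < 1).
  rewrite mem_set; last by rewrite /= in_itv/=; case/andP: x01 => -> /ltW ->.
  rewrite -EFinM lee_fin /h' -mulr_suml ler_wpM2r//.
  rewrite -mulr_sumr indicE mem_set ?mul1r; last by rewrite /I01/= in_itv.
  apply: le_trans (HE _ x01).
  rewrite -[leRHS](big_mkord xpredT (fun j => \1_E ((x + j%:R) / n%:R))).
  by rewrite /index_iota subn0.
rewrite big1.
  by case: ifP => // _; rewrite -EFinM lee_fin mulr_ge0.
have xI : ~ I01 x by rewrite /I01/= in_itv/=; exact/negP.
by move=> j _; rewrite /h' indicE memNset// !mul0r.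
Qed.

(** A list of fractions makes this a finite union of intervals, so that it is measurable and can be
    restricted by filtering the list on [gcd(q, m ^ k)]. *)
Definition arcs (r : seq (nat * nat)) (d : R) : set R :=
  `[0, 1[ `&` [set x | exists2 p, p \in r & `|p.1%:R * x - p.2%:R| <= d].

Lemma arc_itv (p : nat * nat) (d : R) : (0 < p.1)%N ->
  [set x | `|p.1%:R * x - p.2%:R| <= d] = `[(p.2%:R - d) / p.1%:R, (p.2%:R + d) / p.1%:R].
Proof.
move=> p0; have p1 : 0 < p.1%:R :> R by rewrite ltr0n.
apply/seteqP; split => x /=; rewrite in_itv/= ler_norml ler_pdivrMr// ler_pdivlMr//.
  by move=> /andP[? ?]; apply/andP; split; lra.
by move=> /andP[? ?]; apply/andP; split; lra.
Qed.

Lemma arcsE r d : arcs r d = `[0, 1[ `&`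
  \big[setU/set0]_(p <- r) [set x | `|p.1%:R * x - p.2%:R| <= d].
Proof.
congr (_ `&` _); apply/seteqP; split => x /=.
  move=> [p pr H]; elim: r pr => // q r IH; rewrite inE big_cons => /orP[/eqP <-|/IH]; first by left.
  by right.
elim: r => [|q r IH]; first by rewrite big_nil.
rewrite big_cons => -[H|/IH [p pr H]]; first by exists q; rewrite // inE eqxx.
by exists p => //; rewrite inE pr orbT.
Qed.

Lemma measurable_arcs r d : {in r, forall p, (0 < p.1)%N} -> measurable (arcs r d).
Proof.
move=> H; rewrite arcsE; apply: measurableI; first exact: measurable_itv.
rewrite big_seq; apply: bigsetU_measurable => p /H p0.
by rewrite arc_itv//; exact: measurable_itv.
Qed.

Definition farey (Q : R) : seq (nat * nat) :=
  [seq (q, a) | q <- iota 1 (Num.truncn Q), a <- iota 0 q.+1].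

Lemma mem_farey Q q a : ((q, a) \in farey Q) = [&& (0 < q)%N, q%:R <= Q & (a <= q)%N].
Proof.
apply/allpairsPdep/idP => [[q' [a' []]]|/and3P[q0 qQ aq]].
  rewrite !mem_iota => /andP[q0 qQ] /= aq [-> ->]; rewrite q0 -ltnS aq andbT/=.
  by case: q' q0 qQ {aq} => // q' _; rewrite add1n ltnS -truncn_gt_nat.
exists q, a; rewrite !mem_iota q0 add0n ltnS aq; split => //.
by case: q q0 qQ {aq} => // q' _; rewrite add1n ltnS truncn_gt_nat.
Qed.

(** The [q + 1] intervals of denominator [q] have length [2 d / q], in total at most [4 d] for each
    [q <= Q]. *)
Lemma measure_arcs_le (Q d : R) (T : pred (nat * nat)) : 0 <= Q -> 0 <= d ->
  (mu (arcs [seq p <- farey Q | T p] d) <= (4 * Q * d)%:E)%E.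
Proof.
move=> Q0 d0.
pose I (p : nat * nat) := [set x : R | `|p.1%:R * x - p.2%:R| <= d].
have Isub (r : seq (nat * nat)) : {in r, forall p, (0 < p.1)%N} ->
    (mu (\big[setU/set0]_(p <- r) I p) <= (\sum_(p <- r) 2 * d / p.1%:R)%:E)%E.
  elim: r => [|p r IH] H; first by rewrite !big_nil measure0.
  have p0 : (0 < p.1)%N by rewrite H ?mem_head.
  have H' : {in r, forall p, (0 < p.1)%N} by move=> x xr; rewrite H// inE xr orbT.
  rewrite !big_cons; apply: le_trans (measureU2 _ _ _) _.
  - by rewrite /I arc_itv//; exact: measurable_itv.
  - rewrite big_seq; apply: bigsetU_measurable => q /H' q0.
    by rewrite /I arc_itv//; exact: measurable_itv.
  rewrite EFinD; apply: leeD; last exact: IH.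
  rewrite /I arc_itv// [X in (X <= _)%E]lebesgue_measure_itv/=; case: ifP => _; last first.
    by rewrite lee_fin divr_ge0// mulr_ge0.
  by rewrite -EFinB lee_fin -mulrBl ler_pM2r ?invr_gt0 ?ltr0n//; lra.
have HF : {in farey Q, forall p, (0 < p.1)%N}.
  by move=> [q a]; rewrite mem_farey => /and3P[].
apply: (@le_trans _ _ (mu (\big[setU/set0]_(p <- farey Q) I p))).
  apply: le_measure; rewrite ?inE.
  - by apply: measurable_arcs => p; rewrite mem_filter => /andP[_ /HF].
  - rewrite big_seq; apply: bigsetU_measurable => q /HF q0.
    by rewrite /I arc_itv//; exact: measurable_itv.
  have : arcs [seq p <- farey Q | T p] d `<=` arcs (farey Q) d.
    by move=> x [x01 [p]]; rewrite mem_filter => /andP[_ pr] H; split => //; exists p.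
  by move=> /subset_trans; apply; rewrite arcsE; exact: subIsetr.
apply: (le_trans (Isub _ HF)); rewrite lee_fin.
rewrite big_allpairs_dep/=.
apply: (@le_trans _ _ (\sum_(q <- iota 1 (Num.truncn Q)) 4 * d)).
  rewrite big_seq [leRHS]big_seq; apply: ler_sum => q; rewrite mem_iota => /andP[q0 _].
  have q1 : 1 <= q%:R :> R by rewrite ler1n.
  rewrite -[(0%N :: iota 1 q)]/(iota 0 q.+1) big_const_seq count_predT size_iota.
  rewrite iter_addr addr0 [leLHS](_ : _ = (q%:R + 1) * (2 * d) / q%:R); last first.
    by rewrite -[LHS]mulr_natl -[q.+1%:R]natr1 mulrA.
  rewrite ler_pdivrMr ?ltr0n//; nra.
rewrite big_const_seq count_predT size_iota iter_addr addr0 -[leLHS]mulr_natl.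
have -> : 4 * Q * d = Q * (4 * d) by ring.
by rewrite ler_wpM2r ?mulr_ge0// truncn_le.
Qed.

(* If [(c + i) / m ^ k] and [(c + j) / m ^ k] both lie in the arcs then [m ^ k / g]
   divides [j - i], as an integer of absolute value less than [1] vanishes. *)
Lemma arcs_fiber_count (k m g : nat) (T : pred (nat * nat)) (Q P c : R) :
  (forall p, T p -> gcdn p.1 (m ^ k) = g) -> (0 < m)%N -> (0 < g)%N -> 0 < P ->
  0 <= Q -> 0 <= c ->
  4 * Q ^+ 2 * m%:R ^+ k <= g%:R ^+ 2 * P ^+ k ->
  \sum_(j < m ^ k) \1_(arcs [seq p <- farey Q | T p] (Q / P ^+ k))
     ((c + j%:R) / (m ^ k)%:R) <= g%:R :> R.
Proof.
move=> HT m0 g0 P0 Q0 c0 HQ; set E := arcs _ _; set M := (m ^ k)%N.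
have M0 : (0 < M)%N by rewrite expn_gt0 m0.
have MR : 0 < M%:R :> R by rewrite ltr0n.
pose al (j : nat) : R := (c + j%:R) / M%:R.
have [gM|gM] := boolP (g %| M)%N; last first.
  rewrite big1 ?ler0n// => j _; rewrite indicE memNset// => -[_ [p]].
  rewrite mem_filter => /andP[/HT gE _] _; move: gM.
  by rewrite -gE dvdn_gcdr.
pose M' := (M %/ g)%N.
have ME : M = (M' * g)%N by rewrite divnK.
have M'0 : (0 < M')%N by rewrite divn_gt0// dvdn_leq.
have key (i j : nat) : E (al i) -> E (al j) -> (i <= j)%N -> (M' %| j - i)%N.
  move=> [_ [[q1 a1]]]; rewrite mem_filter/= mem_farey => /andP[/HT/= g1 /and3P[q10 q1Q _]] H1.
  move=> [_ [[q2 a2]]]; rewrite mem_filter/= mem_farey => /andP[/HT/= g2 /and3P[q20 q2Q _]] H2.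
  move=> ij.
  have cop q : gcdn q M = g -> coprime M' (q %/ g).
    move=> gq; rewrite /coprime -(eqn_pmul2r g0) mul1n muln_gcdl -ME divnK.
      by rewrite gcdnC gq.
    by rewrite -gq dvdn_gcdl.
  have qE q : gcdn q M = g -> q = (q %/ g * g)%N.
    by move=> gq; rewrite divnK// -gq dvdn_gcdl.
  have c1 := cop _ g1; have c2 := cop _ g2; have E1 := qE _ g1; have E2 := qE _ g2.
  set r1 := (q1 %/ g)%N in c1 E1; set r2 := (q2 %/ g)%N in c2 E2.
  rewrite -(@Gauss_dvdr _ (r1 * r2)); last by rewrite coprimeMr c1.
  (* The combination of the two approximations in which [c] cancels: an integer, congruent to
     [r1 * r2 * (j - i)] modulo [M']. *)
  pose D : int := (r1 * r2 * (j - i))%:Z - M'%:Z * ((r1 * a2)%:Z - (r2 * a1)%:Z).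
  have gR : 0 < g%:R :> R by rewrite ltr0n.
  have M'R : 0 < M'%:R :> R by rewrite ltr0n.
  have P'0 : 0 < P ^+ k by rewrite exprn_gt0.
  have TE : D%:~R = r1%:R * (M'%:R * (q2%:R * al j - a2%:R)) -
      r2%:R * (M'%:R * (q1%:R * al i - a1%:R)) :> R.
    rewrite /D rmorphB/= !intrM rmorphB/= -!pmulrn !natrM natrB//.
    rewrite /al [in q2%:R]E2 [in q1%:R]E1 ME !natrM; field.
    by rewrite !gt_eqF.
  have T2 : `|D%:~R| <= 1 / 2 :> R.
    pose d := Q / P ^+ k.
    have d0 : 0 <= d by rewrite divr_ge0// ltW.
    have r1Q : r1%:R <= Q / g%:R by rewrite ler_pdivlMr// -natrM -E1.
    have r2Q : r2%:R <= Q / g%:R by rewrite ler_pdivlMr// -natrM -E2.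
    have B1 : `|r1%:R * (M'%:R * (q2%:R * al j - a2%:R))| <= Q / g%:R * (M'%:R * d).
      rewrite !normrM (ger0_norm (ler0n _ r1)) (ger0_norm (ler0n _ M')).
      by apply: ler_pM => //; first [exact: mulr_ge0|exact: ler_wpM2l].
    have B2 : `|r2%:R * (M'%:R * (q1%:R * al i - a1%:R))| <= Q / g%:R * (M'%:R * d).
      rewrite !normrM (ger0_norm (ler0n _ r2)) (ger0_norm (ler0n _ M')).
      by apply: ler_pM => //; first [exact: mulr_ge0|exact: ler_wpM2l].
    rewrite TE; apply: le_trans (ler_normB _ _) _; apply: (le_trans (lerD B1 B2)).
    have -> : Q / g%:R * (M'%:R * d) + Q / g%:R * (M'%:R * d) =
        2 * Q ^+ 2 * M%:R / (g%:R ^+ 2 * P ^+ k).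
      by rewrite /d ME natrM; field; rewrite !gt_eqF.
    rewrite ler_pdivrMr ?mulr_gt0 ?exprn_gt0//.
    by move: HQ; rewrite -natrX -/M; lra.
  have T0 : D = 0.
    apply/eqP/negP => /negP Tn.
    have : 1 <= `|D%:~R| :> R by rewrite -intr_norm ler1z -gtz0_ge1 normr_gt0.
    by move: T2; clear; lra.
  have : (M'%:Z %| (r1 * r2 * (j - i))%:Z)%Z.
    by move/eqP: T0; rewrite subr_eq0 => /eqP ->; rewrite dvdz_mulr.
  by [].
pose S := [seq j <- iota 0 M | al j \in E].
have -> : \sum_(j < M) \1_E (al j) = (size S)%:R :> R.
  rewrite -(big_mkord xpredT (fun j => \1_E (al j))) /index_iota subn0.
  rewrite size_filter -sum1_count natr_sum [RHS]big_mkcond/=.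
  by apply: eq_bigr => j _; rewrite indicE; case: (_ \in _).
(* The indices in [S] are congruent modulo [M'], hence determined by their quotients by [M'], which
   are below [g]. *)
rewrite ler_nat -(size_iota 0 g) -(size_map (fun j => j %/ M')%N S).
apply: uniq_leq_size.
  rewrite map_inj_in_uniq ?filter_uniq ?iota_uniq// => i j.
  rewrite !mem_filter => /andP[/set_mem Ei _] /andP[/set_mem Ej _] ij.
  suff H a b : E (al a) -> E (al b) -> (a %/ M' = b %/ M')%N -> (a <= b)%N -> a = b.
    have [leij|/ltnW leji] := leqP i j; first exact: H.
    by apply/esym; exact: H.
  move=> Ea Eb ab leab; have := key a b Ea Eb leab.
  move=> /dvdnP[t tE]; have bE : b = (a + t * M')%N by rewrite -tE subnKC.
  by move: ab; rewrite bE divnDMl//; case: t {tE bE} => [|t]; lia.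
move=> x /mapP[j]; rewrite mem_filter !mem_iota !add0n => /andP[_ jM] ->.
by rewrite ltn_divLR// mulnC -ME.
Qed.

End Arcs.

(** * The descent *)

Section Descent.
Local Open Scope classical_set_scope.
Variable R : realType.
Local Notation mu := (@lebesgue_measure R).
Local Notation C := R[i].

Lemma ler_sum_sub (s s' : seq nat) (F : nat -> R) : uniq s -> uniq s' ->
  {subset s <= s'} -> (forall i, 0 <= F i) ->
  \sum_(i <- s) F i <= \sum_(i <- s') F i.
Proof.
move=> us us' ss F0; rewrite [leRHS](bigID (mem s))/=.
rewrite (_ : \sum_(i <- s' | i \in s) F i = \sum_(i <- s) F i).
  by rewrite lerDl sumr_ge0.
rewrite -big_filter; apply: perm_big; apply: uniq_perm; rewrite ?filter_uniq//.
by move=> i; rewrite mem_filter; case: (boolP (i \in s)) => // /ss ->.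
Qed.

Lemma f_absD1 k (P r x : R) : f_abs k P r (x + 1) = f_abs k P r x.
Proof.
rewrite !f_absE; congr cabs; apply: eq_bigr => n _.
by rewrite mulrDl mul1r eeD ee_nat mulr1.
Qed.

(** All these [m] are multiples of a single [h >= g ^ (1/k)], hence at most [Y / h] in number. *)
Lemma kth_power_count (k g : nat) (Y : R) (s : seq nat) : (0 < k)%N -> (0 < g)%N ->
  uniq s -> {in s, forall m, [/\ (0 < m)%N, (g %| m ^ k)%N & m%:R <= Y]} -> 0 <= Y ->
  (size s)%:R <= Y * g%:R `^ (- k%:R^-1).
Proof.
move=> k0 g0 us Hs Y0.
have [h [h0 gh Hh]] := dvdn_expn_root k0 g0.
have hR : 0 < h%:R :> R by rewrite ltr0n.
have kR : 0 < k%:R :> R by rewrite ltr0n.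
have gR : 0 < g%:R :> R by rewrite ltr0n.
have gh' : g%:R `^ k%:R^-1 <= h%:R :> R.
  apply: (@le_trans _ _ ((h%:R ^+ k) `^ k%:R^-1)).
    by rewrite ler_powRl// ?invr_ge0// -natrX ler_nat.
  by rewrite -powR_mulrn// -powRrM mulfV ?gt_eqF// powRr1.
apply: (@le_trans _ _ (Y / h%:R)); last first.
  by rewrite powRN ler_wpM2l// lef_pV2 ?posrE// powR_gt0.
have Yh0 : 0 <= Y / h%:R by rewrite divr_ge0.
apply: (@le_trans _ _ (Num.truncn (Y / h%:R))%:R); last by rewrite truncn_le.
rewrite ler_nat -(size_iota 1 (Num.truncn (Y / h%:R))) -(size_map (fun m => m %/ h)%N s).
apply: uniq_leq_size.
  rewrite map_inj_in_uniq// => a b /Hs[_ /Hh ha _] /Hs[_ /Hh hb _] ab.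
  by rewrite -(divnK ha) ab divnK.
move=> x /mapP[m /Hs[m0 /Hh hm mY] ->].
rewrite mem_iota divn_gt0// dvdn_leq//= add1n ltnS truncn_ge_nat//.
by rewrite ler_pdivlMr// -natrM divnK.
Qed.

Section Pointwise.
Variables (k : nat) (s P Rr Q dQ : R).
Hypotheses (k0 : (0 < k)%N) (s2 : 2 <= s) (P1 : 1 <= P) (R1 : 1 <= Rr) (Q1 : 1 <= Q).
Hypothesis dQ1 : 1 <= dQ.
Hypothesis HdQ : forall q : nat, (0 < q)%N -> q%:R <= Q -> (size (divisors q))%:R <= dQ.

Let Q0 : 0 < Q := lt_le_trans ltr01 Q1.
Let P0 : 0 < P := lt_le_trans ltr01 P1.
Let s1 : 1 <= s. Proof. by have := s2; lra. Qed.
Let s0 : 0 <= s := le_trans ler01 s1.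

(* [stop m] is [P * scaleG g < m * Rr * scaleV] for [g = gcd(q, m ^ k)]; a first stop then
   satisfies [m <= scaleY g]. *)
Definition scaleV : R := (2 * Q) `^ (2 / k%:R).
Definition scaleG (g : nat) : R := g%:R `^ (2 / k%:R).
Definition scaleY (g : nat) : R := P * scaleG g / scaleV.
Hypothesis RV : Rr * scaleV <= P.

(** Involves [g] but neither [q] nor [alpha]: the stopping products, which vary with the arc, are
    replaced by a fixed list that can be summed outside the integral. The dependence on [alpha] is
    left to [gcd_arcs]. *)
Definition leaf_cond (g m : nat) : bool :=
  [&& (1 < m)%N, (g %| m ^ k)%N, (pdiv m)%:R <= Rr, P * scaleG g < m%:R * Rr * scaleV
    & m%:R * scaleV <= P * scaleG g].
Definition leaves (g : nat) : seq nat := [seq m <- iota 1 (Num.truncn P) | leaf_cond g m].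
Definition gcd_arcs (g m : nat) : set R :=
  arcs [seq p <- farey Q | coprime p.2 p.1 && (gcdn p.1 (m ^ k) == g)] (Q / P ^+ k).

Lemma scaleV_gt0 : 0 < scaleV.
Proof. by rewrite powR_gt0// mulr_gt0. Qed.

Lemma scaleG_gt0 g : (0 < g)%N -> 0 < scaleG g.
Proof. by move=> g0; rewrite powR_gt0// ltr0n. Qed.

Lemma scaleG_le g g' : (g <= g')%N -> scaleG g <= scaleG g'.
Proof. by move=> gg; rewrite ler_powRl// ?ler_nat// divr_ge0. Qed.

Lemma scaleY_ge0 g : 0 <= scaleY g.
Proof. by rewrite divr_ge0 ?mulr_ge0 ?powR_ge0// ltW. Qed.

(** By [kth_power_count] the left side bounds the number of [m <= scaleY g] with [g | m ^ k]. Since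
    [g <= Q], the factor [g ^ (1/k) * (2Q) ^ (-2/k)] is at most [Q ^ (-1/k)]. *)
Lemma scaleY_root_le g : (0 < g)%N -> g%:R <= Q ->
  scaleY g * g%:R `^ (- k%:R^-1) <= P * Q `^ (- k%:R^-1).
Proof.
move=> g0 gQ; have gR : 0 < g%:R :> R by rewrite ltr0n.
have kR : 0 < k%:R :> R by rewrite ltr0n.
rewrite /scaleY -!mulrA ler_wpM2l ?(ltW P0)//.
rewrite /scaleV -powRN mulrCA /scaleG -powRDp//.
have -> : 2 / k%:R + - k%:R^-1 = k%:R^-1 :> R by field; rewrite gt_eqF.
have -> : - k%:R^-1 = - (2 / k%:R) + k%:R^-1 :> R by field; rewrite gt_eqF.
rewrite [leRHS]powRDp//; apply: ler_pM; rewrite ?powR_ge0//; last first.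
  by rewrite ler_powRl// ?invr_ge0 ?ler0n.
rewrite !powRN lef_pV2 ?posrE ?powR_gt0 ?mulr_gt0//.
by rewrite ler_powRl ?divr_ge0 ?(ltW Q0)//; have := Q0; lra.
Qed.

(** Hölder is applied over the divisors [g] of [q], then over the stopping products of a given [g],
    of which there are at most [scaleY g * g ^ (-1/k)]. Adding nonnegative terms extends the sums to
    all [g <= Q] and all leaves; the indicator is [1] on the terms that come from [alpha]. *)
Lemma f_abs_powR_le alpha : Narcs k Q P alpha ->
  f_abs k P Rr alpha `^ s <= 2 `^ s * ((dQ * (P * Q `^ (- k%:R^-1))) `^ s +
   dQ `^ s * \sum_(g <- iota 1 (Num.truncn Q)) \sum_(m <- leaves g)
     (scaleY g * g%:R `^ (- k%:R^-1)) `^ (s - 1) *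
       (\1_(gcd_arcs g m) alpha * f_abs k (P / m%:R) (pdiv m)%:R ((m ^ k)%:R * alpha) `^ s)).
Proof.
move=> [[a0 [a1 [q [a [q0 [qQ [aq [caq qa]]]]]]]] _].
have V0 := scaleV_gt0.
pose gm (m : nat) := gcdn q (m ^ k).
have gm0 m : (0 < gm m)%N by rewrite gcdn_gt0 q0.
have gmq m : gm m \in divisors q by rewrite -dvdn_divisors// dvdn_gcdl.
have gmQ g : g \in divisors q -> (0 < g)%N /\ g%:R <= Q.
  rewrite -dvdn_divisors// => gq; have g0 := dvdn_gt0 q0 gq; split => //.
  by apply: le_trans qQ; rewrite ler_nat dvdn_leq.
pose stop (m : nat) := P * scaleG (gm m) < m%:R * Rr * scaleV.
have stop1 : stop 1%N = false.
  apply/negbTE; rewrite -leNgt /gm exp1n gcdn1 /scaleG powR1 mulr1 mul1r.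
  exact: RV.
pose F (x : nat) : C := ee (alpha * (x ^ k)%:R).
set A := smooth_set P Rr; set T := first_stop stop.
have uA : uniq A by exact: smooth_uniq.
pose fm (m : nat) := f_abs k (P / m%:R) (pdiv m)%:R ((m ^ k)%:R * alpha).
have fm0 m : 0 <= fm m by exact: f_abs_ge0.
pose U1 := (size [seq x <- A | T x == 0%N])%:R : R.
pose U2 := \sum_(m <- A | T m == m) fm m.
have fle : f_abs k P Rr alpha <= U1 + U2.
  rewrite f_absE (sum_smooth_first_stop _ _ F stop1).
  apply: le_trans (cabsD _ _) _; apply: lerD.
    apply: le_trans (cabs_sum _ _ _) _.
    under eq_bigr do rewrite cabs_ee.
    by rewrite big_const_seq iter_addr addr0 /U1 size_filter.
  apply: le_trans (cabs_sum _ _ _) _; apply: ler_sum => m _.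
  rewrite /fm f_absE le_eqVlt; apply/orP; left; apply/eqP; congr cabs.
  apply: eq_bigr => v _; rewrite /F; congr ee.
  by rewrite expnMn natrM; ring.
have U10 : 0 <= U1 by exact: ler0n.
have U20 : 0 <= U2 by exact: sumr_ge0.
have leY x g : x%:R * scaleV <= P * scaleG g -> x%:R <= scaleY g.
  by move=> H; rewrite /scaleY ler_pdivlMr.
have split_gcd (B : seq nat) (W : nat -> R) :
    \sum_(x <- B) W x = \sum_(g <- divisors q) \sum_(x <- B | gm x == g) W x.
  rewrite (exchange_big_dep xpredT)//=; apply: eq_bigr => x _.
  rewrite -big_filter (eq_filter (a2 := pred1 (gm x))); last by move=> g /=; rewrite eq_sym.
  by rewrite filter_pred1_uniq ?divisors_uniq// big_seq1.
have U1le : U1 <= dQ * (P * Q `^ (- k%:R^-1)).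
  rewrite /U1 -sum1_size natr_sum split_gcd.
  apply: (@le_trans _ _ (\sum_(g <- divisors q) (P * Q `^ (- k%:R^-1)))).
    rewrite big_seq [leRHS]big_seq; apply: ler_sum => g /gmQ[g0 gQ].
    apply: le_trans (scaleY_root_le g0 gQ).
    rewrite -big_filter big_const_seq count_predT iter_addr addr0.
    apply: kth_power_count => //; first by do 2! apply: filter_uniq.
      move=> x; rewrite 2!mem_filter => /andP[/eqP gx /andP[/eqP Tx xA]].
      have x0 := smooth_gt0 xA; split => //; first by rewrite -gx dvdn_gcdr.
      have := first_stop_eq0 stop1 x0 Tx; rewrite /stop gx => /negbT; rewrite -leNgt => H.
      apply: leY; apply: le_trans H; rewrite ler_wpM2r ?(ltW V0)//.
      by rewrite ler_peMr.
    exact: scaleY_ge0.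
  rewrite big_const_seq count_predT iter_addr addr0 -[leLHS]mulr_natl ler_wpM2r//.
    by rewrite mulr_ge0 ?powR_ge0// ltW.
  exact: HdQ.
pose wt (g : nat) := (scaleY g * g%:R `^ (- k%:R^-1)) `^ (s - 1).
have leafP m : m \in A -> T m = m -> m \in leaves (gm m).
  move=> mA Tm; have m0 := smooth_gt0 mA.
  have [m1 sm sd] := first_stop_fix stop1 m0 Tm.
  rewrite mem_filter mem_iota m0 add1n ltnS truncn_ge_nat ?(smooth_le mA) ?(ltW P0)//= andbT.
  have pR := smooth_pdiv mA m1.
  apply/and5P; split => //; first exact: dvdn_gcdr.
  have p0 : 0 < (pdiv m)%:R :> R by rewrite ltr0n pdiv_gt0.
  move/negbT: sd; rewrite /stop -leNgt => H.
  (* The gcd grows along divisibility, so the failed test at [m / pdiv m] also holds as an upper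
     bound in terms of [gm m]. *)
  have gd : (gm (m %/ pdiv m) <= gm m)%N.
    rewrite dvdn_leq// /gm dvdn_gcd dvdn_gcdl/=.
    apply: dvdn_trans (dvdn_gcdr _ _) _; rewrite dvdn_exp2r//.
    by rewrite dvdn_div// pdiv_dvd.
  have H2 : (m %/ pdiv m)%N%:R * Rr * scaleV <= P * scaleG (gm m).
    by apply: (le_trans H); rewrite ler_wpM2l ?scaleG_le// ltW.
  apply: le_trans H2; rewrite ler_wpM2r ?(ltW V0)//.
  by rewrite -[in leLHS](divnK (pdiv_dvd m)) natrM ler_wpM2l.
have U2le : U2 `^ s <= dQ `^ s * \sum_(g <- iota 1 (Num.truncn Q)) \sum_(m <- leaves g)
     wt g * (\1_(gcd_arcs g m) alpha * fm m `^ s).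
  rewrite /U2 -big_filter split_gcd.
  apply: le_trans (powR_sum_le _ s1 _) _; first by move=> g; exact: sumr_ge0.
  apply: ler_pM; rewrite ?powR_ge0 ?sumr_ge0//.
  - by move=> i _; exact: powR_ge0.
  - apply: (@le_trans _ _ (dQ `^ (s - 1))); first by rewrite ler_powRl ?HdQ// subr_ge0.
    by rewrite ler_powR// gerBl.
  apply: (@le_trans _ _ (\sum_(g <- divisors q) \sum_(m <- leaves g)
     wt g * (\1_(gcd_arcs g m) alpha * fm m `^ s))).
    rewrite big_seq [leRHS]big_seq; apply: ler_sum => g gq; have [g0 gQ] := gmQ g gq.
    rewrite -big_filter; set B := [seq i <- _ | _].
    have uB : uniq B by do 2! apply: filter_uniq.
    have BP m : m \in B -> [/\ m \in A, T m = m & gm m = g].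
      by rewrite 2!mem_filter => /andP[/eqP ? /andP[/eqP ? ?]].
    have Bl m : m \in B -> m \in leaves g by move=> /BP[mA Tm <-]; exact: leafP.
    have sB : (size B)%:R <= scaleY g * g%:R `^ (- k%:R^-1).
      apply: kth_power_count => //; last exact: scaleY_ge0.
      move=> m /Bl; rewrite mem_filter => /andP[/and5P[m1 gmk _ _ mV] _].
      by split => //; [exact: ltnW|exact: leY].
    apply: le_trans (powR_sum_le _ s1 _) _; first by [].
    rewrite -mulr_sumr; apply: ler_pM; rewrite ?powR_ge0 ?sumr_ge0//.
    - by move=> i _; exact: powR_ge0.
    - by rewrite ler_powRl// subr_ge0.
    apply: (@le_trans _ _ (\sum_(m <- B) \1_(gcd_arcs g m) alpha * fm m `^ s)).
      rewrite big_seq [leRHS]big_seq; apply: ler_sum => m /BP[_ _ gmE].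
      rewrite indicE mem_set ?mul1r//; split; first by rewrite /= in_itv/= a0.
      exists (q, a) => //; rewrite mem_filter/= caq -gmE eqxx/= mem_farey q0 qQ aq.
      by [].
    apply: ler_sum_sub => //; first by rewrite filter_uniq// iota_uniq.
    by move=> m; rewrite mulr_ge0 ?powR_ge0// indicE ler0n.
  apply: ler_sum_sub; [exact: divisors_uniq|exact: iota_uniq| |].
  - by move=> g /gmQ[g0 gQ]; rewrite mem_iota g0 add1n ltnS truncn_ge_nat// ltW.
  move=> g; apply: sumr_ge0 => m _; apply: mulr_ge0; first exact: powR_ge0.
  by apply: mulr_ge0; [rewrite indicE ler0n|exact: powR_ge0].
have f0 := f_abs_ge0 k P Rr alpha.
apply: le_trans (ler_powRl f0 fle s0) _.
apply: (@le_trans _ _ (2 `^ s * (U1 `^ s + U2 `^ s))).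
  have mx : U1 + U2 <= 2 * Num.max U1 U2.
    by case: (leP U1 U2) => H; lra.
  have mx0 : 0 <= Num.max U1 U2 by rewrite le_max U10.
  apply: le_trans (ler_powRl (addr_ge0 U10 U20) mx s0) _.
  rewrite powRM// ler_wpM2l ?powR_ge0//.
  by case: (leP U1 U2) => _; rewrite ?lerDl ?lerDr powR_ge0.
rewrite ler_wpM2l ?powR_ge0// lerD//.
exact: ler_powRl.
Qed.

End Pointwise.
End Descent.

(** * Integration over the arcs *)

Section Integration.
Local Open Scope classical_set_scope.
Variable R : realType.
Local Notation mu := (@lebesgue_measure R).

Lemma MarcsE k (Q P : R) :
  Marcs k Q P = arcs [seq p <- farey Q | coprime p.2 p.1] (Q / P ^+ k).
Proof.
apply/seteqP; split => x.
  move=> [x0 [x1 [q [a [q0 [qQ [aq [caq H]]]]]]]]; split; first by rewrite /= in_itv/= x0.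
  by exists (q, a) => //; rewrite mem_filter mem_farey caq q0 qQ aq.
move=> [+ [[q a]]]; rewrite /= in_itv/= mem_filter mem_farey/=.
move=> /andP[x0 x1] /andP[caq /and3P[q0 qQ aq]] H.
by split => //; split => //; exists q, a.
Qed.

Lemma measurable_Marcs k (Q P : R) : measurable (Marcs k Q P).
Proof.
rewrite MarcsE; apply: measurable_arcs => -[q a].
by rewrite mem_filter mem_farey => /andP[_ /and3P[]].
Qed.

Lemma measurable_Narcs k (Q P : R) : measurable (Narcs k Q P).
Proof. by apply: measurableD; exact: measurable_Marcs. Qed.

Lemma measure_Narcs_le k (Q P : R) : 0 <= Q -> 0 <= P ->
  (mu (Narcs k Q P) <= (4 * Q * (Q / P ^+ k))%:E)%E.
Proof.
move=> Q0 P0; apply: (@le_trans _ _ (mu (Marcs k Q P))).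
  apply: le_measure; rewrite ?inE; [exact: measurable_Narcs|exact: measurable_Marcs|].
  exact: subDsetl.
by rewrite MarcsE; apply: measure_arcs_le => //; rewrite divr_ge0 ?exprn_ge0.
Qed.

Lemma measurable_gcd_arcs k (P Q : R) g m : measurable (gcd_arcs k P Q g m).
Proof.
apply: measurable_arcs => -[q a].
by rewrite mem_filter mem_farey => /andP[_ /and3P[]].
Qed.

Lemma measurable_f_abs_scale k (P r c s : R) (D : set R) :
  measurable_fun D (fun x : R => f_abs k P r (c * x) `^ s).
Proof.
apply: measurable_funTS.
have H : measurable_fun setT (fun x : R => c * x) by exact: measurable_funM.
exact: (measurableT_comp (@measurable_f_abs_powR R k P r s setT) H).
Qed.

(** The pointwise bound takes care of the power [t] where the two sets meet. The power [u] is then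
    integrated over all of [gcd_arcs], on which the map [x -> m ^ k x] modulo one has fibres of at
    most [g] points. *)
Lemma integral_gcd_arcs_le k (P Q N r s t u B : R) (g m : nat) :
  (0 < m)%N -> (0 < g)%N -> 0 < P -> 0 <= Q -> 0 <= t -> 0 < u -> s = t + u ->
  4 * Q ^+ 2 * m%:R ^+ k <= g%:R ^+ 2 * P ^+ k -> 0 <= B ->
  (forall x, Narcs k Q P x -> gcd_arcs k P Q g m x -> f_abs k N r ((m ^ k)%:R * x) <= B) ->
  (\int[mu]_(x in Narcs k Q P)
     (\1_(gcd_arcs k P Q g m) x * f_abs k N r ((m ^ k)%:R * x) `^ s)%:E <=
   (B `^ t * (g%:R / (m ^ k)%:R))%:E * U k u N r)%E.
Proof.
move=> m0 g0 P0 Q0 t0 u0 -> HQ B0 HB.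
set E := gcd_arcs k P Q g m.
have mE : measurable E by exact: measurable_gcd_arcs.
have mN : measurable (Narcs k Q P) by exact: measurable_Narcs.
have indic0 (x : R) : 0 <= \1_E x :> R by rewrite indicE ler0n.
pose f1 (x : R) := \1_E x * f_abs k N r ((m ^ k)%:R * x) `^ (t + u).
pose f2 (x : R) := \1_E x * (B `^ t * f_abs k N r ((m ^ k)%:R * x) `^ u).
have mI (D : set R) : measurable_fun D (\1_E : R -> R).
  by apply: measurable_funTS; exact: measurable_indic.
have mf1 (D : set R) : measurable_fun D (fun x => (f1 x)%:E).
  apply/measurable_EFinP; apply: measurable_funM; first exact: mI.
  exact: measurable_f_abs_scale.
have mf2 (D : set R) : measurable_fun D (fun x => (f2 x)%:E).
  apply/measurable_EFinP; apply: measurable_funM; first exact: mI.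
  by apply: measurable_funM => //; exact: measurable_f_abs_scale.
have f20 x : 0 <= f2 x by rewrite /f2 mulr_ge0// mulr_ge0 ?powR_ge0.
apply: (@le_trans _ _ (\int[mu]_(x in Narcs k Q P) (f2 x)%:E)%E).
  apply: ge0_le_integral => //.
  - by move=> x _; rewrite lee_fin mulr_ge0 ?powR_ge0.
  - exact: mf1.
  - exact: mf2.
  move=> x Nx; rewrite lee_fin /f2 indicE.
  have [Ex|_] := boolP (x \in E); last by rewrite !mul0r.
  rewrite !mul1r powRD; last by apply/implyP => /eqP H; move: t0 u0; rewrite -H; lra.
  rewrite ler_wpM2r ?powR_ge0// ler_powRl ?f_abs_ge0// HB//.
  exact: set_mem.
apply: (@le_trans _ _ (\int[mu]_x (f2 x)%:E)%E).
  apply: ge0_subset_integral => //; first exact: mf2.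
  by move=> x _; rewrite lee_fin.
rewrite (_ : (\int[mu]_x (f2 x)%:E)%E =
   (\int[mu]_(x in E) ((B `^ t)%:E * (f_abs k N r ((m ^ k)%:R * x) `^ u)%:E))%E); last first.
  rewrite [RHS]integral_mkcond; apply: eq_integral => x _.
  rewrite patchE /f2 indicE; case: ifP => _; last by rewrite mul0r.
  by rewrite mul1r EFinM.
have Bt0 : 0 <= B `^ t by exact: powR_ge0.
have mf3 : measurable_fun E (fun x => (f_abs k N r ((m ^ k)%:R * x) `^ u)%:E).
  by apply/measurable_EFinP; exact: measurable_f_abs_scale.
have f30 (x : R) : E x -> (0 <= (f_abs k N r ((m ^ k)%:R * x) `^ u)%:E)%E.
  by move=> _; rewrite lee_fin powR_ge0.
have -> := ge0_integralZl_EFin mu mE f30 mf3 Bt0.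
rewrite EFinM -muleA; apply: lee_wpmul2l; first by rewrite lee_fin powR_ge0.
apply: (@ge0_integral_fold R (fun x => f_abs k N r x `^ u) (m ^ k) g%:R E).
- exact: measurable_f_abs_powR.
- by move=> x; exact: powR_ge0.
- by move=> x; rewrite f_absD1.
- by rewrite expn_gt0 m0.
- exact: ler0n.
- exact: mE.
- exact: subIsetl.
move=> c /andP[c0 _]; apply: arcs_fiber_count => //.
by move=> p /andP[_ /eqP].
Qed.

Section Sum.
Variables (k : nat) (s P Rr Q dQ : R).
Hypotheses (k0 : (0 < k)%N) (s2 : 2 <= s) (P1 : 1 <= P) (R1 : 1 <= Rr) (Q1 : 1 <= Q).
Hypothesis dQ1 : 1 <= dQ.
Hypothesis HdQ : forall q : nat, (0 < q)%N -> q%:R <= Q -> (size (divisors q))%:R <= dQ.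
Local Notation V := (scaleV k Q).
Local Notation G := (scaleG R k).
Local Notation Y := (scaleY k P Q).
Hypothesis RV : Rr * V <= P.

(** Keeping the bound [W] for one leaf abstract separates the exchange of sums and integral from the
    estimates at a single leaf. *)
Lemma integral_Narcs_le (W : nat -> nat -> R) :
  (forall g m, 0 <= W g m) ->
  (forall g m, (0 < g)%N -> g%:R <= Q -> m \in leaves k P Rr Q g ->
     (\int[mu]_(x in Narcs k Q P) (\1_(gcd_arcs k P Q g m) x *
        f_abs k (P / m%:R) (pdiv m)%:R ((m ^ k)%:R * x) `^ s)%:E <= (W g m)%:E)%E) ->
  (\int[mu]_(x in Narcs k Q P) (f_abs k P Rr x `^ s)%:E <=
   (2 `^ s * ((dQ * (P * Q `^ (- k%:R^-1))) `^ s * (4 * Q * (Q / P ^+ k)) +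
     dQ `^ s * \sum_(g <- iota 1 (Num.truncn Q)) \sum_(m <- leaves k P Rr Q g)
       (Y g * g%:R `^ (- k%:R^-1)) `^ (s - 1) * W g m))%:E)%E.
Proof.
move=> W0 HW.
have Q0 : 0 <= Q by exact: le_trans Q1.
have P0 : 0 <= P by exact: le_trans P1.
have mN : measurable (Narcs k Q P) by exact: measurable_Narcs.
pose c1 := (dQ * (P * Q `^ (- k%:R^-1))) `^ s.
pose wt g := (Y g * g%:R `^ (- k%:R^-1)) `^ (s - 1).
pose h g m (x : R) := \1_(gcd_arcs k P Q g m) x *
  f_abs k (P / m%:R) (pdiv m)%:R ((m ^ k)%:R * x) `^ s.
have h0 g m x : 0 <= h g m x by rewrite /h mulr_ge0 ?powR_ge0// indicE ler0n.
have mh g m (D : set R) : measurable_fun D (h g m).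
  apply: measurable_funM; last exact: measurable_f_abs_scale.
  by apply: measurable_funTS; apply: measurable_indic; exact: measurable_gcd_arcs.
have w0 g : 0 <= wt g by exact: powR_ge0.
pose S (x : R) : \bar R := (\sum_(g <- iota 1 (Num.truncn Q)) \sum_(m <- leaves k P Rr Q g)
  (wt g)%:E * (h g m x)%:E)%E.
have mwh g m : measurable_fun (Narcs k Q P) (fun x => ((wt g)%:E * (h g m x)%:E)%E).
  by apply: measurable_funeM; apply/measurable_EFinP; exact: mh.
have mS : measurable_fun (Narcs k Q P) S.
  by apply: emeasurable_sum => g; apply: emeasurable_sum => m.
have S0 x : (0 <= S x)%E.
  by apply: sume_ge0 => g _; apply: sume_ge0 => m _; rewrite -EFinM lee_fin mulr_ge0.
have c10 : 0 <= c1 by exact: powR_ge0.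
have d0 : 0 <= dQ `^ s by exact: powR_ge0.
have t0 : 0 <= 2 `^ s :> R by exact: powR_ge0.
have mdS : measurable_fun (Narcs k Q P) (fun x => ((dQ `^ s)%:E * S x)%E).
  exact: measurable_funeM.
apply: (@le_trans _ _ (\int[mu]_(x in Narcs k Q P)
    ((2 `^ s)%:E * (c1%:E + (dQ `^ s)%:E * S x)))%E).
  apply: ge0_le_integral => //.
  - by move=> x _; rewrite lee_fin powR_ge0.
  - exact: measurable_f_abs_powR_EFin.
  - by apply: measurable_funeM; apply: emeasurable_funD.
  move=> x Nx; rewrite /S.
  under eq_bigr => g _ do under eq_bigr => m _ do rewrite -EFinM.
  under eq_bigr => g _ do rewrite sumEFin.
  rewrite sumEFin -[((dQ `^ s)%:E * _)%E]EFinM -EFinD -EFinM lee_fin.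
  exact: f_abs_powR_le.
rewrite ge0_integralZl_EFin//; last 2 first.
- by move=> x _; rewrite adde_ge0// ?lee_fin// mule_ge0// lee_fin.
- exact: emeasurable_funD.
rewrite EFinM; apply: lee_wpmul2l; first by rewrite lee_fin.
rewrite ge0_integralD//; last by move=> x _; rewrite mule_ge0// lee_fin.
rewrite EFinD; apply: leeD.
  rewrite integral_cst// EFinM; apply: lee_wpmul2l; first by rewrite lee_fin.
  exact: measure_Narcs_le.
rewrite ge0_integralZl_EFin// EFinM; apply: lee_wpmul2l; first by rewrite lee_fin.
rewrite /S ge0_integral_sum//; last 2 first.
- by move=> g; apply: emeasurable_sum => m; exact: mwh.
- by move=> g x _; apply: sume_ge0 => m _; rewrite -EFinM lee_fin mulr_ge0.
rewrite -sumEFin big_seq [leRHS]big_seq; apply: lee_sum => g.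
rewrite mem_iota add1n ltnS => /andP[g0]; rewrite truncn_ge_nat// => gQ.
rewrite ge0_integral_sum//; last 2 first.
- by move=> m; exact: mwh.
- by move=> m x _; rewrite -EFinM lee_fin mulr_ge0.
rewrite -sumEFin big_seq [leRHS]big_seq; apply: lee_sum => m mg.
rewrite ge0_integralZl_EFin//; last 2 first.
- by move=> x _; rewrite lee_fin.
- by apply/measurable_EFinP; exact: mh.
by rewrite EFinM; apply: lee_wpmul2l; [rewrite lee_fin|exact: HW].
Qed.

Let Q0 : 0 < Q := lt_le_trans ltr01 Q1.
Let P0 : 0 < P := lt_le_trans ltr01 P1.
Let R0 : 0 < Rr := lt_le_trans ltr01 R1.
Let kR : 0 < k%:R :> R. Proof. by rewrite ltr0n. Qed.

(** The exponent [2 / k] in the scales makes [(V / G g) ^ k = 4 (Q / g) ^ 2]. A leaf has [P / m]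
    between [V / G g] and [Rr] times it, which is the range required by [pointwise_bound] with
    [Q / g] in place of [Q]. *)
Lemma leafP g m : (0 < g)%N -> g%:R <= Q -> m \in leaves k P Rr Q g ->
  [/\ [/\ (1 < m)%N, (g %| m ^ k)%N & (pdiv m)%:R <= Rr],
      1 <= P / m%:R, P / m%:R <= Rr * (V / G g),
      4 * (Q / g%:R) ^+ 2 <= (P / m%:R) ^+ k &
      (P / m%:R) ^+ k <= Rr ^+ k * (4 * (Q / g%:R) ^+ 2)].
Proof.
move=> g0 gQ; rewrite mem_filter => /andP[/and5P[m1 gm pm PG mV] _].
have m0 : 0 < m%:R :> R by rewrite ltr0n ltnW.
have gR : 0 < g%:R :> R by rewrite ltr0n.
have G0 : 0 < G g by exact: scaleG_gt0.
have V0 : 0 < V by rewrite powR_gt0// mulr_gt0.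
have Vk : V ^+ k = (2 * Q) ^+ 2.
  rewrite -powR_mulrn ?ltW// /scaleV -powRrM divfK ?gt_eqF//.
  by rewrite powR_mulrn// mulr_ge0// ltW.
have Gk : G g ^+ k = g%:R ^+ 2.
  by rewrite -powR_mulrn ?ltW// /scaleG -powRrM divfK ?gt_eqF// powR_mulrn.
have VGk : (V / G g) ^+ k = 4 * (Q / g%:R) ^+ 2.
  by rewrite expr_div_n Vk Gk; field; rewrite gt_eqF.
have lo : V / G g <= P / m%:R.
  by rewrite ler_pdivrMr// mulrAC ler_pdivlMr// mulrC.
have hi : P / m%:R <= Rr * (V / G g).
  rewrite ler_pdivrMr// mulrA mulrAC ler_pdivlMr//.
  by apply: ltW; rewrite [ltRHS]mulrAC [Rr * _]mulrC.
have VG1 : 1 <= V / G g.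
  rewrite ler_pdivlMr// mul1r ler_powRl ?divr_ge0 ?ler0n//.
  by apply: (le_trans gQ); have := Q0; lra.
have VG0 : 0 <= V / G g by exact: le_trans VG1.
have Pm0 : 0 <= P / m%:R by exact: le_trans lo.
split => //; first by rewrite (le_trans VG1).
  by rewrite -VGk; apply: lerXn2r.
by rewrite -VGk -exprMn; apply: lerXn2r => //; rewrite nnegrE mulr_ge0// ltW.
Qed.

End Sum.
End Integration.

(** * Proof of the theorem *)

Section Exponents.
Local Open Scope classical_set_scope.
Variable R : realType.

(** Writing every positive quantity as an exponential turns the power laws into an identity between
    exponents. *)
Lemma exponent_identity (k : nat) (s Ds P Rr Q g : R) : (0 < k)%N ->
  0 < P -> 0 < Rr -> 0 < Q -> 0 < g ->
  (P * g `^ (2 / k%:R) / (2 * Q) `^ (2 / k%:R) * g `^ (- k%:R^-1)) `^ s *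
    (g * P `^ (- k%:R) * (Rr * ((2 * Q) `^ (2 / k%:R) / g `^ (2 / k%:R))) `^ (s + Ds)) =
  Rr `^ (s + Ds) * 2 `^ (2 * Ds / k%:R) * P `^ (s - k%:R) * Q `^ (2 * Ds / k%:R) *
    g `^ (1 - s / k%:R - 2 * Ds / k%:R).
Proof.
move=> k0 P0 R0 Q0 g0.
have ex (x : R) : 0 < x -> exists y, x = expR y by move=> x0; exists (ln x); rewrite lnK.
have [p ->] := ex P P0; have [r ->] := ex Rr R0; have [q ->] := ex Q Q0.
have [l ->] := ex g g0; have [z ->] := ex 2 (ltr0Sn _ 1).
rewrite !(=^~ expRM, =^~ expRD, =^~ expRN); congr expR.
by field; rewrite pnatr_eq0 -lt0n.
Qed.

(** The hypothesis on [Q] is raised to the power [2 / k]; the conclusion says that the product [1]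
    does not stop. *)
Lemma scale_le (k : nat) (P Rr Q : R) : (0 < k)%N -> 1 <= P -> 1 <= Rr -> 0 < Q ->
  Q <= P `^ (k%:R / 2) * (Rr ^+ k)^-1 / 2 -> Rr * scaleV k Q <= P.
Proof.
move=> k0 P1 R1 Q0 HQ.
have kR : 0 < k%:R :> R by rewrite ltr0n.
have P0 : 0 < P by exact: lt_le_trans P1.
have R0 : 0 < Rr by exact: lt_le_trans R1.
have Rk0 : 0 < Rr ^+ k by rewrite exprn_gt0.
have H : Rr ^+ k * (2 * Q) <= P `^ (k%:R / 2).
  rewrite mulrC -ler_pdivlMr//; move: HQ; lra.
have X0 : 0 <= Rr ^+ k * (2 * Q) by rewrite mulr_ge0 ?mulr_ge0 ?exprn_ge0 ?(ltW R0) ?(ltW Q0).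
have E0 : 0 <= 2 / k%:R :> R by rewrite divr_ge0.
have := ler_powRl X0 H E0.
rewrite -powRrM (_ : k%:R / 2 * (2 / k%:R) = 1); last by field; rewrite gt_eqF.
rewrite powRr1 ?(ltW P0)// powRM ?mulr_ge0 ?exprn_ge0 ?(ltW R0) ?(ltW Q0)//.
rewrite -powR_mulrn ?(ltW R0)// -powRrM (_ : k%:R * (2 / k%:R) = 2); last by field; rewrite gt_eqF.
apply: le_trans.
by rewrite ler_wpM2r ?powR_ge0// le1r_powR// ler1n.
Qed.

Lemma harmonic_powR_le (k : nat) (e : R) : 0 < e -> exists2 C : R, 0 < C &
  forall P Q : R, 1 <= P -> 1 <= Q -> Q <= P `^ (k%:R / 2) ->
  \sum_(g <- iota 1 (Num.truncn Q)) g%:R^-1 <= C * P `^ e.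
Proof.
move=> e0; exists (1 + k%:R / 2 / e).
  by rewrite ltr_wpDr// divr_ge0 ?(ltW e0)// divr_ge0.
move=> P Q P1 Q1 QP; have P0 : 0 < P by exact: lt_le_trans P1.
have Q0 : 0 < Q by exact: lt_le_trans Q1.
have t0 : (0 < Num.truncn Q)%N by rewrite truncn_gt0.
have := harmonic_le R t0; rewrite /index_iota subn1 /= => H; apply: (le_trans H).
have : ln (Num.truncn Q)%:R <= k%:R / 2 * ln P.
  rewrite -ln_powR ler_ln ?posrE ?ltr0n ?powR_gt0//.
  by apply: le_trans QP; rewrite truncn_le ltW.
have lP := ln_le_powR e0 P1.
have k2 : 0 <= k%:R / 2 :> R by rewrite divr_ge0.
have := ler_wpM2l k2 lP.
have : 1 <= P `^ e by rewrite powR_ge1// ltW.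
have -> : (1 + k%:R / 2 / e) * P `^ e = P `^ e + k%:R / 2 * (e^-1 * P `^ e) by ring.
move: (ln _) (ln _) (P `^ e) => a b c; lra.
Qed.

Section Leaves.
Variables (k : nat) (s t u tau D P Rr Q C1 C2 e0 : R).
Hypotheses (k0 : (0 < k)%N) (s2 : 2 <= s) (P1 : 1 <= P) (R1 : 1 <= Rr) (Q1 : 1 <= Q).
Hypotheses (t0 : 0 <= t) (sE : s = t + u) (C10 : 0 < C1) (C20 : 0 < C2) (e00 : 0 < e0).
Let Ds := D - t * tau.
Hypothesis DsL : k%:R - s / 2 <= Ds.
Hypothesis Re : Rr <= P `^ e0.
Local Notation Y := (scaleY k P Q).

Definition leaf_bound (g m : nat) : R :=
  (C2 * (P / m%:R) `^ (1 - tau) * P `^ e0) `^ t * (g%:R / (m ^ k)%:R) *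
  (C1 * (P / m%:R) `^ (u - k%:R + D) * P `^ e0).

Lemma leaf_bound_ge0 g m : 0 <= leaf_bound g m.
Proof.
rewrite /leaf_bound; apply: mulr_ge0; first by rewrite mulr_ge0 ?powR_ge0// divr_ge0.
by rewrite !mulr_ge0 ?powR_ge0 ?(ltW C10).
Qed.

Hypothesis u2 : 2 <= u.
Hypothesis HP : forall (N r theta Q' : R) (q b : nat), 1 <= N -> N <= P -> 1 <= r -> r <= Rr ->
  4 * Q' ^+ 2 <= N ^+ k -> N ^+ k <= Rr ^+ k * (4 * Q' ^+ 2) ->
  (0 < q)%N -> coprime b q -> q%:R <= Q' -> `|q%:R * theta - b%:R| <= Q' / N ^+ k ->
  (Q' / 2 < q%:R \/ Q' / (2 * N ^+ k) < `|q%:R * theta - b%:R|) ->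
  f_abs k N r theta <= C2 * N `^ (1 - tau) * P `^ e0.
Hypothesis HU : forall N r : R, 1 <= N -> N <= P -> 1 <= r -> r <= Rr ->
  (U k u N r <= (C1 * N `^ (u - k%:R + D) * P `^ e0)%:E)%E.

(** For [x] near [a / q] with [gcd(q, m ^ k) = g], the point [m ^ k x] is near [a h / q'] with
    [q' = q / g] and [h = m ^ k / g], in lowest terms since [a] and [h] are prime to [q']. Errors
    are multiplied by [h], and [h Q / P ^ k = (Q / g) / N ^ k] for [N = P / m]. *)
Lemma integral_leaf_le g m : (0 < g)%N -> g%:R <= Q -> m \in leaves k P Rr Q g ->
  (\int[lebesgue_measure]_(x in Narcs k Q P) (\1_(gcd_arcs k P Q g m) x *
     f_abs k (P / m%:R) (pdiv m)%:R ((m ^ k)%:R * x) `^ s)%:E <= (leaf_bound g m)%:E)%E.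
Proof.
move=> g0 gQ mg; have [[m1 gm pR] N1 _ QN NQ] := leafP k0 R1 Q1 g0 gQ mg.
have m0 : (0 < m)%N by exact: ltnW.
have mR : 0 < m%:R :> R by rewrite ltr0n.
have gR : 0 < g%:R :> R by rewrite ltr0n.
have Q0 : 0 < Q by exact: lt_le_trans Q1.
have P0 : 0 < P by exact: lt_le_trans P1.
have Pk0 : 0 < P ^+ k by rewrite exprn_gt0.
have NP : P / m%:R <= P by rewrite ler_pdivrMr// ler_peMr ?(ltW P0)// ler1n.
have p1 : 1 <= (pdiv m)%:R :> R by rewrite ler1n pdiv_gt0.
have u0 : 0 < u by move: u2 => *; lra.
apply: (le_trans (@integral_gcd_arcs_le R k P Q (P / m%:R) (pdiv m)%:R s t u
  (C2 * (P / m%:R) `^ (1 - tau) * P `^ e0) g m m0 g0 P0 (ltW Q0) t0 u0 sE _ _ _)).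
- move: QN; rewrite !expr_div_n ler_pdivlMr ?exprn_gt0//.
  rewrite mulrA mulrAC ler_pdivrMr ?exprn_gt0//.
  by rewrite [_ * P ^+ k]mulrC.
- by rewrite !mulr_ge0 ?powR_ge0 ?(ltW C20).
- move=> x [[x0 [x1 _]] NM] [_ [[q a]]] /=.
  rewrite mem_filter mem_farey/= => /andP[/andP[caq /eqP gE] /and3P[q0 qQ aq]] H.
  pose q' := (q %/ g)%N; pose h := (m ^ k %/ g)%N.
  have qE : q = (q' * g)%N by rewrite divnK// -gE dvdn_gcdl.
  have mE : (m ^ k = h * g)%N by rewrite divnK.
  have q'0 : (0 < q')%N by move: q0; rewrite qE muln_gt0 => /andP[].
  have h0 : (0 < h)%N by rewrite divn_gt0// dvdn_leq// expn_gt0 m0.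
  have hR : 0 < h%:R :> R by rewrite ltr0n.
  have ch : coprime h q'.
    rewrite /coprime gcdnC -(eqn_pmul2r g0) mul1n muln_gcdl -qE -mE.
    exact/eqP.
  have cb : coprime (a * h) q'.
    by rewrite coprimeMl ch andbT; apply: coprime_dvdr caq; rewrite qE dvdn_mulr.
  have mER : m%:R ^+ k = h%:R * g%:R :> R by rewrite -natrX mE natrM.
  have bE : `|q'%:R * ((m ^ k)%:R * x) - (a * h)%:R| = h%:R * `|q%:R * x - a%:R|.
    rewrite -[in RHS](ger0_norm (ltW hR)) -normrM mE qE !natrM; congr `|_|.
    by ring.
  have NkE : (P / m%:R) ^+ k = P ^+ k / (h%:R * g%:R) by rewrite expr_div_n mER.
  have q'E : q'%:R = q%:R / g%:R :> R by rewrite qE natrM mulfK ?gt_eqF.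
  apply: (HP (Q' := Q / g%:R) (q := q') (b := (a * h)%N)) => //.
  - by rewrite q'E ler_wpM2r// invr_ge0 ltW.
  - rewrite bE NkE (_ : Q / g%:R / _ = h%:R * (Q / P ^+ k)); last first.
      by field; rewrite !gt_eqF.
    by rewrite ler_pM2l.
  (* If [q <= Q / 2], a small error would put [x] in the arcs of level [Q / 2], which [Narcs]
     excludes. *)
  have [qQ2|] := leP q%:R (Q / 2); last first.
    by move=> qQ2; left; rewrite q'E mulrAC ltr_pM2r// invr_gt0.
  right; rewrite bE NkE.
  rewrite (_ : Q / g%:R / _ = h%:R * (Q / 2 / P ^+ k)); last by field; rewrite !gt_eqF.
  rewrite ltr_pM2l// ltNge; apply/negP => H2; apply: NM.
  by split => //; split => //; exists q, a.
rewrite /leaf_bound [X in (_ <= X)%E]EFinM; apply: lee_wpmul2l; last exact: HU.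
by rewrite lee_fin mulr_ge0 ?powR_ge0// divr_ge0.
Qed.

(** With [1 / m ^ k] written as [(P / m) ^ k / P ^ k], the exponent of [P / m] is [s + Ds >= 0], so
    every leaf is bounded at the largest height [Rr * V / G g]. The number of leaves, at most [y],
    completes [y ^ (s - 1)] to [y ^ s]. *)
Lemma sum_leaf_bound_le g : (0 < g)%N -> g%:R <= Q ->
  \sum_(m <- leaves k P Rr Q g) (Y g * g%:R `^ (- k%:R^-1)) `^ (s - 1) * leaf_bound g m <=
  C2 `^ t * C1 * 2 `^ (2 * Ds / k%:R) * P `^ (e0 * (t + 1 + (s + Ds))) *
  (P `^ (s - k%:R) * Q `^ (2 * Ds / k%:R)) * g%:R^-1.
Proof.
move=> g0 gQ.
have Q0 : 0 < Q by exact: lt_le_trans Q1.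
have P0 : 0 < P by exact: lt_le_trans P1.
have R0 : 0 < Rr by exact: lt_le_trans R1.
have kR : 0 < k%:R :> R by rewrite ltr0n.
have gR : 0 < g%:R :> R by rewrite ltr0n.
have g1 : 1 <= g%:R :> R by rewrite ler1n.
have e_ge0 : 0 <= s + Ds by move: DsL s2 (ler0n R k) => *; lra.
set y := Y g * _.
have y0 : 0 <= y.
  by rewrite mulr_ge0 ?powR_ge0// divr_ge0 ?mulr_ge0 ?powR_ge0// ltW.
pose c := C2 `^ t * C1 * P `^ (e0 * (t + 1)).
have c0 : 0 <= c by rewrite !mulr_ge0 ?powR_ge0 ?(ltW C10).
set b := g%:R * P `^ (- k%:R) * (Rr * (scaleV k Q / scaleG R k g)) `^ (s + Ds).
have b0 : 0 <= b by rewrite !mulr_ge0 ?powR_ge0.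
have each m : m \in leaves k P Rr Q g -> leaf_bound g m <= c * b.
  move=> /(leafP k0 R1 Q1 g0 gQ)[[m1 _ _] N1 NR _ _].
  have m0 : 0 < m%:R :> R by rewrite ltr0n ltnW.
  have N0 : 0 < P / m%:R by exact: lt_le_trans N1.
  have mE : (m ^ k)%:R^-1 = (P / m%:R) `^ k%:R * P `^ (- k%:R) :> R.
    rewrite powRN !powR_mulrn ?(ltW P0) ?(ltW N0)// expr_div_n natrX.
    by field; rewrite !expf_neq0 ?gt_eqF.
  have -> : leaf_bound g m = c * (g%:R * P `^ (- k%:R) * (P / m%:R) `^ (s + Ds)).
    rewrite /leaf_bound mE /c.
    have eE : s + Ds = (1 - tau) * t + (k%:R + (u - k%:R + D)).
      by rewrite /Ds sE; ring.
    rewrite powRM ?mulr_ge0 ?powR_ge0 ?(ltW C20)// powRM ?powR_ge0 ?(ltW C20)//.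
    rewrite -[((P / m%:R) `^ _) `^ _]powRrM -[(P `^ e0) `^ t]powRrM.
    rewrite eE (powRDp ((1 - tau) * t))// (powRDp k%:R)// [e0 * (t + 1)]mulrDr mulr1 (powRDp (e0 * t))//.
    by ring.
  rewrite ler_wpM2l// /b ler_wpM2l ?mulr_ge0 ?powR_ge0//.
  by rewrite ler_powRl// ltW.
have count : (size (leaves k P Rr Q g))%:R <= y.
  apply: kth_power_count => //.
  - by rewrite filter_uniq// iota_uniq.
  - move=> m; rewrite mem_filter => /andP[/and5P[m1 gm _ _ mV] _].
    split => //; first exact: ltnW.
    by rewrite /scaleY ler_pdivlMr// powR_gt0// mulr_gt0.
  - exact: scaleY_ge0.
apply: (@le_trans _ _ (\sum_(m <- leaves k P Rr Q g) y `^ (s - 1) * (c * b))).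
  rewrite big_seq [leRHS]big_seq; apply: ler_sum => m mg.
  by rewrite ler_wpM2l ?powR_ge0// each.
rewrite big_const_seq count_predT iter_addr addr0 -[leLHS]mulr_natl.
apply: (@le_trans _ _ (y * (y `^ (s - 1) * (c * b)))).
  by rewrite ler_wpM2r// mulr_ge0 ?powR_ge0// mulr_ge0.
rewrite mulrA mulr_powRB1//; last by move: s2 => *; lra.
have -> : y `^ s * (c * b) = c * (y `^ s * b) by ring.
rewrite /y /b /scaleY /scaleV /scaleG (exponent_identity s Ds k0 P0 R0 Q0 gR).
have Rle : Rr `^ (s + Ds) <= P `^ (e0 * (s + Ds)).
  by rewrite powRrM ler_powRl// ltW.
(* The exponent is at most [-1] exactly when [k - s / 2 <= Ds]. *)
have gle : g%:R `^ (1 - s / k%:R - 2 * Ds / k%:R) <= g%:R^-1.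
  rewrite -[leRHS](powR_inv1 (ltW gR)) ler_powR//.
  have : 2 - s / k%:R <= 2 * Ds / k%:R.
    rewrite ler_pdivlMr// mulrBl divfK ?gt_eqF//; move: DsL => *; lra.
  move: (s / _) (2 * Ds / _) => a1 a2; lra.
have -> : C2 `^ t * C1 * 2 `^ (2 * Ds / k%:R) * P `^ (e0 * (t + 1 + (s + Ds))) *
   (P `^ (s - k%:R) * Q `^ (2 * Ds / k%:R)) * g%:R^-1 =
   c * (P `^ (e0 * (s + Ds)) * 2 `^ (2 * Ds / k%:R) * P `^ (s - k%:R) *
     Q `^ (2 * Ds / k%:R) * g%:R^-1).
  by rewrite /c (mulrDr e0 (t + 1)) (powRDp (e0 * (t + 1)))//; ring.
rewrite ler_wpM2l//; apply: ler_pM; rewrite ?mulr_ge0 ?powR_ge0//.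
by rewrite !ler_wpM2r ?powR_ge0.
Qed.

End Leaves.

End Exponents.

Local Open Scope classical_set_scope.

Theorem theorem5p2 (R : realType) (k : nat) (s : R) (Delta : R -> R)
    (tau Dstar : R) :
  (0 < k)%N -> 2 <= s ->
  (forall u : R, 2 <= u -> u <= s -> admissible k u (Delta u)) ->
  (forall w : nat, (0 < w)%N -> admissible k (2 * w%:R) (Delta (2 * w%:R))) ->
  is_tau k Delta tau ->
  is_minor_arc_exponent s Delta tau Dstar ->
  forall eps : R, 0 < eps -> exists eta : R, 0 < eta /\
    exists C P0 : R, forall P Rr Q : R,
      P0 <= P -> 2 <= Rr -> Rr <= P `^ eta ->
      1 <= Q -> Q <= P `^ (k%:R / 2) * (Rr ^+ k)^-1 / 2 ->
      (\int[lebesgue_measure]_(alpha in Narcs k Q P)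
          ((f_abs k P Rr alpha) `^ s)%:E
        <= (C * P `^ (s - k%:R + eps) * Q `^ (2 * Dstar / k%:R))%:E)%E.
Proof.
move=> k0 s2 admD admW [[w [w0 tauE]] _] [[t [t0 [ts DE]]] _] eps eps0.
have kR : 0 < k%:R :> R by rewrite ltr0n.
pose u := s - t.
have u2 : 2 <= u by rewrite /u; lra.
have sE : s = t + u by rewrite /u; ring.
have admu : admissible k u (Delta u) by apply: admD => //; rewrite /u; lra.
have DuL := admissible_lower k0 u2 admu.
(* The lower bound for [Delta (2 w)] makes the numerator of [tau] at most [2 w - k]. *)
have tau2 : tau <= 1 / 2.
  have w1 : 1 <= w%:R :> R by rewrite ler1n.
  have DwL : k%:R - w%:R <= Delta (2 * w%:R).
    have := admissible_lower k0 (_ : 2 <= 2 * w%:R) (admW w w0).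
    by rewrite [2 * w%:R / 2]mulrAC divff// mul1r; apply; lra.
  have w2 : w%:R <= w%:R ^+ 2 :> R by rewrite expr2 ler_peMr.
  have w2p : 0 < 4 * w%:R ^+ 2 :> R by rewrite mulr_gt0// exprn_gt0// ltr0n.
  by rewrite tauE ler_pdivrMr//; clear -w2 w1 DwL kR; lra.
(* Each unit of [t] costs at most [1/2], the rate at which [k - u / 2] varies, so the lower bound
   passes from order [u] to order [s]. *)
have DsL : k%:R - s / 2 <= Dstar.
  have : t * tau <= t * (1 / 2) by rewrite ler_wpM2l.
  by rewrite DE; move: DuL; rewrite /u; lra.
have sD0 : 0 <= s + Dstar by lra.
(* Losses in units of [e0]: [k / 2 * s] from the divisor bound, [t + 1] from the pointwise and mean
   value bounds, [s + Dstar] from powers of [Rr], one from the harmonic sum. *)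
pose M := k%:R / 2 * s + (t + 1 + (s + Dstar)) + 1.
have ks0 : 0 <= k%:R / 2 * s by rewrite mulr_ge0 ?divr_ge0//; lra.
have M0 : 0 < M by rewrite /M; lra.
pose e0 := eps / M; have e00 : 0 < e0 by rewrite divr_gt0.
have u0 : 0 <= u by lra.
have [eta1 eta10 [C1 C10 HC1]] := admissible_uniform u0 admu e00.
have [eta2 eta20 [C2 C20 HC2]] := pointwise_bound k0 w0 (admW w w0) e00.
have [C3 C31 HC3] := divisor_bound e00.
have [CH CH0 HCH] := harmonic_powR_le k e00.
rewrite -tauE in HC2.
exists (Num.min e0 (Num.min eta1 eta2)); split; first by rewrite !lt_min e00 eta10.
pose A := C2 `^ t * C1 * 2 `^ (2 * Dstar / k%:R).
(* The threshold [1] for [P] suffices because the uniform bounds have absorbed small heights into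
   their constants. *)
exists (2 `^ s * (C3 `^ s * (4 + A * CH))), 1 => P Rr Q P1 R2 RP Q1 HQ.
have P0 : 0 < P by lra.
have R1 : 1 <= Rr by lra.
have Q0 : 0 < Q by lra.
have Rle e : Num.min e0 (Num.min eta1 eta2) <= e -> Rr <= P `^ e.
  by move=> le; apply: (le_trans RP); exact: ler_powR.
have Re : Rr <= P `^ e0 by apply: Rle; rewrite ge_min lexx.
have Re1 : Rr <= P `^ eta1 by apply: Rle; rewrite !ge_min lexx orbT.
have Re2 : Rr <= P `^ eta2 by apply: Rle; rewrite !ge_min lexx !orbT.
have QP : Q <= P `^ (k%:R / 2).
  apply: (le_trans HQ); rewrite -mulrA ler_piMr ?powR_ge0//.
  rewrite -invfM invf_le1 ?mulr_gt0 ?exprn_gt0//; last by lra.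
  have : 1 <= Rr ^+ k by rewrite exprn_ege1.
  lra.
have RV := scale_le k0 P1 R1 Q0 HQ.
pose dQ := C3 * P `^ (k%:R / 2 * e0).
have ke0 : 0 <= k%:R / 2 * e0 by rewrite mulr_ge0 ?divr_ge0// ltW.
have dP1 : 1 <= P `^ (k%:R / 2 * e0) by rewrite powR_ge1.
have dQ1 : 1 <= dQ by exact: mulr_ege1.
have HdQ (q : nat) : (0 < q)%N -> q%:R <= Q -> (size (divisors q))%:R <= dQ.
  move=> q0 qQ; apply: (le_trans (HC3 q q0)).
  rewrite ler_wpM2l//; first by lra.
  by rewrite (powRrM P (k%:R / 2)) ler_powRl ?ler0n ?(ltW e00)// (le_trans qQ).
pose W := leaf_bound k t u tau (Delta u) P C1 C2 e0.
have HW g m : (0 < g)%N -> g%:R <= Q -> m \in leaves k P Rr Q g ->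
   (\int[lebesgue_measure]_(x in Narcs k Q P) (\1_(gcd_arcs k P Q g m) x *
     f_abs k (P / m%:R) (pdiv m)%:R ((m ^ k)%:R * x) `^ s)%:E <= (W g m)%:E)%E.
  apply: integral_leaf_le => //.
    by move=> N r theta Q' q b *; apply: (HC2 _ _ _ Rr _ Q' q b).
  by move=> N r N1 NP r1 rR; apply: HC1 => //; exact: le_trans Re1.
apply: (le_trans (integral_Narcs_le k0 s2 P1 R1 Q1 dQ1 HdQ RV _ HW)).
  by move=> g m; exact: leaf_bound_ge0.
rewrite lee_fin -2![leRHS]mulrA ler_wpM2l ?powR_ge0//.
pose T := P `^ (s - k%:R) * Q `^ (2 * Dstar / k%:R).
have T0 : 0 <= T by rewrite mulr_ge0 ?powR_ge0.
pose p := P `^ (e0 * (t + 1 + (s + Dstar))).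
have p1 : 1 <= p by rewrite powR_ge1// mulr_ge0 ?(ltW e00)//; lra.
have p0 : 0 <= p by exact: le_trans p1.
have pe1 : 1 <= P `^ e0 by rewrite powR_ge1// ltW.
have A0 : 0 <= A by rewrite !mulr_ge0 ?powR_ge0// ltW.
(* The measure [Q ^ 2 / P ^ k] of the arcs meets [(P Q ^ (-1/k)) ^ s]: the resulting exponent
   [2 - s / k] of [Q] is at most [2 Dstar / k], again by [DsL]. *)
have first_part : (dQ * (P * Q `^ (- k%:R^-1))) `^ s * (4 * Q * (Q / P ^+ k)) <=
    dQ `^ s * (4 * T).
  rewrite powRM ?mulr_ge0 ?powR_ge0 ?(ltW P0)//; last by lra.
  rewrite -mulrA ler_wpM2l ?powR_ge0//.
  rewrite (_ : _ * _ = 4 * (P `^ (s - k%:R) * Q `^ (2 - s / k%:R))); last first.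
    rewrite powRM ?powR_ge0 ?(ltW P0)// (powRDp s)// (powRN P) (powR_mulrn _ (ltW P0)).
    rewrite (powRDp 2)// (powR_mulrn 2 (ltW Q0)) -powRrM mulNr [k%:R^-1 * s]mulrC.
    by ring.
  rewrite ler_wpM2l// /T ler_wpM2l ?powR_ge0// ler_powR//.
  rewrite ler_pdivlMr// mulrBl divfK ?gt_eqF//; lra.
have second_part : \sum_(g <- iota 1 (Num.truncn Q)) \sum_(m <- leaves k P Rr Q g)
    (scaleY k P Q g * g%:R `^ (- k%:R^-1)) `^ (s - 1) * W g m <=
    A * CH * (p * P `^ e0) * T.
  apply: (@le_trans _ _ (\sum_(g <- iota 1 (Num.truncn Q)) A * p * T * g%:R^-1)).
    rewrite big_seq [leRHS]big_seq; apply: ler_sum => g.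
    rewrite mem_iota add1n ltnS => /andP[g0].
    rewrite truncn_ge_nat ?(ltW Q0)// => gQ.
    rewrite /A /p /T DE; apply: sum_leaf_bound_le => //.
    by rewrite -DE.
  rewrite -mulr_sumr (_ : A * CH * _ * T = A * p * T * (CH * P `^ e0)); last by ring.
  rewrite ler_wpM2l ?(mulr_ge0 (mulr_ge0 A0 p0))//; exact: HCH.
have dQE : dQ `^ s * (p * P `^ e0) = C3 `^ s * P `^ eps.
  rewrite /dQ powRM ?powR_ge0//; last by lra.
  rewrite -mulrA -powRrM -!powRDp//; congr (_ * _ `^ _).
  have <- : e0 * M = eps by rewrite divfK// gt_eqF.
  by rewrite /M; ring.
have d0 : 0 <= dQ `^ s by exact: powR_ge0.
have pp1 : 1 <= p * P `^ e0 by exact: mulr_ege1.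
apply: (@le_trans _ _ (dQ `^ s * (4 * T) + dQ `^ s * (A * CH * (p * P `^ e0) * T))).
  apply: lerD; first exact: first_part.
  by rewrite ler_wpM2l.
apply: (@le_trans _ _ (dQ `^ s * (p * P `^ e0) * ((4 + A * CH) * T))).
  rewrite -mulrDr -[leRHS]mulrA ler_wpM2l// [(4 + _) * T]mulrDl mulrDr.
  apply: lerD; first by rewrite ler_peMl// mulr_ge0.
  by rewrite le_eqVlt; apply/orP; left; apply/eqP; ring.
rewrite dQE /T [P `^ (s - k%:R + eps)]powRDp//.
by rewrite le_eqVlt; apply/orP; left; apply/eqP; ring.
Qed.
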